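(* Let $p$ be a prime, $k\ge 1$ an integer, and let $\xi$ be a $\mathbb{Z}_p$-valued random variable which is not constant modulo $p$. For each $n$ let $M_1,\dots,M_k$ be $k$ independent random matrices in $\mathrm{Mat}_n(\mathbb{Z}_p)$ with iid $\xi$-distributed entries. Then for any finite abelian $p$-group $B$, $$\lim_{n\to\infty}\mathbf{P}\big(\mathrm{Cok}(M_1\cdots M_k)\simeq B\big)=(p^{-1};p^{-1})_\infty^k\,\frac{\#\{0=G_0\le G_1\le\cdots\le G_k=B\}}{\#\mathrm{Aut}(B)},$$ where the numerator counts chains of nested subgroups of $B$ starting at $G_0=0$ and ending at $G_k=B$.
   Context: $\mathbb{Z}_p$ is the ring of $p$-adic integers. For $M\in\mathrm{Mat}_n(\mathbb{Z}_p)$, $\mathrm{Cok}(M)=\mathbb{Z}_p^n/M\mathbb{Z}_p^n$. $(a;q)_\infty:=\prod_{i\ge0}(1-aq^i)$. *)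

(* Defs.v *)
From HB Require Import structures.
From mathcomp Require Import all_boot all_order all_algebra all_fingroup all_solvable.
From mathcomp Require Import generic_quotient ring_quotient.
From mathcomp Require Import all_classical all_reals all_analysis.

Set Implicit Arguments.
Unset Strict Implicit.
Unset Printing Implicit Defensive.

Import Order.TTheory GRing.Theory Num.Theory.
Import numFieldNormedType.Exports.

Local Open Scope classical_set_scope.
Local Open Scope ring_scope.

(* [padic p] is the inverse limit of the rings Z/p^(n+1), n >= 0, along the
   reduction maps.  The exponent starts at 1 because 'Z_1 is not the zero ring
   in MathComp; for p > 1, 'Z_(p ^ n.+1) is the ring of integers mod p^(n+1).
   (For p <= 1 all these rings are 'Z_2 and [padic p] is a junk ring.) *)
Definition padic_coherent (p : nat) : pred (forall n, 'Z_(p ^ n.+1)) :=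
  fun x => `[< forall n, inZp (x n.+1) = x n >].

Record padic (p : nat) := Padic {
  padic_seq : forall n, 'Z_(p ^ n.+1);
  padic_seqP : padic_coherent padic_seq }.

HB.instance Definition _ p := [isSub for @padic_seq p].
HB.instance Definition _ p := [Choice of padic p by <:].

Section PadicRing.
Variable p : nat.
Implicit Types x y z : padic p.

Let trunc_dvd n : ((Zp_trunc (p ^ n.+1)).+2 %| (Zp_trunc (p ^ n.+2)).+2)%N.
Proof.
have [p_gt1|p_le1] := ltnP 1 p.
  have gt1 m : (1 < p ^ m.+1)%N by rewrite (leq_trans p_gt1)// -{1}(expn1 p) leq_pexp2l// ltnW.
  by rewrite !Zp_cast// dvdn_exp2l.
by case: p p_le1 => [|[|//]] _; rewrite ?exp0n ?exp1n.
Qed.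

Lemma padicE x n : inZp (padic_seq x n.+1) = padic_seq x n.
Proof. by have /asboolP := padic_seqP x; apply. Qed.

Lemma padic_eqP x y : (forall n, padic_seq x n = padic_seq y n) -> x = y.
Proof. by move=> h; apply: val_inj; apply: functional_extensionality_dep. Qed.

Let add_coherent x y : padic_coherent (fun n => padic_seq x n + padic_seq y n).
Proof.
apply/asboolP => n; rewrite -(padicE x n) -(padicE y n); apply: val_inj.
by rewrite /= modn_dvdm// modnDm.
Qed.

Let opp_coherent x : padic_coherent (fun n => - padic_seq x n).
Proof.
apply/asboolP => n; rewrite -(padicE x n); apply: val_inj.
rewrite /= modn_dvdm//; set a := nat_of_ord _.
have le_a : (a <= (Zp_trunc (p ^ n.+2)).+2)%N by rewrite ltnW// ltn_ord.
apply/eqP; rewrite -(eqn_modDr a) subnK// -(modnDmr _ a) subnK; last first.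
  by rewrite ltnW// ltn_mod.
by rewrite modnn (eqP (trunc_dvd n)).
Qed.

Let mul_coherent x y : padic_coherent (fun n => padic_seq x n * padic_seq y n).
Proof.
apply/asboolP => n; rewrite -(padicE x n) -(padicE y n); apply: val_inj.
by rewrite /= modn_dvdm// modnMm.
Qed.

Let zero_coherent : @padic_coherent p (fun n => 0).
Proof. by apply/asboolP => n; apply: val_inj; rewrite /= mod0n. Qed.

Let one_coherent : @padic_coherent p (fun n => 1).
Proof. by apply/asboolP => n; apply: val_inj; rewrite /= modn_small. Qed.

Definition padic_zero := Padic zero_coherent.
Definition padic_one := Padic one_coherent.
Definition padic_opp x := Padic (opp_coherent x).
Definition padic_add x y := Padic (add_coherent x y).
Definition padic_mul x y := Padic (mul_coherent x y).

Let addA : associative padic_add.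
Proof. by move=> x y z; apply: padic_eqP => n; exact: addrA. Qed.
Let addC : commutative padic_add.
Proof. by move=> x y; apply: padic_eqP => n; exact: addrC. Qed.
Let add0 : left_id padic_zero padic_add.
Proof. by move=> x; apply: padic_eqP => n; exact: add0r. Qed.
Let addN : left_inverse padic_zero padic_opp padic_add.
Proof. by move=> x; apply: padic_eqP => n; exact: addNr. Qed.

HB.instance Definition _ :=
  GRing.isZmodule.Build (padic p) addA addC add0 addN.

Let mulA : associative padic_mul.
Proof. by move=> x y z; apply: padic_eqP => n; exact: mulrA. Qed.
Let mulC : commutative padic_mul.
Proof. by move=> x y; apply: padic_eqP => n; exact: mulrC. Qed.
Let mul1 : left_id padic_one padic_mul.
Proof. by move=> x; apply: padic_eqP => n; exact: mul1r. Qed.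
Let mulD : left_distributive padic_mul padic_add.
Proof. by move=> x y z; apply: padic_eqP => n; exact: mulrDl. Qed.
Let one_neq0 : padic_one != padic_zero.
Proof. by apply/eqP => /(congr1 (fun x => padic_seq x 0)). Qed.

HB.instance Definition _ :=
  GRing.Zmodule_isComNzRing.Build (padic p) mulA mulC mul1 mulD one_neq0.

End PadicRing.

(* The residue classes mod p^(n+1) are the balls of the p-adic topology.  They
   form a countable base, so the sigma-algebra they generate is the Borel one. *)
Definition padic_balls (p : nat) : set_system (padic p) :=
  [set A | exists n (c : 'Z_(p ^ n.+1)), A = [set x | padic_seq x n = c]].

HB.instance Definition _ p := isPointed.Build (padic p) 0.
HB.instance Definition _ p := @isMeasurable.Build
  (sigma_display (@padic_balls p)) (padic p) <<s @padic_balls p >>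
  (@sigma_algebra0 _ setT (@padic_balls p))
  (@sigma_algebraC _ (@padic_balls p))
  (@sigma_algebra_bigcup _ setT (@padic_balls p)).

Section Cokernel.
Variables (R : comNzRingType) (n : nat) (M : 'M[R]_n).

Definition mulmx_image : pred 'cV[R]_n :=
  fun y => `[< exists x : 'cV[R]_n, y = M *m x >].

Let mulmx_image_zmod : zmod_closed mulmx_image.
Proof.
split; first by apply/asboolP; exists 0; rewrite mulmx0.
move=> _ _ /asboolP[x ->] /asboolP[y ->].
by apply/asboolP; exists (x - y); rewrite mulmxBr.
Qed.

HB.instance Definition _ :=
  GRing.isZmodClosed.Build 'cV[R]_n mulmx_image mulmx_image_zmod.

Definition Cok : zmodType := Quotient.quot (GRing.ZmodClosed.clone _ mulmx_image _).

Definition Cok_isog (gT : finGroupType) (B : {set gT}) : Prop :=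
  exists f : Cok -> gT,
    {morph f : x y / x + y >-> (x * y)%g} /\ set_bij [set: Cok] [set` B] f.

End Cokernel.

(* Residue mod p; 'Z_(p ^ 1) is convertible to 'Z_p. *)
Definition padic_modp (p : nat) (x : padic p) : 'Z_p := padic_seq x 0.

Definition constant_modp d (T : measurableType d) (R : realType)
    (P : probability T R) (p : nat) (X : T -> padic p) : Prop :=
  exists c : 'Z_p, P [set w | padic_modp (X w) = c] = 1%E.

Definition independent_RVs d d' (T : measurableType d) (U : measurableType d')
    (R : realType) (P : probability T R) (I : finType) (X : I -> T -> U) : Prop :=
  forall (J : {set I}) (A : I -> set U),
    (forall i, i \in J -> measurable (A i)) ->
    P (\bigcap_(i in [set` J]) (X i @^-1` A i)) =
    (\prod_(i in J) P (X i @^-1` A i))%E.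

Definition qpoch_inf (R : realType) (a q : R) : R :=
  limn (fun N => \prod_(0 <= i < N) (1 - a * q ^+ i)).

Definition subgroup_chains (gT : finGroupType) (B : {group gT}) (k : nat) :
    {set {ffun 'I_k.+1 -> {group gT}}} :=
  [set G : {ffun 'I_k.+1 -> {group gT}} | [&& G ord0 == 1%G, G ord_max == B &
    [forall i : 'I_k, G (widen_ord (leqnSn k) i) \subset G (lift ord0 i)]]]%SET.

(* Main.v *)
(** Let |B| = p^m and R = Z/p^(m+1).  Whether Cok(M) is isomorphic to B depends only
    on A := M mod p^(m+1): embed B as a subgroup C of a power R^s; the event says that
    some f : R^n -> R^s with image C has kernel im A, and there are exactly #Aut(C)
    such f when there is one.  So #Aut(B) P(Cok(M) = B) is the expected number of f onto C
    with ker f = im A.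

    Universality.  For an r x n matrix F over R, let P_mu(F) be the probability that
    F M_1...M_k = 0, for entries of law mu.  As mu is not constant mod p, its nontrivial
    Fourier coefficients are bounded by some rho < 1, and this makes the sum over all F of
    |P_mu(F) - P_unif(F)| tend to 0 for fixed r.  Let p^j be the index of
    im A + p ker f in ker f, so that f is counted iff f A = 0 and j = 0.  The powers of p^j,
    averaged over A and summed over f, are sums of P_mu(F) over families of F with
    s + l rows, hence have asymptotically the same value for mu and for the uniform law.
    The indicator of j = 0 is squeezed between consecutive polynomials
    prod_(1 <= i <= l) (p^i - Y) / (p^i - 1) in Y = p^j, with an error of at most
    p^(j l - l (l - 1) / 2).  The sum over f of the expectation of p^(j l) is at most a constant
    times the number of chains of k subgroups of R^(s + l) that meet 0 x R^l in p-torsion, which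
    is p^(k l^2 / (2 (k + 1)) + O(l)), so the error is negligible for large l.

    Uniform law.  The image of M_1...M_k equals V, for V containing p^m R^n, with probability
    c_n^k [R^n : V]^(-n) times the number of chains from V to R^n, where c_n is the
    probability that a uniform n x n matrix is invertible, and c_n tends to (1/p; 1/p)_oo. *)
Require Import Defs.
From HB Require Import structures.
From mathcomp Require Import all_boot all_order all_algebra all_fingroup all_solvable.
From mathcomp Require Import separable algC cyclotomic complex generic_quotient ring_quotient.
From mathcomp Require Import zify ring lra.
Set Implicit Arguments.
Unset Strict Implicit.
Unset Printing Implicit Defensive.
Import Order.TTheory GRing.Theory Num.Theory FinRing.Theory.
Local Open Scope ring_scope.

(** The modulus has one spare power of p: modulo p^m a cyclic B of order p^m could not be told apart
    from a larger cyclic group. Modulo p^(m+1) the group C is still killed by p^m, so ker f contains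
    p^m R^n, and Nakayama's lemma lifts this to Z_p.

    The obstacle to universality is that there are q^(r n) matrices F, so a bound on the Fourier
    error that is uniform in F is lost in the sum. The error at F is large only if some v outside
    the left kernel of F has few nonzero entries in v F, and such F are rare; for the other F the
    error is small relative to the size of the uniform probability. Since F, F M_1, F M_1 M_2, ...
    is a Markov chain, an l^1 bound on one step propagates by induction on k: the total mass under
    the uniform law is at most a number of chains of subgroups, which does not depend on n.

    The sieve divides by p^(l (l - 1) / 2) while the moments are of size p^(k l^2 / (2 (k + 1)));
    that k / (k + 1) < 1 is what makes it converge for every k. Its remainder under the uniform law
    is bounded uniformly in n, so l is chosen first and n tends to infinity afterwards. *)

Section MatrixSums.
Variables (T : finType) (K : comNzRingType).

Lemma sum_cV_prod (a : nat) (g : 'I_a -> T -> K) :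
  \sum_(x : 'cV[T]_a) \prod_i g i (x i ord0) = \prod_i \sum_c g i c.
Proof.
rewrite bigA_distr_bigA /= (reindex (fun f : {ffun 'I_a -> T} => \col_i f i)) /=.
  by apply: eq_bigr => f _; apply: eq_bigr => i _; rewrite mxE.
exists (fun x : 'cV[T]_a => [ffun i => x i ord0]) => f _.
  by apply/ffunP => i; rewrite ffunE mxE.
by apply/colP => i; rewrite mxE ffunE.
Qed.

Lemma sum_mx_prod_col (a b : nat) (g : 'I_b -> 'cV[T]_a -> K) :
  \sum_(A : 'M[T]_(a, b)) \prod_j g j (col j A) = \prod_j \sum_x g j x.
Proof.
rewrite bigA_distr_bigA /=.
rewrite (reindex (fun f : {ffun 'I_b -> 'cV[T]_a} => \matrix_(i, j) f j i ord0)) /=.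
  apply: eq_bigr => f _; apply: eq_bigr => j _; congr (g j _).
  by apply/colP => i; rewrite !mxE.
exists (fun A : 'M[T]_(a, b) => [ffun j => col j A]) => f _.
  by apply/ffunP => j; rewrite ffunE; apply/colP => i; rewrite !mxE.
by apply/matrixP => i j; rewrite mxE ffunE mxE.
Qed.

Definition mweight (mu : T -> K) (a b : nat) (A : 'M[T]_(a, b)) : K :=
  \prod_j \prod_i mu (A i j).

Lemma mweight_cols mu (a b : nat) (A : 'M[T]_(a, b)) :
  mweight mu A = \prod_j mweight mu (col j A).
Proof.
apply: eq_bigr => j _; rewrite /mweight big_ord1.
by apply: eq_bigr => i _; rewrite mxE.
Qed.

Lemma sum_mweight mu (a b : nat) :
  \sum_c mu c = 1 -> \sum_(A : 'M[T]_(a, b)) mweight mu A = 1.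
Proof.
move=> mu1; under eq_bigr => A _ do rewrite mweight_cols.
rewrite (sum_mx_prod_col (fun=> @mweight mu a 1)) big1 // => j _.
under eq_bigr => x _ do rewrite /mweight big_ord1.
by rewrite (sum_cV_prod (fun=> mu)) big1.
Qed.

End MatrixSums.

Lemma mweight_ge0 (T : finType) (K : numDomainType) (mu : T -> K) (a b : nat)
    (A : 'M[T]_(a, b)) : (forall c, 0 <= mu c) -> 0 <= mweight mu A.
Proof. by move=> mu0; apply: prodr_ge0 => j _; apply: prodr_ge0. Qed.

(** X^n - 1 is separable in characteristic 0, so it has n distinct roots, enough to contain a
    primitive one. This serves both [algC], for counting subgroups, and [K[i]], for the laws on
    ['Z_q]. *)
Lemma closed_prim_root_exists (L : numClosedFieldType) n (n_gt0 : (0 < n)%N) :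
  {z : L | n.-primitive_root z}.
Proof.
apply: sigW; have [rs] := closed_field_poly_normal ('X^n - 1 : {poly L}).
rewrite (monicP (monicXnsubC 1 n_gt0)) scale1r => Ers.
have uniq_rs : uniq rs.
  by rewrite -separable_prod_XsubC -Ers separable_Xn_sub_1 // pnatr_eq0 -lt0n.
have unity_rs : all n.-unity_root rs by apply/allP => z; rewrite -root_prod_XsubC -Ers.
have size_rs : (n <= size rs)%N by rewrite -ltnS -(size_prod_XsubC rs id) -Ers size_XnsubC.
by have /hasP[z] := has_prim_root n_gt0 unity_rs uniq_rs size_rs; exists z.
Qed.

(** * Fourier analysis over Z/q *)

Section Characters.
Variables (q : nat) (L : numClosedFieldType).
Hypothesis q_gt1 : (1 < q)%N.
Let q_gt0 : (0 < q)%N. Proof. exact: ltnW. Qed.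

Definition zeta : L := sval (closed_prim_root_exists L q_gt0).
Definition echar (a : 'Z_q) : L := zeta ^+ a.

Lemma zetaP : q.-primitive_root zeta.
Proof. exact: svalP (closed_prim_root_exists L q_gt0). Qed.

Lemma echar0 : echar 0 = 1. Proof. by rewrite /echar expr0. Qed.

Lemma echarD a b : echar (a + b) = echar a * echar b.
Proof.
rewrite /echar -exprD -(prim_expr_mod zetaP (a + b)%N) /=.
by congr (_ ^+ (_ %% _)); exact: Zp_cast.
Qed.

Lemma echar_eq1 a : (echar a == 1) = (a == 0).
Proof.
rewrite /echar -(prim_order_dvd zetaP) -val_eqE /=.
have a_lt : (a < q)%N by rewrite -[X in (_ < X)%N](Zp_cast q_gt1) ltn_ord.
apply/idP/eqP => [|->]; last exact: dvdn0.
by rewrite /dvdn modn_small // => /eqP.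
Qed.

Lemma echar_norm a : `|echar a| = 1.
Proof.
rewrite /echar normrX; suff -> : `|zeta| = 1 by rewrite expr1n.
apply/eqP; rewrite -(pexpr_eq1 q_gt0) ?normr_ge0 // -normrX.
by rewrite (prim_expr_order zetaP) normr1.
Qed.

(** Orthogonality: if [f x0] is nonzero for some [x0] in [G], translating by [x0] multiplies the sum
    by [echar (f x0)], which differs from 1. *)
Lemma sum_echar (U : finZmodType) (G : {group U}) (f : U -> 'Z_q) :
    {morph f : x y / x + y} ->
  \sum_(x in G) echar (f x) = if [forall (x | x \in G), f x == 0] then #|G|%:R else 0.
Proof.
move=> fD; case: ifP => [/forall_inP f0|/negbT].
  under eq_bigr => x Gx do rewrite (eqP (f0 x Gx)) echar0.
  by rewrite sumr_const.
rewrite negb_forall_in => /exists_inP[x0 Gx0 fx0].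
set S := \sum_(x in G) _; have : S = echar (f x0) * S.
  rewrite mulr_sumr {1}/S (reindex_inj (addrI x0)) /=.
  apply: eq_big => [x|x _]; first by rewrite -zmodMgE groupMl.
  by rewrite fD echarD.
move/eqP; rewrite -subr_eq0 -{1}[S]mul1r -mulrBl mulf_eq0 subr_eq0 eq_sym echar_eq1.
by rewrite (negbTE fx0) => /eqP.
Qed.

End Characters.

Lemma mx11_eq0 (R : nmodType) (A : 'M[R]_1) : (A == 0) = (A 0 0 == 0).
Proof.
apply/eqP/eqP => [->|A0]; first by rewrite mxE.
by apply/matrixP => i j; rewrite !ord1 A0 mxE.
Qed.

Section Duality.
Variable q : nat.
Hypothesis q_gt1 : (1 < q)%N.
Local Notation R := 'Z_q.

Lemma card_Zq : #|{: R}| = q. Proof. by rewrite card_ord Zp_cast. Qed.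
Lemma card_cVq r : #|{: 'cV[R]_r}| = (q ^ r)%N. Proof. by rewrite card_mx card_Zq muln1. Qed.
Lemma card_rVq r : #|{: 'rV[R]_r}| = (q ^ r)%N. Proof. by rewrite card_mx card_Zq mul1n. Qed.

Definition perp r (G : {set 'cV[R]_r}) : {set 'rV[R]_r} :=
  [set v : 'rV[R]_r | [forall (x | x \in G), v *m x == 0]].

Lemma perpP r (G : {set 'cV[R]_r}) (v : 'rV[R]_r) :
  reflect (forall x, x \in G -> v *m x = 0) (v \in perp G).
Proof.
rewrite inE; apply: (iffP forall_inP) => h x Gx; first exact/eqP/h.
by apply/eqP/h.
Qed.

Lemma sum_echar_rV (L : numClosedFieldType) r (y : 'cV[R]_r) :
  \sum_(v : 'rV[R]_r) echar L q_gt1 ((v *m y) 0 0) = if y == 0 then (q ^ r)%:R else 0.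
Proof.
rewrite (eq_bigl [in [set: 'rV[R]_r]%G]) => [|v]; last by rewrite inE.
rewrite sum_echar => [|u v]; last by rewrite mulmxDl mxE.
rewrite cardsT card_rVq; congr (if _ then _ else _).
apply/forall_inP/eqP => [h|-> v _]; last by rewrite mulmx0 mxE.
apply/colP => i; rewrite mxE; have := h (delta_mx 0 i); rewrite inE => /(_ isT)/eqP.
by rewrite -rowE mxE.
Qed.

(** Double counting of the characters of v x over all v and all x in [G]: summing over v first
    leaves only x = 0, summing over x first leaves only v in [perp G]. *)
Lemma card_perp_mul r (G : {group 'cV[R]_r}) : (#|G| * #|perp G| = q ^ r)%N.
Proof.
apply/eqP; rewrite -(eqr_nat algC); apply/eqP.
have := erefl (\sum_(v : 'rV[R]_r) \sum_(x in G) echar algC q_gt1 ((v *m x) 0 0)).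
rewrite {1}exchange_big /=.
under eq_bigr => x _ do rewrite sum_echar_rV.
rewrite -big_mkcondr /= (big_pred1 0) => [|x]; last first.
  by rewrite /= andbC; case: eqP => //= ->; rewrite -zmod1gE group1.
move=> ->.
have row_sum (v : 'rV[R]_r) : \sum_(x in G) echar algC q_gt1 ((v *m x) 0 0) =
    if v \in perp G then #|G|%:R else 0.
  rewrite sum_echar => [|x y]; last by rewrite mulmxDr mxE.
  by rewrite inE; congr (if _ then _ else _); apply: eq_forallb => x; rewrite mx11_eq0.
under eq_bigr => v _ do rewrite row_sum.
by rewrite -big_mkcond /= sumr_const natrM mulr_natr.
Qed.

End Duality.

Section ColumnLaw.
Variables (q : nat) (K : rcfType).
Hypothesis q_gt1 : (1 < q)%N.
Local Notation R := 'Z_q.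
Let q_gt0 : (0 < q)%N. Proof. exact: ltnW. Qed.
Local Notation e := (echar K[i] q_gt1).

Definition colpr (mu : R -> K) r n (F : 'M[R]_(r, n)) (y : 'cV[R]_r) : K :=
  \sum_(x : 'cV[R]_n | F *m x == y) mweight mu x.

Definition mxpr (mu : R -> K) r n m (F : 'M[R]_(r, n)) (F' : 'M[R]_(r, m)) : K :=
  \sum_(A : 'M[R]_(n, m) | F *m A == F') mweight mu A.

Definition unif (c : R) : K := q%:R^-1.

Definition hw n (w : 'rV[R]_n) : nat := #|[set j | w 0 j != 0]|.

Definition rker r n (F : 'M[R]_(r, n)) : {set 'rV[R]_r} := [set v : 'rV[R]_r | v *m F == 0].

Lemma unif_ge0 c : 0 <= unif c. Proof. by rewrite invr_ge0 ler0n. Qed.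

Lemma sum_unif : \sum_c unif c = 1.
Proof.
rewrite sumr_const card_Zq // -[_ *+ q]mulr_natr mulVf //.
by rewrite pnatr_eq0 -lt0n.
Qed.

Lemma mxpr_cols mu r n m (F : 'M[R]_(r, n)) (F' : 'M[R]_(r, m)) :
  mxpr mu F F' = \prod_j colpr mu F (col j F').
Proof.
rewrite /mxpr big_mkcond /=.
pose g j (x : 'cV[R]_n) := if F *m x == col j F' then mweight mu x else 0.
under [RHS]eq_bigr => j _ do rewrite /colpr big_mkcond /=.
have colM (A : 'M[R]_(n, m)) j : F *m col j A = col j (F *m A) by rewrite !colE mulmxA.
rewrite -(sum_mx_prod_col g); apply: eq_bigr => A _; rewrite /g.
have [eqF|neqF] := eqVneq (F *m A) F'.
  rewrite mweight_cols; apply: eq_bigr => j _.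
  by rewrite colM eqF eqxx.
have [j neqj] : exists j, col j (F *m A) != col j F'.
  apply/existsP; apply: contraR neqF => /existsPn h; apply/eqP/matrixP => i j.
  by move/negPn/eqP/colP/(_ i): (h j); rewrite !mxE.
by rewrite (bigD1 j) //= colM (negbTE neqj) mul0r.
Qed.

Section Fourier.
Variable mu : R -> K.

Definition phi (a : R) : K[i] := \sum_c (mu c)%:C%C * e (a * c).

Lemma echar_sum n (f : 'I_n -> R) : e (\sum_j f j) = \prod_j e (f j).
Proof. by elim/big_ind2: _ => [|x y z t <- <-|//]; rewrite ?echar0 ?echarD. Qed.

(** Expand the indicator of F x = y in characters of R^r; the independence of the entries of x turns
    each term into a product of values of [phi]. *)
Lemma colpr_fourier r n (F : 'M[R]_(r, n)) (y : 'cV[R]_r) :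
  (colpr mu F y)%:C%C = (q ^ r)%:R^-1 *
    \sum_(v : 'rV[R]_r) e (- ((v *m y) 0 0)) * \prod_j phi ((v *m F) 0 j).
Proof.
have prod_phi (w : 'rV[R]_n) :
    \prod_j phi (w 0 j) = \sum_(x : 'cV[R]_n) (mweight mu x)%:C%C * e ((w *m x) 0 0).
  rewrite -(sum_cV_prod (fun j c => (mu c)%:C%C * e (w 0 j * c))).
  apply: eq_bigr => x _; rewrite big_split /= -rmorph_prod mxE echar_sum.
  by rewrite /mweight big_ord1.
under eq_bigr => v _ do rewrite prod_phi mulr_sumr.
rewrite exchange_big /= /colpr rmorph_sum big_mkcond /= mulr_sumr.
apply: eq_bigr => x _.
under eq_bigr => v _.
  rewrite mulrCA -echarD -mulmxA addrC.
  have -> : (v *m (F *m x)) 0 0 - (v *m y) 0 0 = (v *m (F *m x - y)) 0 0.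
    by rewrite mulmxBr !mxE.
  over.
rewrite -mulr_sumr sum_echar_rV subr_eq0; case: eqP => _; last by rewrite !mulr0.
by rewrite mulrCA mulVf ?mulr1 // pnatr_eq0 -lt0n expn_gt0 q_gt0.
Qed.

Hypothesis mu_ge0 : forall c, 0 <= mu c.
Hypothesis mu_sum : \sum_c mu c = 1.

Lemma phi0 : phi 0 = 1.
Proof.
rewrite /phi; under eq_bigr => c _ do rewrite mul0r echar0 mulr1.
by rewrite -rmorph_sum mu_sum.
Qed.

(** Equality in the triangle inequality for [phi a] would align the terms of [c1] and [c2], so that
    a (c1 - c2) = 0; as c1 - c2 is a unit, a = 0. The maximum over the finitely many nonzero a is
    then below 1. *)
Lemma phi_gap (c1 c2 : R) : 0 < mu c1 -> 0 < mu c2 -> (c1 - c2) \is a GRing.unit ->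
  exists2 rho : K, 0 <= rho < 1 & forall a, a != 0 -> `|phi a| <= rho%:C%C.
Proof.
move=> mu1 mu2 uc.
have c12 : c2 != c1 by apply: contraTneq uc => ->; rewrite subrr unitr0.
have lt1 a : a != 0 -> `|phi a| < 1.
  move=> a0; have nE c : `|(mu c)%:C%C * e (a * c)| = (mu c)%:C%C.
    by rewrite normrM echar_norm mulr1 ger0_norm // ler0c.
  have sum1 : \sum_c `|(mu c)%:C%C * e (a * c)| = 1.
    by under eq_bigr => c _ do rewrite nE; rewrite -rmorph_sum mu_sum.
  rewrite lt_neqAle -{2}sum1 ler_norm_sum andbT -sum1; apply/eqP.
  move=> /normC_sum_eq[t _ Ft].
  have := Ft c1 isT; have := Ft c2 isT; rewrite !nE => E2 E1.
  have m1 : (mu c1)%:C%C != 0 :> K[i] by rewrite (gt_eqF _) // ltcR.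
  have m2 : (mu c2)%:C%C != 0 :> K[i] by rewrite (gt_eqF _) // ltcR.
  have := mulfI m1 E1; rewrite -(mulfI m2 E2) => E.
  have : e (a * (c1 - c2)) = 1.
    apply: (@mulIf _ (e (a * c2))); first by rewrite -normr_gt0 echar_norm.
    by rewrite -echarD mul1r -mulrDr subrK.
  move/eqP; rewrite echar_eq1 => /eqP aE.
  by move: a0; rewrite -(mulrK uc a) aE mul0r eqxx.
exists (\big[Num.max/0]_(a | a != 0) Normc.normc (phi a)); last first.
  by move=> a a0; rewrite /Num.norm /= lecR; apply: le_bigmax_cond.
apply/andP; split; first exact: bigmax_ge_id.
apply/bigmax_ltP; split=> // a /lt1; rewrite /Num.norm /=.
by rewrite (_ : 1 = (1 : K)%:C%C) // ltcR.
Qed.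

End Fourier.

Lemma phi_unif a : phi unif a = (a == 0)%:R.
Proof.
rewrite /phi /unif -mulr_sumr (eq_bigl [in [set: R]%G]) => [|v]; last by rewrite inE.
rewrite sum_echar => [|x y]; last by rewrite mulrDr.
rewrite cardsT card_Zq //.
have -> : [forall (x | x \in [set: R]%G), a * x == 0] = (a == 0).
  apply/forall_inP/eqP => [h|-> x _]; last by rewrite mul0r.
  by have := h 1; rewrite inE mulr1 => /(_ isT)/eqP.
case: eqP => _; last by rewrite mulr0.
by rewrite fmorphV /= rmorph_nat mulVf // pnatr_eq0 -lt0n.
Qed.

Lemma prod_phi_unif r n (F : 'M[R]_(r, n)) (v : 'rV[R]_r) :
  \prod_j phi unif ((v *m F) 0 j) = (v \in rker F)%:R.
Proof.
rewrite inE; have [->|] := eqVneq (v *m F) 0.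
  by rewrite big1 // => j _; rewrite mxE phi_unif eqxx.
move=> vF; have [j vFj] : exists j, (v *m F) 0 j != 0.
  apply/existsP; apply: contraR vF => /existsPn h; apply/eqP/rowP => j.
  by rewrite [RHS]mxE; apply/eqP/negPn/h.
by rewrite (bigD1 j) //= phi_unif (negbTE vFj) mul0r.
Qed.

Lemma hw_rker r n (F : 'M[R]_(r, n)) v : (hw (v *m F) == 0%N) = (v \in rker F).
Proof.
rewrite cards_eq0 inE; apply/eqP/eqP => [h|->].
  apply/rowP => j; rewrite [RHS]mxE; apply/eqP/negPn/negP => nz.
  by move/setP/(_ j): h; rewrite !inE nz.
by apply/setP => j; rewrite !inE mxE eqxx.
Qed.

Lemma sum_rho_split (rho : K) r n (F : 'M[R]_(r, n)) :
  \sum_v rho ^+ hw (v *m F) =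
  #|rker F|%:R + \sum_(v | v \notin rker F) rho ^+ hw (v *m F).
Proof.
rewrite (bigID [in rker F]) /=; congr (_ + _).
rewrite -sum1_card natr_sum; apply: eq_bigr => v.
by rewrite -hw_rker => /eqP ->; rewrite expr0.
Qed.

Lemma colpr_unif_le r n (F : 'M[R]_(r, n)) y :
  0 <= colpr unif F y <= #|rker F|%:R / (q ^ r)%:R.
Proof.
apply/andP; split.
  by apply: sumr_ge0 => x _; apply: mweight_ge0 => c; apply: unif_ge0.
rewrite -lecR colpr_fourier; apply: le_trans (real_ler_norm _) _.
  by rewrite -colpr_fourier complex_real.
rewrite normrM rmorphM /= fmorphV !rmorph_nat mulrC [X in _ * X]ger0_norm ?invr_ge0 ?ler0n //.
rewrite ler_pM2r ?invr_gt0 ?ltr0n ?expn_gt0 ?q_gt0 //.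
apply: le_trans (ler_norm_sum _ _ _) _.
rewrite -sum1_card natr_sum [leRHS]big_mkcond /=; apply: ler_sum => v _.
rewrite normrM echar_norm mul1r prod_phi_unif.
by case: (v \in _); rewrite ?normr1 ?normr0.
Qed.

(** In the two Fourier expansions the terms with v in the left kernel agree. The others vanish for
    the uniform law, and for [mu] each nonzero entry of v F contributes a factor at most [rho]. *)
Lemma colpr_dist (mu : R -> K) (rho : K) r n (F : 'M[R]_(r, n)) y :
    \sum_c mu c = 1 -> (forall a, a != 0 -> `|phi mu a| <= rho%:C%C) ->
  `|colpr mu F y - colpr unif F y| <=
    (\sum_v rho ^+ hw (v *m F) - #|rker F|%:R) / (q ^ r)%:R.
Proof.
move=> mu1 rhoP; rewrite sum_rho_split addrAC subrr add0r.
rewrite -lecR.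
have -> : `|colpr mu F y - colpr unif F y|%:C%C =
    `|(colpr mu F y)%:C%C - (colpr unif F y)%:C%C| :> K[i].
  by rewrite -rmorphB /= normc_def /= expr0n addr0 sqrtr_sqr.
rewrite !colpr_fourier -mulrBr -sumrB normrM rmorphM /= fmorphV !rmorph_nat mulrC.
rewrite [X in _ * X]ger0_norm ?invr_ge0 ?ler0n //.
rewrite ler_pM2r ?invr_gt0 ?ltr0n ?expn_gt0 ?q_gt0 //.
apply: le_trans (ler_norm_sum _ _ _) _.
rewrite rmorph_sum [leRHS]big_mkcond /=; apply: ler_sum => v _.
rewrite -mulrBr normrM echar_norm mul1r prod_phi_unif.
have [vK|vK] := boolP (v \in rker F); rewrite /=.
  move: vK; rewrite inE => /eqP ->; rewrite big1 ?subrr ?normr0 // => j _.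
  by rewrite mxE phi0.
rewrite subr0 normr_prod (bigID (fun j => (v *m F) 0 j == 0)) /=.
rewrite big1 ?mul1r => [|j /eqP ->]; last by rewrite phi0 ?normr1.
rewrite /hw -prodr_const rmorph_prod /=.
rewrite [leRHS](eq_bigl (fun j => (v *m F) 0 j != 0)) => [|j]; last by rewrite inE.
apply: ler_prod => j nz; rewrite normr_ge0 /=; exact: rhoP.
Qed.

End ColumnLaw.

Section KernelGroups.
Variable q : nat.
Local Notation R := 'Z_q.

Lemma additive_group_set (U : finZmodType) (A : {set U}) :
  0 \in A -> (forall x y, x \in A -> y \in A -> x + y \in A) -> group_set A.
Proof. by move=> A0 AD; apply/group_setP; split. Qed.

Lemma rker_group_set r n (F : 'M[R]_(r, n)) : group_set (rker F).
Proof.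
apply: additive_group_set => [|u v]; rewrite !inE ?mul0mx // => /eqP u0 /eqP v0.
by rewrite mulmxDl u0 v0 addr0.
Qed.
Canonical rker_group r n (F : 'M[R]_(r, n)) := Group (rker_group_set F).

Definition annih r (L : {set 'rV[R]_r}) : {set 'cV[R]_r} :=
  [set y : 'cV[R]_r | [forall (v | v \in L), v *m y == 0]].

Lemma annihP r (L : {set 'rV[R]_r}) (y : 'cV[R]_r) :
  reflect (forall v, v \in L -> v *m y = 0) (y \in annih L).
Proof.
rewrite inE; apply: (iffP forall_inP) => h v Lv; first exact/eqP/h.
by apply/eqP/h.
Qed.

Lemma annih_group_set r (L : {set 'rV[R]_r}) : group_set (annih L).
Proof.
apply: additive_group_set => [|x y /annihP hx /annihP hy]; apply/annihP => v Lv.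
  by rewrite mulmx0.
by rewrite mulmxDr hx ?hy ?addr0.
Qed.
Canonical annih_group r L := Group (@annih_group_set r L).

Lemma perp_group_set r (G : {set 'cV[R]_r}) : group_set (perp G).
Proof.
apply: additive_group_set => [|u v /perpP hu /perpP hv]; apply/perpP => x Gx.
  by rewrite mul0mx.
by rewrite mulmxDl hu ?hv ?addr0.
Qed.
Canonical perp_group r G := Group (@perp_group_set r G).

Lemma annih_gen r (S : {set 'rV[R]_r}) : annih <<S>>%g = annih S.
Proof.
apply/setP => y; apply/annihP/annihP => h v Sv; first by apply: h; rewrite mem_gen.
have : (<<S>> \subset [group of rker y])%g.
  by rewrite gen_subG; apply/subsetP => u Su; rewrite inE h.
by move/subsetP/(_ v Sv); rewrite inE => /eqP.
Qed.

Lemma card_annih_le (q_gt1 : (1 < q)%N) r (L : {set 'rV[R]_r}) :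
  (#|L| * #|annih L| <= q ^ r)%N.
Proof.
rewrite -(card_perp_mul q_gt1 (annih_group L)) mulnC leq_mul2l; apply/orP; right.
by apply/subset_leq_card/subsetP => v Lv; apply/perpP => y /annihP; apply.
Qed.

Lemma half_proper (gT : finGroupType) (H G : {group gT}) : H \proper G -> (2 * #|H| <= #|G|)%N.
Proof.
move=> pHG; rewrite -(Lagrange (proper_sub pHG)) mulnC leq_mul2l indexg_gt1.
by rewrite proper_subn ?orbT.
Qed.

End KernelGroups.

(** * Decay of the Fourier error *)

Section KeyInequality.
Variables (q : nat) (K : realFieldType) (r n t : nat) (rho x : K).
Hypotheses (q_gt1 : (1 < q)%N) (rho01 : 0 <= rho < 1) (x01 : 0 < x <= 1).
Local Notation R := 'Z_q.
Let Q : K := (q ^ r)%:R.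
(** [tau] bounds the contribution of all v with more than t nonzero entries in v F. The number (1 +
    rho) / 2 in [gamma] is the mean over a group that properly contains the left kernel: at least
    half of its elements lie outside the kernel and count at most [rho] each. *)
Let tau : K := Q * rho ^+ t.
Let gamma : K := (1 + rho) / 2 + tau.

Let rho0 : 0 <= rho. Proof. by case/andP: rho01. Qed.
Let rho1 : rho <= 1. Proof. by case/andP: rho01 => _ /ltW. Qed.
Let x0 : 0 < x. Proof. by case/andP: x01. Qed.
Let Q0 : 0 < Q. Proof. by rewrite ltr0n expn_gt0 ltnW. Qed.
Let tau0 : 0 <= tau. Proof. by rewrite mulr_ge0 ?exprn_ge0 // ltW. Qed.
Let gamma0 : 0 <= gamma. Proof. by have := rho0; have := tau0; rewrite /gamma; lra. Qed.

Let rhosum (F : 'M[R]_(r, n)) := \sum_(v : 'rV[R]_r) rho ^+ hw (v *m F).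

(* F has at most q^r t columns outside annih <<low F>>, so the weight x ^ escape, with x small,
   makes the sum over the F with a given <<low F>> small. *)
Definition escape (L : {set 'rV[R]_r}) (F : 'M[R]_(r, n)) : nat :=
  #|[set j | col j F \notin annih L]|.

Let low (F : 'M[R]_(r, n)) : {set 'rV[R]_r} := [set v : 'rV[R]_r | (hw (v *m F) <= t)%N].

Let rhosum_low F : rhosum F <= \sum_(v in low F) rho ^+ hw (v *m F) + tau.
Proof.
rewrite /rhosum (bigID [in low F]) /= lerD2l.
apply: (@le_trans _ _ (\sum_(v : 'rV[R]_r | v \notin low F) rho ^+ t)).
  apply: ler_sum => v; rewrite inE -ltnNge => /ltnW tle.
  by rewrite ler_wiXn2l.
apply: (@le_trans _ _ (\sum_(v : 'rV[R]_r) rho ^+ t)).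
  by rewrite [leRHS](bigID [in low F]) /= lerDr sumr_ge0 // => v _; rewrite exprn_ge0.
by rewrite sumr_const card_rVq // -[X in X <= _]mulr_natl.
Qed.

Let escape_low F : (escape <<low F>>%g F <= q ^ r * t)%N.
Proof.
rewrite /escape annih_gen.
apply: (@leq_trans (\sum_(v in low F) hw (v *m F))).
  have sub : [set j | col j F \notin annih (low F)] \subset
      \bigcup_(v in low F) [set j | (v *m F) 0 j != 0].
    apply/subsetP => j; rewrite !inE negb_forall_in => /exists_inP[v vl nz].
    apply/bigcupP; exists v => //; rewrite inE.
    by move: nz; rewrite mx11_eq0 -[_ 0 0](_ : (v *m F) 0 j = _) // !mxE; apply: eq_bigr => i _; rewrite mxE.
  apply: leq_trans (subset_leq_card sub) _.
  elim/big_ind2: _ => [|A a B b lA lB|v _]; first by rewrite cards0.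
    by apply: leq_trans (leq_card_setU _ _) _; apply: leq_add.
  by [].
apply: (@leq_trans (\sum_(v in low F) t)); first by apply: leq_sum => v; rewrite inE.
by rewrite sum_nat_const leq_mul2r -(@card_rVq q) // max_card orbT.
Qed.

(** If [low F] lies in the left kernel, the first term suffices. Otherwise the summand of L =
    [<<low F>>] suffices, since [escape_low] makes the power of [x] in it at least 1. *)
Let term_bound F :
  rhosum F ^+ n - #|rker F|%:R ^+ n <=
  #|rker F|%:R ^+ n * ((1 + tau) ^+ n - 1) +
  \sum_(L : {group 'rV[R]_r}) x ^+ escape L F * (x ^- (q ^ r * t) * (#|L|%:R * gamma) ^+ n).
Proof.
have X0 : 0 <= rhosum F by apply: sumr_ge0 => v _; rewrite exprn_ge0.
have t0 (L : {group 'rV[R]_r}) :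
    0 <= x ^+ escape L F * (x ^- (q ^ r * t) * (#|L|%:R * gamma) ^+ n).
  by rewrite !mulr_ge0 ?invr_ge0 ?exprn_ge0 ?mulr_ge0 ?ler0n ?(ltW x0).
have k1 : 1 <= #|rker F|%:R :> K by rewrite ler1n (cardG_gt0 [group of rker F]).
have [sub|nsub] := boolP (low F \subset rker F).
  rewrite -[leLHS]addr0 lerD ?sumr_ge0 //.
  rewrite mulrBr mulr1 lerD2r -exprMn lerXn2r ?nnegrE ?mulr_ge0 ?addr_ge0 ?ler0n //.
  apply: le_trans (rhosum_low F) _; rewrite mulrDr mulr1 lerD //; last first.
    by rewrite ler_peMl.
  apply: (@le_trans _ _ (\sum_(v in low F) 1)).
    by apply: ler_sum => v _; rewrite exprn_ile1.
  by rewrite sumr_const ler_nat subset_leq_card.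
pose L := <<low F>>%G.
have kerL : rker F \proper L.
  rewrite properE; apply/andP; split.
    apply/subsetP => v; rewrite -hw_rker => /eqP h; apply: mem_gen.
    by rewrite inE h.
  by apply: contra nsub; apply: subset_trans; apply: subset_gen.
rewrite (bigD1 L) //= addrA -[leLHS]addr0 lerD ?sumr_ge0 //.
apply: (@le_trans _ _ (rhosum F ^+ n)).
  by rewrite gerBl exprn_ge0 ?ler0n.
rewrite -[leLHS]add0r lerD //.
  by rewrite mulr_ge0 ?exprn_ge0 ?ler0n // subr_ge0 exprn_ege1 // lerDl.
rewrite mulrA -[leLHS]mul1r ler_pM // ?exprn_ge0 //.
  rewrite -[leLHS](mulfV (_ : x ^+ (q ^ r * t) != 0)) ?expf_neq0 ?(gt_eqF x0) //.
  rewrite ler_pM2r ?invr_gt0 ?exprn_gt0 // ler_wiXn2l ?(ltW x0) ?escape_low //.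
    by case/andP: x01.
rewrite lerXn2r ?nnegrE ?mulr_ge0 ?ler0n //.
apply: le_trans (rhosum_low F) _; rewrite /gamma mulrDr lerD //; last first.
  by rewrite ler_peMl // ler1n cardG_gt0.
apply: (@le_trans _ _ (\sum_(v in L) rho ^+ hw (v *m F))).
  rewrite [leRHS](bigID [in low F]) /= -[leLHS]addr0 lerD //; last first.
    by rewrite sumr_ge0 // => v _; rewrite exprn_ge0.
  rewrite [leRHS](eq_bigl [in low F]) // => v.
  by rewrite andb_idl // => h; apply: mem_gen.
rewrite (bigID [in rker F]) /=.
apply: (@le_trans _ _ (#|rker F|%:R + (#|L|%:R - #|rker F|%:R) * rho)).
  have sKL := proper_sub kerL.
  apply: lerD.
    apply: (@le_trans _ _ (\sum_(v in L | v \in rker F) 1)).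
      by apply: ler_sum => v _; rewrite exprn_ile1.
    rewrite (eq_bigl [in rker F]) ?sumr_const // => v.
    by rewrite andb_idl //; apply/subsetP.
  apply: (@le_trans _ _ (\sum_(v in L | v \notin rker F) rho)).
    apply: ler_sum => v /andP[_]; rewrite -hw_rker -lt0n => h.
    by rewrite -[leRHS]expr1 ler_wiXn2l.
  rewrite (eq_bigl [in L :\: rker F]) => [|v]; last by rewrite !inE andbC.
  rewrite sumr_const cardsD (setIidPr sKL) -natrB ?subset_leq_card //.
  by rewrite mulr_natl.
have : 2 * #|rker F|%:R <= #|L|%:R :> K.
  by rewrite -natrM ler_nat; apply: (@half_proper _ [group of rker F]).
move: rho0 rho1 k1; nra.
Qed.

Let sum_escape (L : {set 'rV[R]_r}) :
  \sum_(F : 'M[R]_(r, n)) x ^+ escape L F <= (#|annih L|%:R + Q * x) ^+ n.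
Proof.
pose g (y : 'cV[R]_r) := if y \in annih L then 1 else x.
have xg (F : 'M[R]_(r, n)) : x ^+ escape L F = \prod_j g (col j F).
  rewrite /escape -prodr_const big_mkcond /=; apply: eq_bigr => j _.
  by rewrite inE /g; case: (_ \in _).
under eq_bigr => F _ do rewrite xg.
rewrite (sum_mx_prod_col (fun=> g)) prodr_const card_ord.
rewrite lerXn2r ?nnegrE ?addr_ge0 ?mulr_ge0 ?ler0n ?(ltW x0) ?(ltW Q0) //.
  by apply: sumr_ge0 => y _; rewrite /g; case: ifP; rewrite ?ler01 ?(ltW x0).
rewrite /g (bigID [in annih L]) /=; apply: lerD.
  rewrite (eq_bigr (fun=> 1)) => [|y ->] //.
  by rewrite sumr_const.
apply: (@le_trans _ _ (\sum_(y : 'cV[R]_r) x)); last first.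
  by rewrite sumr_const card_cVq // -[X in X <= _]mulr_natl.
rewrite big_mkcond /=; apply: ler_sum => y _.
by case: ifP => [/negbTE->//|_]; apply: ltW.
Qed.

(** The first term is harmless while n q^r rho^t is small; the second decays exponentially in n once
    [x] is small and t is a small fraction of n. It comes from |L| (|annih L| + Q x) <= Q (1 + Q x),
    which lets the sum over F cancel the denominator Q^n. *)
Lemma key_inequality :
  \sum_(F : 'M[R]_(r, n)) ((\sum_(v : 'rV[R]_r) rho ^+ hw (v *m F)) ^+ n - #|rker F|%:R ^+ n)
    / (q ^ r)%:R ^+ n <=
  (\sum_(F : 'M[R]_(r, n)) (#|rker F|%:R / (q ^ r)%:R) ^+ n) *
    ((1 + (q ^ r)%:R * rho ^+ t) ^+ n - 1) +
  #|{: {group 'rV[R]_r}}|%:R * (x ^- (q ^ r * t) *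
    (((1 + rho) / 2 + (q ^ r)%:R * rho ^+ t) * (1 + (q ^ r)%:R * x)) ^+ n).
Proof.
rewrite -/Q -/tau -/gamma.
apply: (@le_trans _ _ (\sum_(F : 'M[R]_(r, n)) ((#|rker F|%:R ^+ n * ((1 + tau) ^+ n - 1) +
  \sum_(L : {group 'rV[R]_r}) x ^+ escape L F * (x ^- (q ^ r * t) * (#|L|%:R * gamma) ^+ n))
   / Q ^+ n))).
  apply: ler_sum => F _; rewrite ler_pM2r ?invr_gt0 ?exprn_gt0 //; exact: term_bound.
under eq_bigr => F _ do rewrite mulrDl.
rewrite big_split /= lerD //.
  rewrite mulr_suml; apply: ler_sum => F _.
  by rewrite exprMn exprVn mulrAC.
under eq_bigr => F _ do rewrite mulr_suml.
rewrite exchange_big /= mulr_natl -sumr_const.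
apply: ler_sum => L _; rewrite -!mulr_suml.
rewrite -!mulrA mulrCA.
rewrite ler_wpM2l ?invr_ge0 ?exprn_ge0 ?(ltW x0) // mulrA.
rewrite ler_pdivrMr ?exprn_gt0 //.
apply: le_trans (ler_wpM2r _ (sum_escape L)) _.
  by rewrite exprn_ge0 // mulr_ge0 ?ler0n.
have Qx0 : 0 <= Q * x by rewrite mulr_ge0 ?(ltW Q0) ?(ltW x0).
have a0 : 0 <= #|annih L|%:R + Q * x by rewrite addr_ge0 ?ler0n.
have b0 : 0 <= #|L|%:R * gamma by rewrite mulr_ge0 ?ler0n.
have c0 : 0 <= gamma * (1 + Q * x) by rewrite mulr_ge0 // addr_ge0.
rewrite -!exprMn lerXn2r ?nnegrE ?(mulr_ge0 a0 b0) ?(mulr_ge0 c0 (ltW Q0)) //.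
suff h : #|L|%:R * (#|annih L|%:R + Q * x) <= (1 + Q * x) * Q.
  have -> : (#|annih L|%:R + Q * x) * (#|L|%:R * gamma) =
    gamma * (#|L|%:R * (#|annih L|%:R + Q * x)) by ring.
  by rewrite -[leRHS]mulrA ler_wpM2l.
have := card_annih_le q_gt1 L; rewrite -(ler_nat K) natrM -/Q => h1.
have h2 : #|L|%:R <= Q :> K by rewrite ler_nat -(card_rVq q_gt1) max_card.
have : #|L|%:R * (Q * x) <= Q * (Q * x) by rewrite ler_wpM2r ?mulr_ge0 ?(ltW Q0) ?(ltW x0).
by move: h1; lra.
Qed.

End KeyInequality.

(** Exchange one factor at a time. The bound is left as a difference of powers because, with kap =
    |rker F| / q^r and eta the bound of [colpr_dist], it is exactly the summand of [key_sum]. *)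
Lemma prod_dist_le (K : realFieldType) n (a b : 'I_n -> K) (kap eta : K) :
    (forall i, `|a i - b i| <= eta) -> (forall i, `|b i| <= kap) ->
  `|\prod_i a i - \prod_i b i| <= (kap + eta) ^+ n - kap ^+ n.
Proof.
elim: n a b => [|n IH] a b hab hb; first by rewrite !big_ord0 !expr0 !subrr normr0.
have kap0 : 0 <= kap := le_trans (normr_ge0 _) (hb ord0).
have eta0 : 0 <= eta := le_trans (normr_ge0 _) (hab ord0).
rewrite !big_ord_recl /=.
have := IH (fun i => a (lift ord0 i)) (fun i => b (lift ord0 i))
  (fun i => hab _) (fun i => hb _).
set A := \prod_i _; set B := \prod_i _ => hAB.
have hB : `|B| <= kap ^+ n.
  rewrite normr_prod -[n in leRHS]card_ord -prodr_const; apply: ler_prod => i _.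
  by rewrite normr_ge0 hb.
have ha0 : `|a ord0| <= kap + eta.
  rewrite -[a ord0](subrK (b ord0)) addrC; apply: le_trans (ler_normD _ _) _.
  exact: lerD.
have -> : a ord0 * A - b ord0 * B = a ord0 * (A - B) + (a ord0 - b ord0) * B by ring.
apply: le_trans (ler_normD _ _) _; rewrite !normrM.
have -> : (kap + eta) ^+ n.+1 - kap ^+ n.+1 =
  (kap + eta) * ((kap + eta) ^+ n - kap ^+ n) + eta * kap ^+ n by rewrite !exprS; ring.
by apply: lerD; apply: ler_pM.
Qed.

(** * Expectations over products of matrices *)

Fixpoint group_chains (gT : finGroupType) k (G : {group gT}) : nat :=
  if k is k'.+1 then (\sum_(H : {group gT} | H \subset G) group_chains k' H)%N else 1%N.

Section Image.
Variable q : nat.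
Hypothesis q_gt1 : (1 < q)%N.
Local Notation R := 'Z_q.

Definition mimg r n (F : 'M[R]_(r, n)) : {set 'cV[R]_r} := [set F *m x | x : 'cV[R]_n].

Lemma mimgP r n (F : 'M[R]_(r, n)) y :
  reflect (exists x : 'cV[R]_n, y = F *m x) (y \in mimg F).
Proof. by apply: (iffP imsetP) => [[x _ ->]|[x ->]]; exists x. Qed.

Lemma mem_mimg r n (F : 'M[R]_(r, n)) x : F *m x \in mimg F.
Proof. by apply/mimgP; exists x. Qed.

Lemma mimg_group_set r n (F : 'M[R]_(r, n)) : group_set (mimg F).
Proof.
apply: additive_group_set => [|_ _ /mimgP[x ->] /mimgP[y ->]]; apply/mimgP.
  by exists 0; rewrite mulmx0.
by exists (x + y); rewrite mulmxDr.
Qed.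
Canonical mimg_group r n (F : 'M[R]_(r, n)) := Group (mimg_group_set F).

Lemma perp_mimg r n (F : 'M[R]_(r, n)) : perp (mimg F) = rker F.
Proof.
apply/setP => v; rewrite [RHS]inE; apply/perpP/eqP => [h|vF _ /mimgP[x ->]].
  apply/rowP => j; have := h _ (mem_mimg F (delta_mx j 0)).
  by rewrite mulmxA -colE => /matrixP/(_ 0 0); rewrite !mxE.
by rewrite mulmxA vF mul0mx.
Qed.

Lemma card_mimg_rker r n (F : 'M[R]_(r, n)) : (#|mimg F| * #|rker F| = q ^ r)%N.
Proof. by rewrite -perp_mimg (card_perp_mul q_gt1 (mimg_group F)). Qed.

Lemma group_scale r (G : {group 'cV[R]_r}) (a : R) x : x \in G -> a *: x \in G.
Proof.
by move=> Gx; rewrite -[a]natr_Zp scaler_nat -zmodXgE groupX.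
Qed.

Lemma mulmx_sum_col m n (A : 'M[R]_(m, n)) (x : 'cV[R]_n) :
  A *m x = \sum_j x j 0 *: col j A.
Proof.
apply/colP => i; rewrite mxE summxE; apply: eq_bigr => j _.
by rewrite !mxE mulrC.
Qed.

Lemma mimg_sub r n (F : 'M[R]_(r, n)) (G : {group 'cV[R]_r}) :
  (mimg F \subset G) = [forall j, col j F \in G].
Proof.
apply/subsetP/forallP => [h j|h _ /mimgP[x ->]].
  by rewrite colE; apply/h/mem_mimg.
rewrite mulmx_sum_col; elim/big_ind: _ => [|x1 x2|j _]; first exact: group1.
  exact: groupM.
exact: group_scale.
Qed.

Lemma card_mimg_sub r n (G : {group 'cV[R]_r}) :
  #|[set F : 'M[R]_(r, n) | mimg F \subset G]| = (#|G| ^ n)%N.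
Proof.
have -> : (#|G| ^ n)%N = #|[pred f : {ffun 'I_n -> 'cV[R]_r} | f \in ffun_on (mem G)]|.
  by rewrite card_ffun_on card_ord.
pose h (f : {ffun 'I_n -> 'cV[R]_r}) : 'M[R]_(r, n) := \matrix_(i, j) f j i 0.
have hI : injective h.
  move=> f g /matrixP fg; apply/ffunP => j; apply/colP => i.
  by have := fg i j; rewrite !mxE.
rewrite -(card_imset _ hI); apply: eq_card => A; apply/idP/imsetP.
  rewrite inE mimg_sub => /forallP FG; exists [ffun j => col j A].
    by rewrite inE; apply/ffun_onP => j; rewrite ffunE; exact: FG.
  by apply/matrixP => i j; rewrite !mxE ffunE mxE.
case=> f fG ->; move: fG; rewrite !inE => /ffun_onP fG; rewrite mimg_sub; apply/forallP => j.
suff -> : col j (h f) = f j by exact: fG.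
by apply/colP => i; rewrite !mxE.
Qed.

Lemma card_mimg_eq r n (G : {group 'cV[R]_r}) :
  (#|[set F : 'M[R]_(r, n) | mimg F == G :> {set _}]| <= #|G| ^ n)%N.
Proof.
rewrite -(@card_mimg_sub r n); apply/subset_leq_card/subsetP => F.
by rewrite !inE => /eqP ->.
Qed.

End Image.

Section Expectation.
Variables (q : nat) (K : rcfType).
Hypothesis q_gt1 : (1 < q)%N.
Local Notation R := 'Z_q.
Variable n : nat.
Implicit Types (mu : R -> K) (g : 'M[R]_n -> K).

Fixpoint Ex mu k g : K :=
  if k is k'.+1 then \sum_(A : 'M[R]_n) mweight mu A * Ex mu k' (fun A' => g (A *m A'))
  else g 1%:M.

Definition kpr mu k r (F : 'M[R]_(r, n)) : K := Ex mu k (fun A => (F *m A == 0)%:R).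

Lemma eq_Ex mu k g1 g2 : g1 =1 g2 -> Ex mu k g1 = Ex mu k g2.
Proof.
elim: k g1 g2 => [|k IH] g1 g2 h /=; first exact: h.
by apply: eq_bigr => A _; congr (_ * _); apply: IH => A'; apply: h.
Qed.

Lemma ExD mu k g1 g2 : Ex mu k (fun A => g1 A + g2 A) = Ex mu k g1 + Ex mu k g2.
Proof.
elim: k g1 g2 => [|k IH] g1 g2 //=; rewrite -big_split /=.
by apply: eq_bigr => A _; rewrite IH mulrDr.
Qed.

Lemma ExZ mu k c g : Ex mu k (fun A => c * g A) = c * Ex mu k g.
Proof.
elim: k g => [|k IH] g //=; rewrite mulr_sumr.
by apply: eq_bigr => A _; rewrite IH mulrCA.
Qed.

Lemma Ex_sum mu k (I : Type) (s : seq I) (P : pred I) (g : I -> 'M[R]_n -> K) :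
  Ex mu k (fun A => \sum_(i <- s | P i) g i A) = \sum_(i <- s | P i) Ex mu k (g i).
Proof.
elim: s => [|i s IH].
  rewrite big_nil -[RHS](mul0r (Ex mu k (fun=> 0))) -ExZ; apply: eq_Ex => A.
  by rewrite big_nil mul0r.
rewrite big_cons -IH; case: ifP => Pi; rewrite -?ExD; apply: eq_Ex => A;
  by rewrite big_cons Pi.
Qed.

Lemma ler_Ex mu k g1 g2 : (forall c, 0 <= mu c) -> (forall A, g1 A <= g2 A) ->
  Ex mu k g1 <= Ex mu k g2.
Proof.
move=> mu0; elim: k g1 g2 => [|k IH] g1 g2 h //=; apply: ler_sum => A _.
by apply: ler_wpM2l; [apply: mweight_ge0|apply: IH].
Qed.

Lemma kpr_ge0 mu k r (F : 'M[R]_(r, n)) : (forall c, 0 <= mu c) -> 0 <= kpr mu k F.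
Proof.
move=> mu0; have -> : 0 = Ex mu k (fun A => 0 * 0) :> K by rewrite ExZ mul0r.
by apply: ler_Ex => // A; rewrite mul0r ler0n.
Qed.

Lemma mxpr_ge0 mu r m m' (F : 'M[R]_(r, m)) (F' : 'M[R]_(r, m')) :
  (forall c, 0 <= mu c) -> 0 <= mxpr mu F F'.
Proof. by move=> mu0; apply: sumr_ge0 => A _; apply: mweight_ge0. Qed.

(** The matrices F, F M_1, F M_1 M_2, ... form a Markov chain with kernel [mxpr], and [kpr] is the
    probability that it is at 0 after k steps. *)
Lemma kprS mu k r (F : 'M[R]_(r, n)) :
  kpr mu k.+1 F = \sum_(F' : 'M[R]_(r, n)) mxpr mu F F' * kpr mu k F'.
Proof.
rewrite /kpr /= (partition_big (fun A => F *m A) xpredT) //=; apply: eq_bigr => F' _.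
rewrite /mxpr mulr_suml; apply: eq_bigr => A /eqP <-; congr (_ * _).
by apply: eq_Ex => A'; rewrite mulmxA.
Qed.

(** For uniform A the columns of F A are independent and take each value of the image of F with
    probability at most 1 / |mimg F|. *)
Lemma mxpr_unif_le r (F F' : 'M[R]_(r, n)) :
  mxpr (unif K) F F' <= (mimg F' \subset mimg F)%:R / #|mimg F|%:R ^+ n.
Proof.
have [sub|nsub] := boolP (_ \subset _); last first.
  rewrite mul0r /mxpr big_pred0 // => A; apply: contraNF nsub => /eqP <-.
  by apply/subsetP => _ /mimgP[x ->]; rewrite -mulmxA mem_mimg.
rewrite mul1r mxpr_cols // -exprVn.
have -> : #|mimg F|%:R^-1 ^+ n = \prod_(j < n) #|mimg F|%:R^-1 :> K.
  by rewrite prodr_const card_ord.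
apply: ler_prod => j _; have /andP[-> /le_trans] := colpr_unif_le K q_gt1 F (col j F').
apply; rewrite -(card_mimg_rker q_gt1 F) natrM invfM mulrCA mulrV ?mulr1 ?unitfE //.
by rewrite pnatr_eq0 -lt0n (cardG_gt0 (rker_group F)).
Qed.

(** At most |H|^n matrices have image H, so the weight |mimg F|^-n lets each subgroup count at most
    once. *)
Lemma sum_mimg_group r (P : pred {group 'cV[R]_r}) (f : {group 'cV[R]_r} -> K) :
    (forall H, 0 <= f H) ->
  \sum_(F : 'M[R]_(r, n) | P (mimg_group F)) (f (mimg_group F) / #|mimg F|%:R ^+ n) <=
  \sum_(H | P H) f H.
Proof.
move=> f0; rewrite (partition_big (fun F => mimg_group F) P) //=.
apply: ler_sum => H PH.
apply: (@le_trans _ _ (\sum_(F : 'M[R]_(r, n) | mimg F == H :> {set _}) f H / #|H|%:R ^+ n)).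
  rewrite big_mkcond [leRHS]big_mkcond /=; apply: ler_sum => F _.
  case: ifP => [/andP[_ /eqP <-]|_]; first by rewrite eqxx.
  by case: ifP => // _; rewrite mulr_ge0 ?invr_ge0 ?exprn_ge0 ?ler0n.
rewrite sumr_const -[X in X <= _]mulr_natr mulrAC ler_pdivrMr ?exprn_gt0 ?ltr0n ?cardG_gt0 //.
rewrite ler_wpM2l // -natrX ler_nat; apply: leq_trans _ (card_mimg_eq n H).
by rewrite cardsE.
Qed.

Lemma kprS_unif_le k r (F : 'M[R]_(r, n)) :
  kpr (unif K) k.+1 F <=
  (\sum_(F' : 'M[R]_(r, n) | mimg F' \subset mimg F) kpr (unif K) k F') / #|mimg F|%:R ^+ n.
Proof.
rewrite kprS mulr_suml [leRHS]big_mkcond /=; apply: ler_sum => F' _.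
apply: le_trans (ler_wpM2r (kpr_ge0 _ _ (@unif_ge0 _ _)) (mxpr_unif_le _ _)) _.
by case: ifP => _; rewrite ?mul0r // mul1r mulrC.
Qed.

(** Each step of the Markov chain yields a factor |mimg|^-n, which pays for the choice among
    matrices with a given image. After k+1 steps the chain must be at 0, so the images at times 0,
    ..., k remain: k+1 nested subgroups, the first of which is H. *)
Lemma sum_kpr_unif_le k r (P : pred {group 'cV[R]_r}) :
  \sum_(F : 'M[R]_(r, n) | P (mimg_group F)) kpr (unif K) k.+1 F <=
  (\sum_(H | P H) group_chains k H)%:R.
Proof.
elim: k P => [|k IH] P; rewrite natr_sum;
  apply: le_trans (sum_mimg_group P (fun H => ler0n _ (group_chains _ H)));
  apply: ler_sum => F _; apply: le_trans (kprS_unif_le _ _) _;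
  rewrite ler_wpM2r ?invr_ge0 ?exprn_ge0 ?ler0n //.
  apply: (@le_trans _ _ (\sum_(F' : 'M[R]_(r, n) | F' == 0) 1)).
    rewrite big_mkcond [leRHS]big_mkcond /=; apply: ler_sum => F' _.
    by rewrite /kpr /= mulmx1; case: (F' == 0); case: ifP; rewrite ?ler01.
  by rewrite big_pred1_eq.
exact: (IH (fun H : {group 'cV[R]_r} => H \subset mimg_group F)).
Qed.

Lemma sum_kpr_unif_full k r :
  \sum_(F : 'M[R]_(r, n)) kpr (unif K) k F <= (group_chains k [set: 'cV[R]_r]%G)%:R.
Proof.
case: k => [|k].
  rewrite (bigD1 0) //= big1 => [|F /negbTE F0]; rewrite /kpr /= mulmx1.
    by rewrite eqxx addr0.
  by rewrite F0.
apply: le_trans (sum_kpr_unif_le k xpredT) _; rewrite ler_nat /=.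
by rewrite [leqRHS](eq_bigl xpredT) // => H; rewrite subsetT.
Qed.

Lemma sum_rker_le r :
  \sum_(F : 'M[R]_(r, n)) (#|rker F|%:R / (q ^ r)%:R) ^+ n <= #|{: {group 'cV[R]_r}}|%:R :> K.
Proof.
apply: le_trans (_ : _ <= \sum_(H : {group 'cV[R]_r}) 1) _; last by rewrite sumr_const.
apply: le_trans (sum_mimg_group xpredT (f := fun=> 1) (fun=> ler01)).
apply: ler_sum => F _; rewrite -exprVn mul1r -(card_mimg_rker q_gt1 F) natrM invfM.
rewrite mulrCA mulrV ?mulr1 ?unitfE // pnatr_eq0 -lt0n.
by rewrite (cardG_gt0 (rker_group F)).
Qed.

Section Comparison.
Variables (mu : R -> K) (rho : K) (r : nat).
Hypotheses (mu_ge0 : forall c, 0 <= mu c) (mu_sum : \sum_c mu c = 1).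
Hypothesis rhoP : forall a, a != 0 -> `|phi q_gt1 mu a| <= rho%:C%C.

Definition kdist k : K := \sum_(F : 'M[R]_(r, n)) `|kpr mu k F - kpr (unif K) k F|.

Definition key_sum : K := \sum_(F : 'M[R]_(r, n))
  ((\sum_(v : 'rV[R]_r) rho ^+ hw (v *m F)) ^+ n - #|rker F|%:R ^+ n) / (q ^ r)%:R ^+ n.

Let delta (F : 'M[R]_(r, n)) : K :=
  ((\sum_(v : 'rV[R]_r) rho ^+ hw (v *m F)) ^+ n - #|rker F|%:R ^+ n) / (q ^ r)%:R ^+ n.

Lemma mxpr_dist (F F' : 'M[R]_(r, n)) :
  `|mxpr mu F F' - mxpr (unif K) F F'| <= delta F.
Proof.
rewrite !mxpr_cols /delta mulrBl -!exprVn -!exprMn.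
set X := \sum_v _; set k := #|_|%:R; set Q := (q ^ r)%:R.
have -> : X / Q = k / Q + (X - k) / Q by rewrite -mulrDl addrC subrK.
apply: prod_dist_le => j; first exact: colpr_dist.
by have /andP[/ger0_norm -> ] := colpr_unif_le K q_gt1 F (col j F').
Qed.

Lemma key_sum_ge0 : 0 <= key_sum.
Proof. by apply: sumr_ge0 => F _; apply: le_trans (mxpr_dist F 0). Qed.

Lemma kdist_ge0 k : 0 <= kdist k.
Proof. exact: sumr_ge0. Qed.

(** Change the law of the first step, then that of the others. The first change costs [key_sum]
    times the total mass of [kpr mu k], which is within [kdist k] of the uniform mass. In the
    second, the sum over F of [mxpr] to a fixed F' is at most the number of subgroups of R^r. *)
Lemma kdistS k : kdist k.+1 <=
  key_sum * ((group_chains k [set: 'cV[R]_r]%G)%:R + kdist k) +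
  #|{: {group 'cV[R]_r}}|%:R * kdist k.
Proof.
have kprle F : `|kpr mu k.+1 F - kpr (unif K) k.+1 F| <=
   delta F * (\sum_(F' : 'M[R]_(r, n)) kpr mu k F') +
   \sum_(F' : 'M[R]_(r, n)) mxpr (unif K) F F' * `|kpr mu k F' - kpr (unif K) k F'|.
  rewrite !kprS -sumrB mulr_sumr -big_split /=.
  apply: le_trans (ler_norm_sum _ _ _) _; apply: ler_sum => F' _.
  have -> : mxpr mu F F' * kpr mu k F' - mxpr (unif K) F F' * kpr (unif K) k F' =
    (mxpr mu F F' - mxpr (unif K) F F') * kpr mu k F' +
    mxpr (unif K) F F' * (kpr mu k F' - kpr (unif K) k F') by ring.
  apply: le_trans (ler_normD _ _) _; rewrite !normrM.
  rewrite (ger0_norm (kpr_ge0 _ _ mu_ge0)) (ger0_norm (mxpr_ge0 _ _ (@unif_ge0 _ _))).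
  by rewrite lerD2r ler_wpM2r ?kpr_ge0 // mxpr_dist.
apply: le_trans (ler_sum _ (fun F _ => kprle F)) _; rewrite big_split /=.
apply: lerD.
  rewrite -mulr_suml ler_wpM2l ?key_sum_ge0 //.
  apply: le_trans (_ : _ <= \sum_(F' : 'M[R]_(r, n)) (kpr (unif K) k F' +
    `|kpr mu k F' - kpr (unif K) k F'|)) _.
    apply: ler_sum => F' _; rewrite -lerBlDl; exact: ler_norm.
  by rewrite big_split /= lerD // sum_kpr_unif_full.
rewrite exchange_big /= mulr_sumr; apply: ler_sum => F' _.
rewrite -mulr_suml ler_wpM2r //.
apply: le_trans (_ : _ <= \sum_(H : {group 'cV[R]_r}) 1) _; last by rewrite sumr_const.
apply: le_trans (sum_mimg_group xpredT (f := fun=> 1) (fun=> ler01)).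
apply: ler_sum => F _; apply: le_trans (mxpr_unif_le F F') _.
by rewrite ler_wpM2r ?invr_ge0 ?exprn_ge0 ?ler0n // lern1 leq_b1.
Qed.

End Comparison.
End Expectation.

(** * Counting chains of subgroups *)

Section ElementaryAbelian.
Variables (p : nat) (p_pr : prime p) (gT : finGroupType).
Local Open Scope nat_scope.
Let p_gt1 := prime_gt1 p_pr.
Let p_gt0 := prime_gt0 p_pr.

(** For an elementary abelian [H] these are the linearly independent j-tuples over the field with p
    elements; independence is read off the order of the span. *)
Definition free_tuples (H : {set gT}) j : {set j.-tuple gT} :=
  [set t : j.-tuple gT | all (mem H) t && (#|<<[set x in tval t]>>%g| == p ^ j)].

(** A free j-tuple with j < d extends in p^d - p^j >= p^(d-1) ways. *)
Lemma card_free_tuples (H : {group gT}) d j :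
  (p.-abelem H)%g -> #|H| = p ^ d -> j <= d -> p ^ (d.-1 * j) <= #|free_tuples H j|.
Proof.
move=> abH oH; elim: j => [|j IH] jd.
  rewrite muln0 card_gt0; apply/set0Pn; exists [tuple]; rewrite inE /=.
  rewrite (_ : [set x in [::]] = set0); last by apply/setP => x; rewrite !inE.
  by rewrite gen0 cards1.
pose D := [set tx : j.-tuple gT * gT |
  (tx.1 \in free_tuples H j) && (tx.2 \in H :\: <<[set x in tval tx.1]>>%g)].
pose h (tx : j.-tuple gT * gT) : j.+1.-tuple gT := [tuple of tx.2 :: tx.1].
have hI : injective h.
  move=> [t x] [t' x'] /(congr1 val) /= [xx tt]; rewrite xx; congr (_, _).
  exact: val_inj.
have gsub (t : j.-tuple gT) : all (mem H) t -> (<<[set x in tval t]>> \subset H)%g.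
  by move=> /allP tH; rewrite gen_subG; apply/subsetP => x; rewrite inE => /tH.
have hD : h @: D \subset free_tuples H j.+1.
  apply/subsetP => xt0 /imsetP[[t x] txD ->]; move: txD.
  rewrite !inE /= => /andP[/andP[tH /eqP ot] /andP[xt xH]].
  rewrite /= xH tH /=.
  pose A := [set y in tval t]; rewrite -/A in ot xt.
  have -> : [set y in x :: t] = x |: A by apply/setP => y; rewrite !inE.
  have -> : (<<x |: A>> = <<A>> <*> <[x]>)%g by rewrite joing_idl joing_idr setUC.
  have sAH := gsub t tH; rewrite -/A in sAH.
  have cAx : (<[x]> \subset 'C(<<A>>))%g.
    rewrite cycle_subG; apply: (subsetP _ x xH).
    apply: subset_trans (abelem_abelian abH) _; exact: centS.
  have x1 : x != 1%g by apply: contraNneq xt => ->; apply: group1.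
  have ox := abelem_order_p abH xH x1.
  have ti : (<<A>> :&: <[x]> = 1)%g.
    rewrite setIC; apply: prime_TIg; first by rewrite -orderE ox.
    by rewrite cycle_subG.
  by rewrite cent_joinEr // TI_cardMg // ot -orderE ox expnSr.
apply: leq_trans (subset_leq_card hD); rewrite card_imset //.
have -> : #|D| = \sum_(t in free_tuples H j) #|H :\: <<[set x in tval t]>>%g|.
  rewrite -sum1_card (eq_bigl (fun tx => (tx.1 \in free_tuples H j) &&
    (tx.2 \in H :\: <<[set x in tval tx.1]>>%g))) => [|tx]; last by rewrite inE.
  rewrite -(pair_big_dep (fun t => t \in free_tuples H j)
    (fun t x => x \in H :\: <<[set x in tval t]>>%g) (fun _ _ => 1)) /=.
  by apply: eq_bigr => t _; rewrite sum1_card.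
apply: (@leq_trans (\sum_(t in free_tuples H j) p ^ d.-1)).
  by rewrite sum_nat_const mulnS addnC expnD leq_mul2r IH ?orbT // ltnW.
apply: leq_sum => t; rewrite inE => /andP[tH /eqP ot].
rewrite cardsD (setIidPr (gsub t tH)) ot oH.
rewrite leq_subRL; last by rewrite leq_pexp2l // ltnW.
case: d jd {oH IH} => // d jd; rewrite /= expnS.
apply: (@leq_trans (p ^ d + p ^ d)); first by rewrite leq_add2r leq_pexp2l.
by rewrite addnn -mul2n leq_mul2r p_gt1 orbT.
Qed.

(** Count pairs of a subgroup and a basis of it: there are at most p^(e d) tuples, and each subgroup
    has at least p^((d-1) d) bases. The exponent d (e - d) is the dimension of the Grassmannian; the
    extra d is the loss in the count of bases. *)
Lemma card_abelem_subgroups (E : {group gT}) e d :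
  (p.-abelem E)%g -> #|E| = p ^ e -> d <= e ->
  #|[set H : {group gT} | (H \subset E) && (#|H| == p ^ d)]| <= p ^ (d * (e - d) + d).
Proof.
move=> abE oE de; set S := [set H | _].
suff : #|S| * p ^ (d.-1 * d) <= p ^ (e * d).
  have -> : p ^ (e * d) = p ^ (d * (e - d) + d) * p ^ (d.-1 * d).
    by rewrite -expnD; congr (_ ^ _); case: (d) de => [|d'] /=; nia.
  by rewrite leq_pmul2r // expn_gt0 p_gt0.
apply: (@leq_trans (\sum_(H in S) #|free_tuples H d|)).
  rewrite -sum_nat_const; apply: leq_sum => H; rewrite inE => /andP[sHE /eqP oH].
  by apply: (card_free_tuples _ oH) => //; apply: abelemS abE.
apply: (@leq_trans #|[set t : d.-tuple gT | all (mem E) t]|); last first.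
  pose h (t : d.-tuple gT) := [ffun i => tnth t i].
  have hI : injective h.
    by move=> t t' /ffunP tt; apply: eq_from_tnth => i; have := tt i; rewrite !ffunE.
  rewrite expnM -oE -[d in leqRHS]card_ord -card_ffun_on -(card_imset _ hI).
  apply/subset_leq_card/subsetP => _ /imsetP[t /[!inE] /allP tE ->].
  by apply/ffun_onP => i; rewrite ffunE; apply/tE/mem_tnth.
rewrite -sum1_card (partition_big (fun t : d.-tuple gT => <<[set x in tval t]>>%G) xpredT) //=.
rewrite [leqRHS](bigID (mem S)) /= -[leqLHS]addn0 leq_add //.
apply: leq_sum => H; rewrite inE => /andP[sHE /eqP oH].
rewrite sum1_card; apply/subset_leq_card/subsetP => t; rewrite inE => /andP[tH /eqP ot].
rewrite unfold_in /= ?inE; apply/andP; split.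
  by apply: sub_all tH => x; apply: (subsetP sHE).
rewrite -val_eqE /= eqEcard ot oH leqnn andbT gen_subG.
by apply/subsetP => x; rewrite inE => xt; move/allP: tH; apply.
Qed.

End ElementaryAbelian.

Section ChainBounds.
Variable p : nat.
Hypothesis p_pr : prime p.
Local Open Scope nat_scope.
Let p_gt1 := prime_gt1 p_pr.
Let p_gt0 := prime_gt0 p_pr.

(** The quadratic parts satisfy d f + k d^2 / (2 (k+1)) <= (k+1) (d+f)^2 / (2 (k+2)), where the
    difference, after clearing denominators, is the square of (k+1) f - d. Here d is the rank of the
    largest subgroup of the chain, d + f that of the ambient group, and the terms linear in d + f
    absorb all losses. *)
Lemma chain_exponent k c d f td t :
  2 * k.+1 * td <= k * d ^ 2 + c * d.+1 + 2 * k.+1 ->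
  k.+1 * (d + f) ^ 2 + (4 * k.+2 + k.+2 * c + 2 * k.+2) * (d + f).+1 <= 2 * k.+2 * t ->
  (d + f) + ((d * f + d) + td) <= t.
Proof.
move=> h1 h2; have h3 := nat_Cauchy (k.+1 * f) d.
suff h : 2 * k.+1 * k.+2 * ((d + f) + ((d * f + d) + td)) <= 2 * k.+1 * k.+2 * t.
  by move: h; rewrite leq_pmul2l.
have h4 : k.+2 * (2 * k.+1 * td) <= k.+2 * (k * d ^ 2 + c * d.+1 + 2 * k.+1).
  by rewrite leq_mul2l h1 orbT.
have h5 : k.+1 * (k.+1 * (d + f) ^ 2 + (4 * k.+2 + k.+2 * c + 2 * k.+2) * (d + f).+1) <=
    k.+1 * (2 * k.+2 * t) by rewrite leq_mul2l h2 orbT.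
have -> : 2 * k.+1 * k.+2 * t = k.+1 * (2 * k.+2 * t) by ring.
apply: leq_trans h5.
have -> : 2 * k.+1 * k.+2 * (d + f + (d * f + d + td)) =
  2 * k.+1 * k.+2 * (d + f + (d * f + d)) + k.+2 * (2 * k.+1 * td) by ring.
have arith G T X S A Y B : B <= A -> T <= X -> G + X + S + A = Y + B -> G + T <= Y by lia.
(* The explicit polynomial is the slack [S]: what is left of the target [Y] after removing [G], [X]
   and the square ((k+1) f - d)^2 = A - B. *)
apply: (arith _ _ _ (k.+2 * c * (k * d.+1 + k.+1 * f) + k.+1 * k.+2 * (2 * d + 4 * f + 4))
  _ _ _ h3 h4); ring.
Qed.

(* The exponent k e^2 / (2 (k+1)) is the maximum over e >= d1 >= ... >= dk of the
   sum of the d_i (d_(i-1) - d_i), the dimensions of Grassmannians. *)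
Lemma abelem_chains_le k : exists c, forall (gT : finGroupType) (E : {group gT}) e t,
  (p.-abelem E)%g -> #|E| = p ^ e -> k * e ^ 2 + c * e.+1 <= 2 * k.+1 * t ->
  group_chains k E <= p ^ t.
Proof.
elim: k => [|k [c IH]]; first by exists 0 => gT E e t _ _ _ /=; rewrite expn_gt0 p_gt0.
(* The three terms pay, in this order, for the linear exponents (number of ranks, loss in the
   Grassmannian count), for the linear term of the induction hypothesis, and for the rounding in
   [td]. *)
exists (4 * k.+2 + k.+2 * c + 2 * k.+2) => gT E e t abE oE et /=.
have le_et : e <= t by have := chain_exponent (k := k) (c := c) (d := 0) (f := e) (td := 0); nia.
pose logH (H : {group gT}) : 'I_e.+1 := inord (logn p #|H|).
rewrite (partition_big logH xpredT) //=.
(* Subgroups are grouped by rank d; as there are e + 1 <= p^e ranks, a bound p^(t - e) for each of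
   them is enough. *)
apply: (@leq_trans (\sum_(d < e.+1) p ^ (t - e))).
  apply: leq_sum => d _; have de : d <= e by rewrite -ltnS.
  pose td := (k * d ^ 2 + c * d.+1) %/ (2 * k.+1) + 1.
  have tdP : k * d ^ 2 + c * d.+1 <= 2 * k.+1 * td.
    by rewrite /td addn1 [X in _ <= X]mulnC ltnW // ltn_ceil.
  have tdQ : 2 * k.+1 * td <= k * d ^ 2 + c * d.+1 + 2 * k.+1.
    by rewrite /td addn1 [X in X <= _]mulnC mulSn addnC leq_add2r leq_trunc_div.
  have bound : (d * (e - d) + d) + td <= t - e.
    by have := chain_exponent (f := e - d) tdQ; rewrite subnKC // leq_subRL //; apply.
  have subP (H : {group gT}) : (H \subset E) && (logH H == d) ->
      (H \subset E) && (#|H| == p ^ d).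
    case/andP => sHE /eqP ld; rewrite sHE /=.
    have /(dvdn_pfactor _ _ p_pr)[i ie oH] : #|H| %| p ^ e by rewrite -oE cardSg.
    by rewrite oH -ld /logH oH pfactorK // inordK.
  apply: (@leq_trans (\sum_(H in [set H : {group gT} | (H \subset E) && (#|H| == p ^ d)]) p ^ td)).
    rewrite big_mkcond [leqRHS]big_mkcond /=; apply: leq_sum => H _.
    case: ifP => // /subP HP; rewrite inE HP.
    case/andP: HP => sHE /eqP oH; exact: IH (abelemS sHE abE) oH tdP.
  rewrite sum_nat_const; apply: (@leq_trans (p ^ (d * (e - d) + d) * p ^ td)).
    by rewrite leq_mul2r (card_abelem_subgroups p_pr abE oE de) orbT.
  by rewrite -expnD leq_pexp2l.
rewrite sum_nat_const card_ord.
apply: (@leq_trans (p ^ e * p ^ (t - e))); last by rewrite -expnD subnKC.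
by rewrite leq_mul2r ltn_expl ?orbT.
Qed.

End ChainBounds.

(* A subgroup of R^s x R^l is determined by its fiber over 0 and one point in each nonempty
   fiber, which leaves p^O(l) subgroups with a given fiber over 0. *)
Section FiberChains.
Variable q : nat.
Hypothesis q_gt1 : (1 < q)%N.
Local Notation R := 'Z_q.
Variables s l : nat.

Definition fiber (G : {set 'cV[R]_(s + l)}) : {set 'cV[R]_l} :=
  [set y : 'cV[R]_l | col_mx 0 y \in G].

Lemma fiber_group_set (G : {group 'cV[R]_(s + l)}) : group_set (fiber G).
Proof.
apply: additive_group_set => [|y z]; rewrite !inE; first by rewrite col_mx0 -zmod1gE group1.
by move=> Gy Gz; rewrite -[0]addr0 -add_col_mx -zmodMgE groupM.
Qed.
Canonical fiber_group G := Group (fiber_group_set G).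

Let lifts (G : {set 'cV[R]_(s + l)}) : {ffun 'cV[R]_s -> option 'cV[R]_l} :=
  [ffun b => [pick y : 'cV[R]_l | col_mx b y \in G]].

Let fiber_lifts_sub (G H : {group 'cV[R]_(s + l)}) :
  fiber G = fiber H -> lifts G = lifts H -> G \subset H.
Proof.
move=> eqf /ffunP eql; apply/subsetP => x Gx.
move: (Gx); rewrite -(vsubmxK x); set b := usubmx x; set y := dsubmx x => Gby.
have := eql b; rewrite !ffunE; case: pickP => [y0 Gy0|/(_ y)]; last by rewrite Gby.
case: pickP => // y1 Hy1 [ey]; rewrite -ey in Hy1.
have : y - y0 \in fiber G.
  by rewrite inE -[0](subrr b) -[- y0]/(- y0) -add_col_mx -opp_col_mx -zmodVgE -zmodMgE groupM ?groupV.
rewrite eqf inE => Hyy.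
have -> : col_mx b y = col_mx 0 (y - y0) + col_mx b y0 by rewrite add_col_mx add0r subrK.
by rewrite -zmodMgE groupM.
Qed.

Lemma card_fiber_eq (E : {set 'cV[R]_l}) :
  (#|[set H : {group 'cV[R]_(s + l)} | fiber H == E]| <= (q ^ l).+1 ^ (q ^ s))%N.
Proof.
rewrite -(card_cVq q_gt1 l) -(card_cVq q_gt1 s) -card_option -card_ffun.
set S := [set H | _].
have inj : {in S &, injective (fun H : {group _} => lifts H)}.
  move=> G H /[!inE] /eqP fG /eqP fH eql; apply/val_inj/eqP.
  by rewrite /= eqEsubset !fiber_lifts_sub // ?fG ?fH.
by rewrite -(card_in_imset inj) max_card.
Qed.

Lemma sum_fiber_le (E : {set 'cV[R]_l}) (f : {group 'cV[R]_l} -> nat) :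
  (\sum_(H : {group 'cV[R]_(s + l)} | fiber H \subset E) f (fiber_group H) <=
   (q ^ l).+1 ^ (q ^ s) * \sum_(H : {group 'cV[R]_l} | H \subset E) f H)%N.
Proof.
rewrite (partition_big (fun H => fiber_group H) (fun H : {group _} => H \subset E)) //=.
rewrite big_distrr /=; apply: leq_sum => F FE.
apply: (@leq_trans (\sum_(H in [set H : {group 'cV[R]_(s + l)} | fiber H == F]) f F)).
  rewrite big_mkcond [leqRHS]big_mkcond /=; apply: leq_sum => H _.
  by case: ifP => // /andP[_ /eqP <-]; rewrite inE eqxx.
by rewrite sum_nat_const leq_mul2r card_fiber_eq orbT.
Qed.

(** The fibers of nested subgroups are nested, and each of the k+1 subgroups is recovered from its
    fiber at the cost of one factor from [card_fiber_eq]. *)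
Lemma sum_fiber_chains k (E : {group 'cV[R]_l}) :
  (\sum_(H : {group 'cV[R]_(s + l)} | fiber H \subset E) group_chains k H <=
   ((q ^ l).+1 ^ (q ^ s)) ^ k.+1 * group_chains k.+1 E)%N.
Proof.
elim: k E => [|k IH] E; first by rewrite expn1; apply: (sum_fiber_le E (fun=> 1%N)).
apply: (@leq_trans (\sum_(H : {group 'cV[R]_(s + l)} | fiber H \subset E)
   ((q ^ l).+1 ^ (q ^ s)) ^ k.+1 * group_chains k.+1 (fiber_group H))%N); last first.
  have -> c N : (c ^ k.+2 * N = c ^ k.+1 * (c * N))%N by rewrite (expnSr c k.+1) mulnA.
  rewrite -big_distrr leq_mul2l; apply/orP; right.
  exact: (sum_fiber_le E (fun H => group_chains k.+1 H)).
apply: leq_sum => H _; apply: leq_trans (IH (fiber_group H)) => /=.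
rewrite big_mkcond [leqRHS]big_mkcond /=; apply: leq_sum => G _.
case: ifP => // /subsetP GH; rewrite ifT //.
by apply/subsetP => y; rewrite !inE => /GH.
Qed.

End FiberChains.

Section TorsionChains.
Variables p m : nat.
Hypothesis p_pr : prime p.
Local Notation q := (p ^ m.+1)%N.
Local Notation R := 'Z_q.
Let p_gt0 := prime_gt0 p_pr.

Lemma ppow_gt1 : (1 < q)%N. Proof. by rewrite -(exp1n m.+1) ltn_exp2r ?prime_gt1. Qed.

Definition ptorsion l : {set 'cV[R]_l} := [set y : 'cV[R]_l | p%:R *: y == 0].

Lemma ptorsion_group_set l : group_set (ptorsion l).
Proof.
apply: additive_group_set => [|x y]; rewrite !inE ?scaler0 // => /eqP x0 /eqP y0.
by rewrite scalerDr x0 y0 addr0.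
Qed.
Canonical ptorsion_group l := Group (ptorsion_group_set l).

Lemma Zq_val_lt (a : R) : (a < q)%N.
Proof. by rewrite -[X in (_ < X)%N](Zp_cast ppow_gt1) ltn_ord. Qed.

Lemma natr_Zq_eq0 a : (a%:R == 0 :> R) = (q %| a)%N.
Proof. by rewrite -val_eqE /= val_Zp_nat ?ppow_gt1. Qed.

Lemma pmulr_eq0 (a : R) : (p%:R * a == 0) = (p ^ m %| a)%N.
Proof.
rewrite -[a in LHS]natr_Zp -natrM natr_Zq_eq0.
have h b : (p ^ m.+1 %| p * b)%N = (p ^ m %| b)%N by rewrite expnS dvdn_pmul2l.
exact: h.
Qed.

Lemma card_ptorsion l : #|ptorsion l| = (p ^ l)%N.
Proof.
have card1 : #|[set a : R | p%:R * a == 0]| = p.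
  pose h (i : 'I_p) : R := (i * p ^ m)%:R.
  have hv i : h i = (i * p ^ m)%N :> nat.
    rewrite /h val_Zp_nat ?ppow_gt1 // modn_small // expnS ltn_pmul2r ?ltn_ord //.
    by rewrite expn_gt0 p_gt0.
  have hI : injective h.
    move=> i j /(congr1 (@nat_of_ord _)); rewrite !hv => /eqP.
    by rewrite eqn_pmul2r ?expn_gt0 ?p_gt0 // => /eqP/val_inj.
  rewrite -[RHS]card_ord -(card_imset _ hI); apply: eq_card => a.
  rewrite inE pmulr_eq0; apply/idP/imsetP => [/dvdnP[i ai]|[i _ ->]].
    have ip : (i < p)%N.
      by have := Zq_val_lt a; rewrite ai expnS ltn_pmul2r ?expn_gt0 ?p_gt0.
    by exists (Ordinal ip) => //; apply: val_inj; rewrite /= hv ai.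
  by rewrite hv dvdn_mull.
have -> : #|ptorsion l| = #|[set x : {ffun 'I_l -> R} | x \in ffun_on (mem [set a : R | p%:R * a == 0])]|.
  pose h (f : {ffun 'I_l -> R}) : 'cV[R]_l := \col_i f i.
  have hI : injective h.
    by move=> f g /colP fg; apply/ffunP => i; have := fg i; rewrite !mxE.
  rewrite -(card_imset _ hI); apply: eq_card => y; apply/idP/imsetP.
    rewrite inE => /eqP/colP py; exists [ffun i => y i 0].
      rewrite inE; apply/ffun_onP => i; rewrite ffunE inE.
      by have := py i; rewrite !mxE => ->.
    by apply/colP => i; rewrite !mxE ffunE.
  case=> f; rewrite inE => /ffun_onP fP ->; rewrite inE; apply/eqP/colP => i.
  by rewrite !mxE; have := fP i; rewrite inE => /eqP.
by rewrite cardsE card_ffun_on card1 card_ord.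
Qed.

Lemma ptorsion_abelem l : (p.-abelem (ptorsion l))%g.
Proof.
apply/abelemP => //; split.
  by apply/centsP => x _ y _; rewrite /commute !zmodMgE addrC.
move=> x; rewrite inE => /eqP px; rewrite zmodXgE zmod1gE.
by rewrite -scaler_nat.
Qed.

(** The fibers form chains of k+1 subgroups in an elementary abelian group of rank l, so the sum is
    p^((k+1) l^2 / (2 (k+2)) + O(l)). The gap of l^2 / (2 (k+2)) to the leading term l^2 / 2 of C(l,
    2) absorbs everything linear, including the factor p^l, which makes the sieve remainder tend to
    0 in l. *)
Lemma sum_torsion_chains_le k s : exists l0, forall l, (l0 <= l)%N ->
  (p ^ l * \sum_(H : {group 'cV[R]_(s + l)} | fiber H \subset ptorsion l) group_chains k H
   <= p ^ 'C(l, 2))%N.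
Proof.
have [c cP] := abelem_chains_le p_pr k.+1.
(* Passing to fibers costs at most p^(a l + b): each of k+1 subgroups costs (q^l + 1)^(q^s), and q^l
   + 1 <= p^((m+1) l + 1). *)
pose a := (m.+1 * (q ^ s * k.+1))%N; pose b := (q ^ s * k.+1)%N.
exists (k.+2 + 2 * k.+2 * (a + b + 2) + 2 * c)%N => l l0.
pose t := ((k.+1 * l ^ 2 + c * l.+1) %/ (2 * k.+2) + 1)%N.
have tP : (k.+1 * l ^ 2 + c * l.+1 <= 2 * k.+2 * t)%N.
  by rewrite /t addn1 [X in (_ <= X)%N]mulnC ltnW // ltn_ceil.
have tQ : (2 * k.+2 * t <= k.+1 * l ^ 2 + c * l.+1 + 2 * k.+2)%N.
  by rewrite /t addn1 [X in (X <= _)%N]mulnC mulSn addnC leq_add2r leq_trunc_div.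
apply: (@leq_trans (p ^ l * (p ^ ((m.+1 * l).+1 * b) * p ^ t))%N).
  rewrite leq_mul2l; apply/orP; right.
  apply: leq_trans (sum_fiber_chains ppow_gt1 s k (ptorsion_group l)) _.
  apply: leq_mul; last exact: cP (ptorsion_abelem l) (card_ptorsion l) tP.
  rewrite -expnM [X in (_ <= X)%N]expnM leq_exp2r ?muln_gt0 ?expn_gt0 ?p_gt0 //.
  rewrite -expnM expnS; apply: (@leq_trans (2 * p ^ (m.+1 * l))%N).
    by rewrite mul2n -addnn -add1n leq_add2r expn_gt0 p_gt0.
  by rewrite leq_mul2r prime_gt1 ?orbT.
rewrite -!expnD leq_pexp2l //.
suff h : (2 * k.+2 * (l + ((m.+1 * l).+1 * b + t)) <= k.+2 * (2 * 'C(l, 2)))%N.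
  have e2 : (k.+2 * (2 * 'C(l, 2)) = 2 * k.+2 * 'C(l, 2))%N by ring.
  by move: h; rewrite e2 leq_pmul2l.
have l_gt0 : (0 < l)%N by apply: leq_trans l0; rewrite !addSn.
have -> : (2 * 'C(l, 2) = l ^ 2 - l)%N.
  by rewrite mulnC (bin_ffact l 2) ffactnS ffactn1 expnS expn1 -subn1 mulnBr muln1.
have sq : (l * (k.+2 + 2 * k.+2 * (a + b + 2) + 2 * c) <= l ^ 2)%N.
  by rewrite expnS expn1 leq_mul2l l0 orbT.
rewrite mulnBr leq_subRL; last by rewrite leq_mul2l expnS expn1 leq_pmulr ?orbT.
have -> : (k.+2 * l + 2 * k.+2 * (l + ((m.+1 * l).+1 * b + t)) =
  2 * k.+2 * t + (k.+2 * l + 2 * k.+2 * (l + a * l + b)))%N by rewrite /a /b; ring.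
apply: leq_trans (_ : _ <= k.+1 * l ^ 2 + c * l.+1 + 2 * k.+2 +
   (k.+2 * l + 2 * k.+2 * (l + a * l + b)))%N _; first by rewrite leq_add2r.
have -> : (k.+2 * l ^ 2 = k.+1 * l ^ 2 + l ^ 2)%N by ring.
move: (k.+1 * l ^ 2)%N (k.+2) sq => Z K sq.
rewrite -!addnA leq_add2l; apply: leq_trans sq.
have -> : (l * (K + 2 * K * (a + b + 2) + 2 * c) =
   c * (l + l) + (2 * K * l + (K * l + 2 * K * (l + a * l + b * l))))%N by ring.
have -> : (c * l.+1 + (K + (K + (0 + (K * l + 2 * K * (l + (a * l + b))))) ) =
  c * l.+1 + (2 * K + (K * l + 2 * K * (l + a * l + b))))%N by ring.
apply: leq_add; first by rewrite leq_mul2l -add1n leq_add2r l_gt0 orbT.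
apply: leq_add; first by rewrite leq_pmulr.
by rewrite leq_add2l leq_mul2l leq_add2l leq_pmulr ?orbT.
Qed.

End TorsionChains.

(** * The uniform law *)

Section PrimePowerModules.
Variables p m : nat.
Hypothesis p_pr : prime p.
Local Notation q := (p ^ m.+1)%N.
Local Notation R := 'Z_q.
Let p_gt0 := prime_gt0 p_pr.
Let q_gt1 := ppow_gt1 m p_pr.

Lemma ppow_eq0 : (p ^ m.+1)%:R = 0 :> R.
Proof. by apply/eqP; rewrite natr_Zq_eq0. Qed.

Lemma Zq_unit_or_pmul (a : R) : a \is a GRing.unit \/ exists b, a = p%:R * b.
Proof.
rewrite -[a]natr_Zp unitZpE // coprime_pexpl // prime_coprime //.
case: (boolP (p %| a)%N) => [/dvdnP[b ->]|]; last by left.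
by right; exists b%:R; rewrite natrM mulrC.
Qed.

(** p Z is nilpotent, so the geometric sum inverts 1 - p Z. *)
Lemma unitmx_1subp n (Z : 'M[R]_n) : 1%:M - p%:R *: Z \in unitmx.
Proof.
case: n Z => [|n] Z; first by rewrite [_ - _]thinmx0 unitmxE det_mx00 unitr1.
have N0 : (p%:R *: Z) ^+ m.+1 = 0 by rewrite exprZn -natrX ppow_eq0 scale0r.
have := subrX1 (p%:R *: Z) m.+1; rewrite N0 sub0r => /(congr1 -%R).
rewrite opprK -mulNr opprB => /esym/mulmx1_unit[].
by [].
Qed.

(** Nakayama's lemma for R^n: a matrix whose columns generate modulo p is invertible. *)
Lemma mulmx_pspan_unit n (A Y Z : 'M[R]_n) : A *m Y + p%:R *: Z = 1%:M -> A \in unitmx.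
Proof.
move=> e; have : A *m Y \in unitmx.
  by rewrite -[A *m Y](addrK (p%:R *: Z)) e unitmx_1subp.
by rewrite unitmx_mul => /andP[].
Qed.

Lemma mimg_mul_sub r n l (A : 'M[R]_(r, n)) (B : 'M[R]_(n, l)) : mimg (A *m B) \subset mimg A.
Proof. by apply/subsetP => _ /mimgP[x ->]; rewrite -mulmxA mem_mimg. Qed.

Lemma mimg_mul_unit r n (A : 'M[R]_(r, n)) (B : 'M[R]_n) :
  B \in unitmx -> mimg (A *m B) = mimg A.
Proof.
move=> uB; apply/eqP; rewrite eqEsubset mimg_mul_sub -{1}[A](mulmxK uB).
exact: mimg_mul_sub.
Qed.

(** Reduce the Smith form over the integers of a lift; unimodular matrices stay invertible. *)
Lemma smith_Zq r n (T : 'M[R]_(r, n)) : exists L : 'M[R]_r, exists U : 'M[R]_n,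
  exists D : 'M[R]_(r, n), [/\ L \in unitmx, U \in unitmx, T = L *m D *m U &
  forall (i : 'I_r) (j : 'I_n), (i != j :> nat) -> D i j = 0].
Proof.
pose T0 : 'M[int]_(r, n) := \matrix_(i, j) (T i j : nat)%:Z.
have [L uL [U uU [d _ eT]]] := int_Smith_normal_form T0.
pose f : {rmorphism int -> R} := intr.
exists (map_mx f L), (map_mx f U), (map_mx f (\matrix_(i, j) (d`_i *+ (i == j :> nat)))).
split; try by rewrite unitmxE det_map_mx rmorph_unit // -unitmxE.
  rewrite -!map_mxM -eT; apply/matrixP => i j; rewrite !mxE /=.
  by rewrite -pmulrn natr_Zp.
by move=> i j ij; rewrite !mxE (negbTE ij) mulr0n rmorph0.
Qed.

(** Take all elements of W as columns. In Smith form only the first n columns of [D] can be nonzero,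
    so multiplying by [E^T] cuts [D] to a square matrix, or pads it with zero columns, without
    changing the image; the right factor [U] does not affect the image. *)
Lemma group_mimg n (W : {group 'cV[R]_n}) : exists L D : 'M[R]_n,
  [/\ L \in unitmx, forall i j, i != j -> D i j = 0 & mimg (L *m D) = W].
Proof.
pose T : 'M[R]_(n, #|W|) := \matrix_(i, j) (enum_val j : 'cV[R]_n) i 0.
have TW : mimg T = W.
  have colT j : col j T = enum_val j by apply/colP => i; rewrite !mxE.
  apply/eqP; rewrite eqEsubset mimg_sub; apply/andP; split.
    by apply/forallP => j; rewrite colT enum_valP.
  apply/subsetP => x Wx; rewrite -(enum_rankK_in Wx Wx) -colT colE.
  exact: mem_mimg.
have [L [U [D [uL uU eT Dd]]]] := smith_Zq T.
pose E : 'M[R]_(n, #|W|) := \matrix_(i, j) (i == j :> nat)%:R.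
exists L, (D *m E^T); split=> //.
  move=> i j ij; rewrite mxE big1 // => l _; rewrite !mxE.
  have [il|il] := eqVneq (i : nat) l; last by rewrite Dd // mul0r.
  by rewrite -il [_ == _ :> nat](_ : _ = false) ?mulr0 //; apply: contraNF ij => /eqP/val_inj ->.
have DE : D *m E^T *m E = D.
  have EE l j : (E^T *m E) l j = ((l == j) && (l < n)%N)%:R.
    rewrite mxE; have [ln|ln] := ltnP l n; last first.
      rewrite andbF big1 // => k _; rewrite !mxE ltn_eqF ?mul0r //.
      exact: leq_trans (ltn_ord k) ln.
    rewrite (bigD1 (Ordinal ln)) //= big1 => [|k kl]; last first.
      rewrite !mxE [_ == _ :> nat](_ : _ = false) ?mul0r //.
      by apply: contraNF kl => /eqP kl; apply/eqP/val_inj.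
    by rewrite !mxE eqxx mul1r andbT addr0.
  apply/matrixP => i j; rewrite -mulmxA mxE (bigD1 j) //= EE eqxx /=.
  rewrite big1 ?addr0 => [|l lj]; last by rewrite EE (negbTE lj) mulr0.
  case: ltnP => jn; first by rewrite mulr1.
  by rewrite Dd ?mul0r // ltn_eqF // (leq_trans (ltn_ord i)).
suff -> : mimg (L *m (D *m E^T)) = mimg T by [].
apply/eqP; rewrite eqEsubset eT (mimg_mul_unit (L *m D) uU) mulmxA mimg_mul_sub /=.
by rewrite -{1}DE !mulmxA mimg_mul_sub.
Qed.

Definition ker_in_pspan n (P : 'M[R]_n) :=
  forall x : 'cV[R]_n, P *m x = 0 -> exists y : 'cV[R]_n, x = p%:R *: y.

(* W contains p^m R^n, so no diagonal entry of the Smith form vanishes: each is p^i u with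
   i <= m and u a unit, and its annihilator lies in pR. *)
Lemma group_generators n (W : {group 'cV[R]_n}) :
  (forall x : 'cV[R]_n, p%:R ^+ m *: x \in W) ->
  exists2 P : 'M[R]_n, mimg P = W & ker_in_pspan P.
Proof.
move=> pW; have [L [D [uL Dd eW]]] := group_mimg W.
exists (L *m D) => // x Px.
have Dx i : D i i * x i 0 = 0.
  have : D *m x = 0 by rewrite -(mulKmx uL (D *m x)) [L *m (D *m x)]mulmxA Px mulmx0.
  move/colP/(_ i); rewrite !mxE (bigD1 i) //= big1 ?addr0 // => j ji.
  by rewrite Dd ?mul0r // eq_sym.
have D0 i : D i i != 0.
  have : p%:R ^+ m *: (L *m delta_mx i 0) \in mimg (L *m D) by rewrite eW.
  case/mimgP => y; rewrite -mulmxA scalemxAr => /(congr1 (mulmx (invmx L))).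
  rewrite !mulKmx // => /colP/(_ i); rewrite !mxE !eqxx /= mulr1.
  rewrite (bigD1 i) //= big1 ?addr0 => [e|j ji]; last first.
    by rewrite Dd ?mul0r // eq_sym.
  apply: contraTneq (erefl true) => Di0; move/eqP: e; rewrite Di0 mul0r.
  by rewrite -natrX natr_Zq_eq0 // gtnNdvd ?expn_gt0 ?p_gt0 // ltn_exp2l ?prime_gt1.
have xp i : exists b, x i 0 = p%:R * b.
  have [ux|//] := Zq_unit_or_pmul (x i 0).
  by move: (D0 i); rewrite -(mulrK ux (D i i)) Dx mul0r eqxx.
have [b bP] := fin_all_exists xp.
by exists (\col_i b i); apply/colP => i; rewrite !mxE.
Qed.

(** If the images agree, then P e_j = P A y for some y, so e_j - A y lies in p R^n and Nakayama
    applies. The event thus has the same probability for every [P] with small kernel. *)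
Lemma mimg_mul_eq n (P A : 'M[R]_n) : ker_in_pspan P ->
  (mimg (P *m A) == mimg P) = (A \in unitmx).
Proof.
move=> kerP; apply/eqP/idP => [e|uA]; last exact: mimg_mul_unit.
have h j : exists yz : 'cV[R]_n * 'cV[R]_n, A *m yz.1 + p%:R *: yz.2 = delta_mx j 0.
  have : P *m delta_mx j 0 \in mimg (P *m A) by rewrite e mem_mimg.
  case/mimgP => y ey; have [|z ez] := kerP (delta_mx j 0 - A *m y).
    by rewrite mulmxBr ey mulmxA subrr.
  by exists (y, z); rewrite /= -ez addrC subrK.
have [yz yzP] := fin_all_exists h.
apply: (@mulmx_pspan_unit _ _ (\matrix_(i, j) (yz j).1 i 0) (\matrix_(i, j) (yz j).2 i 0)).
apply/matrixP => i j; have /colP/(_ i) := yzP j.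
rewrite !mxE eqxx andbT => <-; congr (_ + _).
by apply: eq_bigr => l _; rewrite mxE.
Qed.

End PrimePowerModules.

Fixpoint group_cochains (gT : finGroupType) (T : {group gT}) k (V : {group gT}) : nat :=
  if k is k'.+1 then (\sum_(W : {group gT} | V \subset W) group_cochains T k' W)%N
  else (V == T).

Section UniformLaw.
Variables (p m : nat) (K : rcfType).
Hypothesis p_pr : prime p.
Local Notation q := (p ^ m.+1)%N.
Local Notation R := 'Z_q.
Let p_gt0 := prime_gt0 p_pr.
Let q_gt1 := ppow_gt1 m p_pr.
Local Notation U := (unif K : R -> K).

Lemma colpr_unif_eq r n (F : 'M[R]_(r, n)) y :
  y \in mimg F -> colpr U F y = #|mimg F|%:R^-1.
Proof.
have shift x0 : colpr U F (F *m x0) = colpr U F 0.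
  rewrite /colpr [RHS](reindex_inj (addIr (- x0))) /=.
  by apply: eq_bigl => x; rewrite mulmxBr subr_eq0.
case/mimgP => x0 ->; rewrite shift; apply: (@mulfI _ #|mimg F|%:R).
  by rewrite pnatr_eq0 -lt0n (cardG_gt0 (mimg_group F)).
rewrite mulfV; last by rewrite pnatr_eq0 -lt0n (cardG_gt0 (mimg_group F)).
rewrite mulr_natl -sumr_const -(@sum_mweight R K U n 1 (sum_unif K q_gt1)).
rewrite [RHS](partition_big (fun x => F *m x) [in mimg F]) /=; last first.
  by move=> x _; apply: mem_mimg.
by apply: eq_bigr => _ /mimgP[x1 ->]; rewrite -(shift x1).
Qed.

Lemma mxpr_unif_eq r n l (F : 'M[R]_(r, n)) (F' : 'M[R]_(r, l)) :
  mimg F' \subset mimg F -> mxpr U F F' = #|mimg F|%:R ^- l.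
Proof.
move=> sub; rewrite mxpr_cols // (eq_bigr (fun=> #|mimg F|%:R^-1)) => [|j _].
  by rewrite prodr_const card_ord exprVn.
by apply: colpr_unif_eq; apply: (subsetP sub); rewrite colE mem_mimg.
Qed.

Variable n : nat.

Definition unit_prob : K := \sum_(A : 'M[R]_n | A \in unitmx) mweight U A.

(** Each T with image V is hit with probability |mimg P|^-n, so only the number of such T is
    missing. It is found by applying the same formula to a matrix [P0] with image V itself, for
    which the event says that A is invertible. *)
Lemma prob_mimg_eq (P : 'M[R]_n) (V : {group 'cV[R]_n}) :
    (forall x : 'cV[R]_n, p%:R ^+ m *: x \in V) -> V \subset mimg P ->
  \sum_(A : 'M[R]_n | mimg (P *m A) == V) mweight U A =
  unit_prob * (#|V|%:R / #|mimg P|%:R) ^+ n.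
Proof.
move=> pV; have [P0 eV kerP0] := group_generators p_pr pV.
have law (P1 : 'M[R]_n) : V \subset mimg P1 ->
    \sum_(A : 'M[R]_n | mimg (P1 *m A) == V) mweight U A =
    #|[set T : 'M[R]_n | mimg T == V]|%:R * #|mimg P1|%:R ^- n.
  move=> sub; rewrite (partition_big (fun A => P1 *m A) (fun T => mimg T == V)) //=.
  rewrite mulr_natl -sumr_const; apply: eq_big => [T|T eT]; first by rewrite inE.
  rewrite -(@mxpr_unif_eq n n n P1 T) ?(eqP eT) //; apply: eq_bigl => A.
  by apply: andb_idl => /eqP ->.
move=> sub; rewrite law // /unit_prob.
have -> : \sum_(A : 'M[R]_n | A \in unitmx) mweight U A =
    \sum_(A : 'M[R]_n | mimg (P0 *m A) == V) mweight U A.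
  by apply: eq_bigl => A; rewrite -eV (mimg_mul_eq p_pr _ kerP0).
rewrite law ?eV // -mulrA; congr (_ * _).
rewrite exprMn exprVn mulrA mulVf ?mul1r //.
by rewrite expf_neq0 // pnatr_eq0 -lt0n cardG_gt0.
Qed.

(** Images shrink under multiplication on the right, so the induction on images must split off the
    last factor, whereas [Ex] splits off the first. *)
Lemma Ex_right (mu : R -> K) k (g : 'M[R]_n -> K) :
  Ex mu k.+1 g = Ex mu k (fun A => \sum_B mweight mu B * g (A *m B)).
Proof.
elim: k g => [|k IH] g.
  by rewrite /=; apply: eq_bigr => A _; rewrite mulmx1 mul1mx.
rewrite [LHS]/= [RHS]/=; apply: eq_bigr => A _; congr (_ * _).
rewrite -[LHS]/(Ex mu k.+1 (fun A' => g (A *m A'))) IH.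
by apply: eq_Ex => A'; apply: eq_bigr => B _; rewrite mulmxA.
Qed.

(** Condition on the image W of the first k factors: passing from W to V costs [unit_prob] times
    (|V| / |W|)^n, and these ratios telescope along the chain. *)
Lemma Ex_unif_mimg k (V : {group 'cV[R]_n}) : (forall x : 'cV[R]_n, p%:R ^+ m *: x \in V) ->
  Ex U k (fun A => (mimg A == V)%:R) =
  unit_prob ^+ k * (#|V|%:R / (q ^ n)%:R) ^+ n * (group_cochains [set: _]%G k V)%:R.
Proof.
elim: k V => [|k IH] V pV.
  rewrite /= expr0 mul1r.
  have -> : mimg (1%:M : 'M[R]_n) = [set: 'cV[R]_n].
    by apply/setP => x; rewrite inE -[x]mul1mx mem_mimg.
  have -> : (V == [set: 'cV[R]_n]%G) = ([set: 'cV[R]_n] == V) by rewrite eq_sym -val_eqE.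
  case: eqP => [<-|_]; last by rewrite mulr0.
  by rewrite cardsT card_cVq // mulfV ?expr1n ?mulr1 // pnatr_eq0 -lt0n expn_gt0 expn_gt0 p_gt0.
rewrite Ex_right.
have step (A : 'M[R]_n) : \sum_(B : 'M[R]_n) mweight U B * (mimg (A *m B) == V)%:R =
    \sum_(W : {group 'cV[R]_n} | V \subset W)
      unit_prob * (#|V|%:R / #|W|%:R) ^+ n * (mimg A == W)%:R.
  transitivity (\sum_(B : 'M[R]_n | mimg (A *m B) == V) mweight U B).
    rewrite [RHS]big_mkcond; apply: eq_bigr => B _.
    by case: eqP => _; rewrite ?mulr1 ?mulr0.
  have [sub|nsub] := boolP (V \subset mimg A).
    rewrite prob_mimg_eq // (bigD1 (mimg_group A)) //= eqxx mulr1 big1 ?addr0 //.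
    by move=> W /andP[_]; rewrite -val_eqE /= eq_sym => /negbTE ->; rewrite mulr0.
  rewrite big_pred0 ?big1 // => [W VW|B].
    by rewrite (_ : _ == _ = false) ?mulr0 //; apply: contraNF nsub => /eqP ->.
  by apply: contraNF nsub => /eqP <-; apply: mimg_mul_sub.
rewrite (eq_Ex _ _ step) Ex_sum /= natr_sum mulr_sumr; apply: eq_bigr => W VW.
rewrite ExZ IH => [|x]; last exact: (subsetP VW).
have W0 : #|W|%:R != 0 :> K by rewrite pnatr_eq0 -lt0n cardG_gt0.
rewrite exprS !exprMn !exprVn; have : #|W|%:R ^+ n != 0 :> K by rewrite expf_neq0.
set w := _ ^+ n => w0; set u := unit_prob; set v := _ ^+ n; set Q := (q ^ n)%:R ^- n.
transitivity (u * u ^+ k * v * Q * (group_cochains [set: 'cV[R]_n]%G k W)%:R * (w / w)).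
  by ring.
by rewrite mulfV // mulr1 -!mulrA.
Qed.

(** A matrix over R is invertible iff its reduction mod p is, by Nakayama applied to a lift of the
    inverse, and a uniform entry reduces to a uniform one. Hence [unit_prob] is the proportion of
    GL_n(F_p) among all matrices. *)
Let red (a : R) : 'F_p := (a : nat)%:R.

Let red_nat a : red a%:R = a%:R.
Proof.
rewrite /red val_Zp_nat // [in RHS](divn_eq a q) natrD natrM.
have -> : q%:R = 0 :> 'F_p by rewrite natrX pchar_Fp_0 // expr0n.
by rewrite mulr0 add0r.
Qed.

Let redD : {morph red : a b / a + b}.
Proof. by move=> a b; rewrite -[a]natr_Zp -[b]natr_Zp -natrD !red_nat natrD. Qed.

Let redM : {morph red : a b / a * b}.
Proof. by move=> a b; rewrite -[a]natr_Zp -[b]natr_Zp -natrM !red_nat natrM. Qed.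

Let red_lift (b : 'F_p) : red (b : nat)%:R = b.
Proof. by rewrite red_nat natr_Zp. Qed.

Let red0 : red 0 = 0. Proof. exact: (red_nat 0). Qed.
Let red1 : red 1 = 1. Proof. exact: (red_nat 1). Qed.

Let red_eq0 (a : R) : red a = 0 -> exists b, a = p%:R * b.
Proof.
move=> a0; have : (p %| a)%N.
  by rewrite (dvdn_pcharf (pchar_Fp p_pr)); apply/eqP.
by case/dvdnP => b ab; exists b%:R; rewrite -[a]natr_Zp ab natrM mulrC.
Qed.

Let red_mul (A B : 'M[R]_n) : map_mx red (A *m B) = map_mx red A *m map_mx red B.
Proof.
apply/matrixP => i j; rewrite !mxE (big_morph red redD red0).
by apply: eq_bigr => l _; rewrite redM !mxE.
Qed.

Let red_add (A B : 'M[R]_n) : map_mx red (A + B) = map_mx red A + map_mx red B.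
Proof. by apply/matrixP => i j; rewrite !mxE redD. Qed.

Let red_scalar1 : map_mx red 1%:M = 1%:M :> 'M_n.
Proof. by apply/matrixP => i j; rewrite !mxE; case: eqP; rewrite ?red0 ?red1. Qed.

Let red_unit (A : 'M[R]_n) : (map_mx red A \in unitmx) = (A \in unitmx).
Proof.
apply/idP/idP => uA; last first.
  have e : map_mx red A *m map_mx red (invmx A) = 1%:M by rewrite -red_mul mulmxV.
  have : map_mx red A *m map_mx red (invmx A) \in unitmx by rewrite e unitmx1.
  by rewrite unitmx_mul => /andP[uA1 _]; exact: uA1.
pose B : 'M[R]_n := \matrix_(i, j) ((invmx (map_mx red A) i j : nat)%:R).
have rB : map_mx red B = invmx (map_mx red A).
  by apply/matrixP => i j; rewrite !mxE red_lift.
have r0 : map_mx red (1%:M - A *m B) = 0.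
  have := red_add (1%:M - A *m B) (A *m B).
  by rewrite subrK red_scalar1 red_mul rB mulmxV // => /esym/(canRL (addrK _)); rewrite subrr.
have h (ij : 'I_n * 'I_n) : exists z, (1%:M - A *m B) ij.1 ij.2 = p%:R * z.
  by apply: red_eq0; move/matrixP/(_ ij.1 ij.2): r0; rewrite mxE [in RHS]mxE.
have [z zP] := fin_all_exists h.
apply: (mulmx_pspan_unit p_pr (Y := B) (Z := \matrix_(i, j) z (i, j))).
apply/matrixP => i j; rewrite mxE [X in _ + X]mxE [X in p%:R * X]mxE -(zP (i, j)) /=.
by rewrite [X in _ + X]mxE [X in _ + (_ + X)]mxE addrC subrK.
Qed.

Let sum_red (b : 'F_p) : \sum_(a | red a == b) U a = p%:R^-1.
Proof.
have shift c : \sum_(a | red a == c) U a = \sum_(a | red a == 0) U a.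
  rewrite [RHS](reindex_inj (addIr (- (c : nat)%:R))) /=.
  apply: eq_bigl => a; have e : red a = red (a - (c : nat)%:R) + c.
    by rewrite -[X in _ + X]red_lift -redD subrK.
  by rewrite e -[X in _ == X]add0r (inj_eq (addIr _)).
have p0 : p%:R != 0 :> K by rewrite pnatr_eq0 -lt0n.
apply: (mulfI p0); rewrite mulfV // -[RHS](sum_unif K q_gt1) mulr_natl.
rewrite [RHS](partition_big red xpredT) //=.
set S := \sum_(a | red a == b) _.
rewrite (eq_bigr (fun=> S)) => [|c _]; last by rewrite /S !shift.
by rewrite sumr_const card_Fp.
Qed.

Let sum_map_red (B : 'M['F_p]_n) :
  \sum_(A : 'M[R]_n | map_mx red A == B) mweight U A = p%:R^-1 ^+ (n * n).
Proof.
pose g j (x : 'cV[R]_n) : K := \prod_i (if red (x i 0) == B i j then U (x i 0) else 0).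
transitivity (\sum_(A : 'M[R]_n) \prod_j g j (col j A)).
  rewrite big_mkcond; apply: eq_bigr => A _; case: eqP => [eA|/eqP neA].
    apply: eq_bigr => j _; apply: eq_bigr => i _.
    by rewrite mxE -eA [X in _ == X]mxE eqxx.
  have [[i j] /= ij] : exists ij : 'I_n * 'I_n, red (A ij.1 ij.2) != B ij.1 ij.2.
    apply/existsP; apply: contraR neA => /existsPn h; apply/eqP/matrixP => i j.
    move: (h (i, j)); rewrite negbK /= => /eqP <-; by rewrite mxE.
  by rewrite (bigD1 j) //= /g (bigD1 i) //= mxE (negbTE ij) !mul0r.
rewrite (sum_mx_prod_col g) (eq_bigr (fun=> p%:R^-1 ^+ n)) => [|j _].
  by rewrite prodr_const card_ord exprM.
rewrite (sum_cV_prod (fun i a => if red a == B i j then U a else 0)).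
rewrite (eq_bigr (fun=> p%:R^-1)) => [|i _]; last by rewrite -big_mkcond sum_red.
by rewrite prodr_const card_ord.
Qed.

Let unit_prob_card :
  unit_prob = #|[set B : 'M['F_p]_n | B \in unitmx]|%:R * p%:R^-1 ^+ (n * n).
Proof.
rewrite /unit_prob (partition_big (map_mx red) [in unitmx]) /= => [|A]; last by rewrite red_unit.
rewrite mulr_natl -sumr_const; apply: eq_big => [B|B uB]; first by rewrite inE.
rewrite -(sum_map_red B); apply: eq_bigl => A; apply: andb_idl => /eqP eB.
by rewrite -red_unit eB.
Qed.

Lemma unit_prob_eq : unit_prob = \prod_(0 <= i < n) (1 - p%:R^-1 * p%:R^-1 ^+ i).
Proof.
have p0 : p%:R != 0 :> K by rewrite pnatr_eq0 -lt0n.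
rewrite unit_prob_card.
have -> : #|[set B : 'M['F_p]_n | B \in unitmx]| =
    (p ^ 'C(n, 2) * \prod_(0 <= i < n) (p ^ i.+1 - 1))%N.
  case: (n) => [|n'].
    rewrite big_geq // bin0n expn0 (_ : [set B | _] = setT) ?cardsT ?card_mx ?muln0 //.
    by apply/setP => B; rewrite !inE unitmxE det_mx00 unitr1.
  have := card_GL 'F_p (ltn0Sn n'); rewrite big_add1 /= card_Fp // => <-.
  rewrite /GLgroup cardsT card_sub cardsE; apply: eq_card => B; rewrite !inE.
  by [].
elim: (n) => [|k IH]; first by rewrite !big_geq // bin0n !expn0 muln1 expr0 mulr1.
rewrite !big_nat_recr //= -IH binS bin1 expnD [(k.+1 * k.+1)%N](_ : _ = k * k + (k + k.+1))%N; last by lia.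
rewrite !natrM natrB ?expn_gt0 ?p_gt0 // !natrX exprD exprD -exprS !exprVn.
by field; rewrite ?expf_neq0 // p0.
Qed.

End UniformLaw.

(** * Sieving for equality of kernel and image *)

Section Sieve.
Variables (p : nat) (K : realFieldType).
Hypothesis p_gt1 : (1 < p)%N.
Let p_gt0 : (0 < p)%N. Proof. exact: ltnW. Qed.

(* Interpolates 1 at Y = 1 and 0 at Y = p, ..., p^l; beyond p^l it has sign (-1)^l. *)
Definition sieve_poly l : {poly K} :=
  \prod_(i < l) (((p ^ i.+1)%:R - 1)^-1 *: ((p ^ i.+1)%:R%:P - 'X)).

Let sieve_eval l (y : K) :
  (sieve_poly l).[y] = \prod_(i < l) (((p ^ i.+1)%:R - y) / ((p ^ i.+1)%:R - 1)).
Proof.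
rewrite /sieve_poly horner_prod; apply: eq_bigr => i _.
by rewrite hornerZ !hornerE mulrC.
Qed.

Let den_gt0 i : 0 < (p ^ i.+1)%:R - 1 :> K.
Proof. by rewrite subr_gt0 ltr1n -(exp1n i.+1) ltn_exp2r. Qed.

(** For 1 <= j <= l one factor vanishes. For j > l every factor is negative, and its absolute value
    is at most p^j / p^i because p^(i+1) - 1 >= p^i; the product of the p^i is p^C(l, 2). *)
Lemma sieve_poly_bound l j :
  let e := (sieve_poly l).[(p ^ j)%:R] - (j == 0)%:R in
  0 <= (-1) ^+ l * e <= (p ^ j)%:R ^+ l / (p ^ 'C(l, 2))%:R.
Proof.
rewrite /= sieve_eval.
have b0 : 0 <= (p ^ j)%:R ^+ l / (p ^ 'C(l, 2))%:R :> K by rewrite mulr_ge0 ?invr_ge0 ?exprn_ge0 ?ler0n.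
have [j0|j0] := eqVneq j 0%N; first rewrite j0 in b0 *.
  rewrite big1 => [|i _]; first by rewrite /= subrr mulr0 lexx.
  by rewrite expn0 mulfV // (gt_eqF (den_gt0 i)).
rewrite subr0; have [jl|lj] := leqP j l.
  case: j j0 jl b0 => // j _ jl b0.
  by rewrite (bigD1 (Ordinal jl)) //= subrr !mul0r mulr0 lexx.
have cst (c : K) : c ^+ l = \prod_(i < l) c by rewrite prodr_const card_ord.
rewrite !cst -big_split /=.
have -> : (p ^ 'C(l, 2))%:R = \prod_(i < l) (p ^ i)%:R :> K.
  by rewrite -bin2_sum big_mkord expn_sum natr_prod.
rewrite -prodf_div; apply/andP; split.
  apply: prodr_ge0 => i _; rewrite mulN1r -mulNr opprB divr_ge0 ?(ltW (den_gt0 i)) //.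
  by rewrite subr_ge0 ler_nat leq_exp2l // ltnW // (leq_ltn_trans (ltn_ord i)).
apply: ler_prod => i _; rewrite mulN1r -mulNr opprB; apply/andP; split.
  rewrite divr_ge0 ?(ltW (den_gt0 i)) //.
  by rewrite subr_ge0 ler_nat leq_exp2l // ltnW // (leq_ltn_trans (ltn_ord i)).
apply: ler_pM.
- by rewrite subr_ge0 ler_nat leq_exp2l // ltnW // (leq_ltn_trans (ltn_ord i)).
- by rewrite invr_ge0 (ltW (den_gt0 i)).
- by rewrite gerBl ler0n.
rewrite lef_pV2 ?posrE ?den_gt0 ?ltr0n ?expn_gt0 ?p_gt0 //.
rewrite lerBrDr -[1]/(1%:R) -natrD ler_nat expnS.
apply: (@leq_trans (2 * p ^ i)); last by rewrite leq_mul2r p_gt1 orbT.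
by rewrite mul2n -addnn leq_add2l expn_gt0 p_gt0.
Qed.

End Sieve.

Section Surjections.
Variables (p m : nat) (K : rcfType).
Hypothesis p_pr : prime p.
Local Notation q := (p ^ m.+1)%N.
Local Notation R := 'Z_q.
Let q_gt1 := ppow_gt1 m p_pr.
Variables (s : nat) (C : {group 'cV[R]_s}).

Definition mxker r n (f : 'M[R]_(r, n)) : {set 'cV[R]_n} := [set x : 'cV[R]_n | f *m x == 0].

Lemma mxker_group_set r n (f : 'M[R]_(r, n)) : group_set (mxker f).
Proof.
apply: additive_group_set => [|x y]; rewrite !inE ?mulmx0 // => /eqP x0 /eqP y0.
by rewrite mulmxDr x0 y0 addr0.
Qed.
Canonical mxker_group r n (f : 'M[R]_(r, n)) := Group (mxker_group_set f).

Lemma card_mxker_mimg r n (f : 'M[R]_(r, n)) : (#|mxker f| * #|mimg f| = q ^ n)%N.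
Proof.
have e : #|{: 'cV[R]_n}| = (\sum_(y in mimg f) \sum_(x : 'cV[R]_n | f *m x == y) 1)%N.
  rewrite -sum1_card (partition_big (fun x => f *m x) [in mimg f]) //= => x _.
  exact: mem_mimg.
rewrite -(card_cVq q_gt1) e mulnC -sum_nat_const; apply: eq_bigr => _ /mimgP[x0 ->].
rewrite sum1dep_card -(card_imset (mem (mxker f)) (addIr x0)); apply: eq_card => x.
rewrite [RHS]inE; apply/imsetP/eqP => [[y /[!inE] /eqP fy ->]|fx].
  by rewrite mulmxDr fy add0r.
by exists (x - x0); rewrite ?subrK // inE mulmxBr fx subrr.
Qed.

Variable n : nat.
Implicit Types (f : 'M[R]_(s, n)) (A : 'M[R]_n).

Definition torsion_on l f (H : 'M[R]_(l, n)) :=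
  [forall (x : 'cV[R]_n | x \in mxker f), p%:R *: (H *m x) == 0].

(* The annihilator of im A + p ker f; when f A = 0 its order is #|C| times the index of
   im A + p ker f in ker f, which is 1 iff ker f = im A by Nakayama's lemma. *)
Definition dual_count f A : nat :=
  #|[set h : 'rV[R]_n | (h *m A == 0) && torsion_on f h]|.

Lemma dual_countP f A : mimg f = C -> f *m A = 0 ->
  exists2 j, dual_count f A = (#|C| * p ^ j)%N & (j == 0)%N = (mxker f == mimg A).
Proof.
move=> fC fA; have [L [D [_ _]]] := group_mimg (mxker_group f).
move: (L *m D) => P eP /=.
(* [P] generates ker f, so [W] is im A + p ker f; [dual_count] is the order of the left kernel of
   this block matrix, and duality turns it into an index. *)
pose W := mimg_group (row_mx A (p%:R *: P)).
have AP (x : 'cV[R]_(n + n)) : row_mx A (p%:R *: P) *m x =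
    A *m usubmx x + p%:R *: (P *m dsubmx x).
  by rewrite -{1}[x]vsubmxK mul_row_col -scalemxAl.
have fP : f *m P = 0.
  apply/matrixP => i j; have : P *m delta_mx j 0 \in mxker f by rewrite -eP mem_mimg.
  by rewrite inE mulmxA -colE => /eqP/matrixP/(_ i 0); rewrite !mxE.
have WV : W \subset mxker f.
  apply/subsetP => _ /mimgP[x ->]; rewrite AP inE mulmxDr -scalemxAr !mulmxA fA fP.
  by rewrite !mul0mx scaler0 addr0.
have eY : dual_count f A = #|rker (row_mx A (p%:R *: P))|.
  apply: eq_card => h; rewrite !inE mul_mx_row -row_mx0.
  have -> : (row_mx (h *m A) (h *m (p%:R *: P)) == row_mx 0 0) =
      (h *m A == 0) && (h *m (p%:R *: P) == 0).
    by apply/eqP/andP => [/eq_row_mx[-> ->]|[/eqP -> /eqP ->]].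
  congr (_ && _); apply/forall_inP/eqP => [hP|hP x].
    apply/rowP => j; have := hP (P *m delta_mx j 0); rewrite -eP mem_mimg => /(_ isT).
    by rewrite mulmxA -colE -scalemxAr => /eqP/matrixP/(_ 0 0); rewrite !mxE.
  by rewrite -eP => /mimgP[y ->]; rewrite mulmxA scalemxAl scalemxAr hP mul0mx.
have cW : (#|W| * dual_count f A = q ^ n)%N by rewrite eY card_mimg_rker.
have W0 : (0 < #|W|)%N := cardG_gt0 W.
have eYi : dual_count f A = (#|C| * #|mxker f : W|%g)%N.
  apply/eqP; rewrite -(eqn_pmul2l W0) cW mulnCA (Lagrange WV) mulnC -fC.
  by rewrite card_mxker_mimg.
have : (#|mxker f : W|%g %| q ^ n)%N.
  by rewrite -(card_mxker_mimg f) dvdn_mulr // dvdn_indexg.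
rewrite -expnM => /(dvdn_pfactor _ _ p_pr)[j _ ej]; exists j; first by rewrite eYi ej.
have -> : (j == 0)%N = (#|mxker f : W|%g == 1)%N.
  by rewrite ej -[1%N](expn0 p) eqn_exp2l ?prime_gt1.
rewrite indexg_eq1; apply/idP/eqP => [VW|eVA]; last first.
  rewrite /= eVA; apply/subsetP => _ /mimgP[x ->]; apply/mimgP.
  exists (col_mx x 0); by rewrite mul_row_col mulmx0 addr0.
have hx j0 : exists x, col j0 P = row_mx A (p%:R *: P) *m x.
  by apply/mimgP/(subsetP VW); rewrite inE colE mulmxA fP mul0mx.
have [X hX] := fin_all_exists hx.
(* Nakayama: ker f = im A + p ker f gives P = A X1 + p P Z1, hence P (1 - p Z1) = A X1 with 1 - p Z1
   invertible. *)
pose X1 : 'M[R]_n := \matrix_(i, j) usubmx (X j) i 0.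
pose Z1 : 'M[R]_n := \matrix_(i, j) dsubmx (X j) i 0.
have eP1 : P = A *m X1 + p%:R *: (P *m Z1).
  apply/matrixP => i j0; have /colP/(_ i) := hX j0; rewrite AP mxE => ->.
  rewrite mxE [RHS]mxE [X in _ + X]mxE [X in _ = _ + X]mxE.
  by congr (_ + _ * _); rewrite !mxE; apply: eq_bigr => l _; rewrite !mxE.
have eP2 : P *m (1%:M - p%:R *: Z1) = A *m X1.
  by rewrite mulmxBr mulmx1 -scalemxAr {1}eP1 addrK.
apply/eqP; rewrite eqEsubset; apply/andP; split; last first.
  by apply/subsetP => _ /mimgP[x ->]; rewrite inE mulmxA fA mul0mx.
by rewrite -eP -(mimg_mul_unit P (unitmx_1subp p_pr Z1)) eP2 mimg_mul_sub.
Qed.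

Variable k : nat.
Implicit Type mu : R -> K.

Definition surj_count mu : K :=
  \sum_(f | mimg f == C) Ex mu k (fun A => (mxker f == mimg A)%:R).

Definition surj_moment mu i : K :=
  \sum_(f | mimg f == C) Ex mu k (fun A => (f *m A == 0)%:R * (dual_count f A)%:R ^+ i).

Definition fiber_torsion l (F : 'M[R]_(s + l, n)) :=
  (mimg (usubmx F) == C) && torsion_on (usubmx F) (dsubmx F).

Lemma card_dual_count l f A :
  #|[set H : 'M[R]_(l, n) | (H *m A == 0) && torsion_on f H]| = (dual_count f A ^ l)%N.
Proof.
rewrite /dual_count; set S := [set h : 'rV[R]_n | _].
have -> : (#|S| ^ l)%N = #|[set g : {ffun 'I_l -> 'rV[R]_n} | g \in ffun_on (mem S)]|.
  by rewrite [RHS]cardsE card_ffun_on card_ord.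
pose h (g : {ffun 'I_l -> 'rV[R]_n}) : 'M[R]_(l, n) := \matrix_(i, j) g i 0 j.
have hI : injective h.
  move=> f1 f2 /matrixP e; apply/ffunP => i; apply/rowP => j.
  by have := e i j; rewrite !mxE.
have rowh g i : row i (h g) = g i by apply/rowP => j; rewrite !mxE.
have rowS (H : 'M[R]_(l, n)) : (H *m A == 0) && torsion_on f H = [forall i, row i H \in S].
  apply/andP/forallP => [[/eqP HA /forall_inP Ht] i|HS].
    rewrite inE -row_mul HA row0 eqxx /=; apply/forall_inP => x xf.
    by rewrite -row_mul -linearZ /= (eqP (Ht x xf)) row0.
  have HS1 i : row i (H *m A) = 0 by have := HS i; rewrite inE => /andP[/eqP <- _]; rewrite row_mul.
  have HS2 i x : x \in mxker f -> row i (p%:R *: (H *m x)) = 0.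
    have := HS i; rewrite inE => /andP[_ /forall_inP h2] xf.
    by rewrite linearZ /= row_mul; apply/eqP/h2.
  split; first by apply/eqP/row_matrixP => i; rewrite HS1 row0.
  by apply/forall_inP => x xf; apply/eqP/row_matrixP => i; rewrite HS2 // row0.
rewrite -(card_imset _ hI); apply: eq_card => H; rewrite inE rowS; apply/forallP/imsetP.
  move=> HS; exists [ffun i => row i H]; last by apply/matrixP => i j; rewrite !mxE ffunE mxE.
  by rewrite inE; apply/ffun_onP => i; rewrite ffunE; apply: HS.
by case=> g; rewrite inE => /ffun_onP gS -> i; rewrite rowh; apply: gS.
Qed.

(** The l-th power of [dual_count] counts matrices H with l rows, and stacking f on H gives an F
    with F A = 0. The resulting family of F does not depend on [mu], so [kdist] controls the change
    of law. *)
Lemma surj_moment_eq mu l :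
  surj_moment mu l = \sum_(F : 'M[R]_(s + l, n) | fiber_torsion F) kpr mu k F.
Proof.
transitivity (\sum_(f | mimg f == C) \sum_(H : 'M[R]_(l, n) | torsion_on f H)
    kpr mu k (col_mx f H)).
  apply: eq_bigr => f _; rewrite -Ex_sum; apply: eq_Ex => A.
  rewrite -natrX -card_dual_count -sum1_card natr_sum mulr_sumr.
  rewrite big_mkcond [RHS]big_mkcond; apply: eq_bigr => H _; rewrite inE mul_col_mx -col_mx0.
  have -> : (col_mx (f *m A) (H *m A) == col_mx 0 0) = (f *m A == 0) && (H *m A == 0).
    by apply/eqP/andP => [/eq_col_mx[-> ->]|[/eqP -> /eqP ->]].
  by case: (f *m A == 0); case: (H *m A == 0); case: (torsion_on _ _);
    rewrite /= ?mulr1 ?mulr0 ?mul0r.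
rewrite pair_big_dep /=.
rewrite (reindex (fun F : 'M[R]_(s + l, n) => (usubmx F, dsubmx F))) /=.
  by apply: eq_bigr => F _; rewrite vsubmxK.
exists (fun fH => col_mx fH.1 fH.2) => [F _|[f H] _] /=; first exact: vsubmxK.
by rewrite col_mxKu col_mxKd.
Qed.

Lemma surj_moment_dist mu l :
  `|surj_moment mu l - surj_moment (unif K) l| <= kdist n mu (s + l) k.
Proof.
rewrite !surj_moment_eq -sumrB; apply: le_trans (ler_norm_sum _ _ _) _.
by rewrite [leRHS](bigID (@fiber_torsion l)) /= lerDl sumr_ge0.
Qed.

End Surjections.

Section SieveComparison.
Variables (p m : nat) (K : rcfType).
Hypothesis p_pr : prime p.
Local Notation q := (p ^ m.+1)%N.
Local Notation R := 'Z_q.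
Let p_gt1 := prime_gt1 p_pr.
Local Notation U := (unif K : R -> K).
Variables (s : nat) (C : {group 'cV[R]_s}) (n k : nat).
Implicit Types (mu : R -> K) (f : 'M[R]_(s, n)) (A : 'M[R]_n).
Let C0 : #|C|%:R != 0 :> K. Proof. by rewrite pnatr_eq0 -lt0n cardG_gt0. Qed.

(** Division by |C| normalizes [dual_count] to the power p^j at which the sieve polynomial is to be
    evaluated. *)
Definition sieve_count mu l : K := \sum_(f | mimg f == C) Ex mu k (fun A =>
  (f *m A == 0)%:R * (sieve_poly p K l).[(dual_count f A)%:R / #|C|%:R]).

Lemma sieve_count_moments mu l : sieve_count mu l =
  \sum_(i < size (sieve_poly p K l))
    (sieve_poly p K l)`_i / #|C|%:R ^+ i * surj_moment C n k mu i.
Proof.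
rewrite /sieve_count; under eq_bigr => f _.
  have e A : (f *m A == 0)%:R * (sieve_poly p K l).[(dual_count f A)%:R / #|C|%:R] =
      \sum_(i < size (sieve_poly p K l)) (sieve_poly p K l)`_i / #|C|%:R ^+ i *
        ((f *m A == 0)%:R * (dual_count f A)%:R ^+ i).
    rewrite horner_coef mulr_sumr; apply: eq_bigr => i _.
    by rewrite exprMn exprVn; ring.
  rewrite (eq_Ex _ _ e) Ex_sum.
  over.
rewrite exchange_big; apply: eq_bigr => i _; rewrite mulr_sumr.
by apply: eq_bigr => f _; rewrite ExZ.
Qed.

Lemma sieve_count_bound mu l : (forall c, 0 <= mu c) ->
  0 <= (-1) ^+ l * (sieve_count mu l - surj_count C n k mu) <=
  surj_moment C n k mu l / (p ^ 'C(l, 2))%:R.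
Proof.
move=> mu0.
pose e f A : K := (f *m A == 0)%:R * (sieve_poly p K l).[(dual_count f A)%:R / #|C|%:R] -
   (mxker f == mimg A)%:R.
have eP f A : mimg f = C -> 0 <= (-1) ^+ l * e f A <=
    (p ^ 'C(l, 2))%:R^-1 * ((f *m A == 0)%:R * (dual_count f A)%:R ^+ l).
  move=> fC; rewrite /e; have [fA|nfA] := eqVneq (f *m A) 0; last first.
    rewrite !mul0r mulr0 (_ : _ == _ = false) ?subrr ?mulr0 ?lexx //.
    apply: contraNF nfA => /eqP eV; apply/eqP/matrixP => i j.
    have := mem_mimg A (delta_mx j 0); rewrite -eV inE mulmxA -colE.
    by move=> /eqP/matrixP/(_ i 0); rewrite !mxE.
  have [j ej <-] := dual_countP p_pr fC fA.
  rewrite ej natrM mul1r mulrAC mulfV // mul1r.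
  have /andP[-> /le_trans] := sieve_poly_bound K p_gt1 l j; apply.
  rewrite mul1r mulrC ler_wpM2l ?invr_ge0 ?ler0n // lerXn2r ?nnegrE ?mulr_ge0 ?ler0n //.
  by rewrite ler_peMl ?ler0n // ler1n cardG_gt0.
have -> : (-1) ^+ l * (sieve_count mu l - surj_count C n k mu) =
    \sum_(f | mimg f == C) Ex mu k (fun A => (-1) ^+ l * e f A).
  rewrite /sieve_count /surj_count -sumrB mulr_sumr; apply: eq_bigr => f _.
  rewrite ExZ; congr (_ * _); rewrite /e ExD; congr (_ + _).
  by rewrite -[LHS]mulN1r -ExZ; apply: eq_Ex => A; rewrite mulN1r.
have E0 f : 0 = Ex mu k (fun A : 'M[R]_n => 0 * 0) :> K by rewrite ExZ mul0r.
apply/andP; split.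
  apply: sumr_ge0 => f /eqP fC; rewrite (E0 f); apply: ler_Ex => // A.
  by rewrite mul0r; case/andP: (eP f A fC).
rewrite /surj_moment mulr_suml; apply: ler_sum => f /eqP fC.
rewrite mulrC -ExZ; apply: ler_Ex => // A; by case/andP: (eP f A fC).
Qed.

Definition moment_error mu l : K := \sum_(i < size (sieve_poly p K l))
  `|(sieve_poly p K l)`_i| * kdist n mu (s + i) k.

Lemma sieve_count_dist mu l :
  `|sieve_count mu l - sieve_count U l| <= moment_error mu l.
Proof.
rewrite !sieve_count_moments -sumrB; apply: le_trans (ler_norm_sum _ _ _) _.
apply: ler_sum => i _; rewrite -mulrBr !normrM -mulrA ler_wpM2l //.
apply: le_trans (surj_moment_dist C n k mu i); rewrite ler_piMl //.
rewrite normfV normrX ger0_norm ?ler0n // invf_le1 ?exprn_gt0 ?ltr0n ?cardG_gt0 //.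
by rewrite exprn_ege1 // ler1n cardG_gt0.
Qed.

(** For every law the sieve overestimates at even level and underestimates at odd level. So the
    count for [mu] lies between two sieve counts for [mu], these are close to those of the uniform
    law, and only remainders under the uniform law enter the bound. *)
Lemma surj_count_dist mu t : (forall c, 0 <= mu c) ->
  `|surj_count C n k mu - surj_count C n k U| <=
    (moment_error mu t.*2 + moment_error mu t.*2.+1) +
    (surj_moment C n k U t.*2 / (p ^ 'C(t.*2, 2))%:R +
     surj_moment C n k U t.*2.+1 / (p ^ 'C(t.*2.+1, 2))%:R).
Proof.
move=> mu0; have u0 := @unif_ge0 q K.
have := sieve_count_dist mu t.*2; have := sieve_count_dist mu t.*2.+1.
have := sieve_count_bound t.*2 mu0; have := sieve_count_bound t.*2.+1 mu0.
have := sieve_count_bound t.*2 u0; have := sieve_count_bound t.*2.+1 u0.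
have -> : (-1) ^+ t.*2.+1 = -1 :> K by rewrite exprS -signr_odd odd_double mulr1.
have -> : (-1) ^+ t.*2 = 1 :> K by rewrite -signr_odd odd_double.
move: (sieve_count mu _) (sieve_count mu _) (sieve_count U _) (sieve_count U _).
move: (moment_error mu _) (moment_error mu _) (surj_count C n k mu) (surj_count C n k U).
move: (surj_moment C n k mu _ / _) (surj_moment C n k mu _ / _).
move: (surj_moment C n k U _ / _) (surj_moment C n k U _ / _) => a b c d e f g h x y z w.
clear; rewrite !mulN1r !mul1r !ler_norml.
do 6 move=> /andP[? ?]; apply/andP; split; lra.
Qed.

End SieveComparison.

Section UniformValue.
Variables (p m : nat) (K : rcfType).
Hypothesis p_pr : prime p.
Local Notation q := (p ^ m.+1)%N.
Local Notation R := 'Z_q.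
Let q_gt1 := ppow_gt1 m p_pr.
Local Notation U := (unif K : R -> K).
Variables (s : nat) (C : {group 'cV[R]_s}).

(** If F consists of f on top of H, a point (0, y) of its image is (f x, H x) with x in ker f, so
    [torsion_on] gives p y = 0. *)
Lemma surj_moment_unif_le n k l : surj_moment C n k.+1 U l <=
  (\sum_(H : {group 'cV[R]_(s + l)} | fiber H \subset ptorsion p m l) group_chains k H)%:R.
Proof.
rewrite surj_moment_eq.
apply: le_trans (sum_kpr_unif_le K q_gt1 n k (fun H : {group 'cV[R]_(s + l)} => fiber H \subset ptorsion p m l)).
rewrite big_mkcond [leRHS]big_mkcond /=; apply: ler_sum => F _.
have k0 := kpr_ge0 k.+1 F (@unif_ge0 q K).
case: ifP => [/andP[_ /forall_inP Ft]|_]; last by case: ifP.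
rewrite ifT //; apply/subsetP => y; rewrite !inE => /mimgP[x].
rewrite -{1}[F]vsubmxK mul_col_mx => /eq_col_mx[fx ->].
by apply: Ft; rewrite inE -fx.
Qed.

Hypothesis pC : forall x, x \in C -> p%:R ^+ m *: x = 0.

Lemma surj_count_unif n k (c : nat) :
    (forall f : 'M[R]_(s, n), mimg f = C -> group_cochains [set: _]%G k (mxker_group f) = c) ->
  surj_count C n k U =
  unit_prob p m K n ^+ k * c%:R * (#|[set f : 'M[R]_(s, n) | mimg f == C]|%:R / #|C|%:R ^+ n).
Proof.
move=> cP; rewrite /surj_count.
rewrite (eq_bigr (fun=> unit_prob p m K n ^+ k * c%:R / #|C|%:R ^+ n)) => [|f /eqP fC].
  rewrite sumr_const -[LHS]mulr_natl cardsE; ring.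
rewrite (@eq_Ex _ _ _ U k _ (fun A => (mimg A == mxker_group f)%:R)) => [|A]; last by rewrite eq_sym.
rewrite Ex_unif_mimg // => [|x]; last first.
  by rewrite inE -scalemxAr pC // -fC mem_mimg.
rewrite cP // -!mulrA; congr (_ * _); rewrite mulrC -exprVn; congr (_ * _ ^+ n).
rewrite -fC -(card_mxker_mimg p_pr f) natrM invfM mulrA mulfV ?mul1r //.
by rewrite pnatr_eq0 -lt0n (cardG_gt0 (mxker_group f)).
Qed.

(** A map into [C] that is not onto has its image in a proper subgroup, of order at most |C| / 2;
    each of those contributes at most (|C| / 2)^n maps. *)
Lemma card_surj_bounds n :
  (1 : K) - #|{: {group 'cV[R]_s}}|%:R / 2 ^+ n <=
    #|[set f : 'M[R]_(s, n) | mimg f == C]|%:R / #|C|%:R ^+ n <= (1 : K).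
Proof.
have C0 : 0 < #|C|%:R ^+ n :> K by rewrite exprn_gt0 // ltr0n cardG_gt0.
rewrite ler_pdivrMr // ler_pdivlMr // mul1r -[#|C|%:R ^+ n]natrX ler_nat card_mimg_eq andbT.
rewrite mulrBl mul1r lerBlDr.
pose S := [set f : 'M[R]_(s, n) | mimg f \proper C].
have eS : (#|C| ^ n = #|[set f : 'M[R]_(s, n) | mimg f == C]| + #|S|)%N.
  rewrite -(card_mimg_sub n C) -cardsUI [X in _ = (_ + X)%N](_ : _ = 0%N) ?addn0.
    by apply: eq_card => f; rewrite !inE subEproper.
  apply: eq_card0 => f; rewrite !inE properE; apply/negP => /andP[/eqP -> /andP[_]].
  by rewrite subxx.
have leS : (2 ^ n * #|S| <= #|{: {group 'cV[R]_s}}| * #|C| ^ n)%N.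
  rewrite -[#|S|]sum1_card (partition_big (fun f => mimg_group f) (fun H : {group _} => H \proper C)) //=; last first.
    by move=> f; rewrite inE.
  rewrite big_distrr /= -sum_nat_const big_mkcond /=; apply: leq_sum => H _.
  case: ifP => // HC; rewrite sum1dep_card.
  apply: leq_trans (_ : _ <= 2 ^ n * #|H| ^ n)%N _; last first.
    by rewrite -expnMn; case: (n) => // n'; rewrite leq_exp2r // half_proper.
  rewrite leq_mul2l; apply/orP; right; apply: leq_trans _ (card_mimg_eq n H).
  by apply/subset_leq_card/subsetP => f; rewrite !inE => /andP[_ /eqP <-].
rewrite {1}eS natrD lerD2l mulrAC ler_pdivlMr ?exprn_gt0 // -(natrX K 2 n) -!natrM ler_nat.
by rewrite mulnC.
Qed.

End UniformValue.

(** * Embedding B and counting automorphisms *)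

Section CochainTransfer.
Variables (gT1 gT2 : finGroupType) (T1 V1 : {group gT1}) (T2 V2 : {group gT2}).
Variables (a : {group gT1} -> {group gT2}) (b : {group gT2} -> {group gT1}).
Hypotheses (sV1 : V1 \subset T1) (sV2 : V2 \subset T2).
Hypothesis aP : forall W : {group gT1}, V1 \subset W -> W \subset T1 ->
  [/\ V2 \subset a W, a W \subset T2 & b (a W) = W].
Hypothesis bP : forall W : {group gT2}, V2 \subset W -> W \subset T2 ->
  [/\ V1 \subset b W, b W \subset T1 & a (b W) = W].
Hypothesis aS : forall W W' : {group gT1}, W \subset W' -> a W \subset a W'.
Hypothesis bS : forall W W' : {group gT2}, W \subset W' -> b W \subset b W'.

Lemma cochains_sub (gT : finGroupType) (T W : {group gT}) k :
  ~~ (W \subset T) -> group_cochains T k W = 0%N.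
Proof.
elim: k W => [|k IH] W nWT /=; first by case: eqP nWT => // ->; rewrite subxx.
rewrite big1 // => W' sW; apply: IH; apply: contra nWT; exact: subset_trans.
Qed.

Let cochains_transfer_in k (W : {group gT1}) : V1 \subset W -> W \subset T1 ->
  group_cochains T1 k W = group_cochains T2 k (a W).
Proof.
have aT : a T1 = T2.
  have [_ sbT abT] := bP sV2 (subxx T2); have [_ saT _] := aP sV1 (subxx T1).
  by apply/val_inj/eqP; rewrite /= eqEsubset saT -abT aS.
elim: k W => [|k IH] W sVW sWT /=.
  congr (nat_of_bool _); apply/eqP/eqP => [->//|eaW].
  have [_ _ <-] := aP sVW sWT; have [_ _ <-] := aP sV1 (subxx T1).
  by rewrite eaW aT.
rewrite (bigID (fun W' : {group gT1} => W' \subset T1)) /= [X in (_ + X)%N]big1 ?addn0; last first.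
  by move=> W' /andP[_]; apply: cochains_sub.
rewrite [RHS](bigID (fun W' : {group gT2} => W' \subset T2)) /= [X in (_ + X)%N]big1 ?addn0; last first.
  by move=> W' /andP[_]; apply: cochains_sub.
rewrite (reindex_onto b a) /= => [|W' /andP[sWW' sWT']]; last first.
  by have [] := aP (subset_trans sVW sWW') sWT'.
have [sVaW saWT baW] := aP sVW sWT.
apply: eq_big => [G|G /andP[/andP[sWb sbT] /eqP eG]]; last first.
  by rewrite IH ?eG //; apply: subset_trans sWb.
apply/idP/idP => [/andP[/andP[sWb sbT] /eqP eG]|/andP[saG sGT]].
  have [_ sabT _] := aP (subset_trans sVW sWb) sbT.
  by rewrite -eG sabT aS.
have [_ sbT abG] := bP (subset_trans sVaW saG) sGT.
by rewrite sbT abG eqxx -baW bS.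
Qed.

(** [a] and [b] are mutually inverse order isomorphisms between the intervals from [V1] to [T1] and
    from [V2] to [T2] in the subgroup lattices. *)
Lemma cochains_transfer k : group_cochains T1 k V1 = group_cochains T2 k V2.
Proof.
rewrite cochains_transfer_in //; congr group_cochains.
have [sVa _ _] := aP (subxx V1) sV1; have [sVb _ abV] := bP (subxx V2) sV2.
by apply/val_inj/eqP; rewrite /= eqEsubset sVa andbT; have := aS sVb; rewrite abV.
Qed.

End CochainTransfer.

Lemma card_group_chains (gT : finGroupType) (B V : {group gT}) k :
  #|[set G : {ffun 'I_k.+1 -> {group gT}} | [&& G ord0 == V, G ord_max == B &
    [forall i : 'I_k, G (widen_ord (leqnSn k) i) \subset G (lift ord0 i)]]]| =
  group_cochains B k V.
Proof.
elim: k V => [|k IH] V /=.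
  have [->|nVB] := eqVneq V B; rewrite /=.
    rewrite -[RHS](cards1 ([ffun=> B] : {ffun 'I_1 -> {group gT}})); apply: eq_card => G.
    rewrite !inE; apply/and3P/eqP => [[/eqP G0 _ _]|->].
      by apply/ffunP => i; rewrite ffunE ord1 G0.
    by rewrite !ffunE eqxx; split=> //; apply/forallP => -[].
  apply: eq_card0 => G; rewrite !inE; apply/negP => /and3P[/eqP G0 /eqP Gm _].
  by case/eqP: nVB; rewrite -G0 -Gm; congr (G _); apply: val_inj.
pose h (g : {ffun 'I_k.+1 -> {group gT}}) : {ffun 'I_k.+2 -> {group gT}} :=
  [ffun i => if unlift ord0 i is Some j then g j else V].
have h0 g : h g ord0 = V by rewrite ffunE unlift_none.
have hS g j : h g (lift ord0 j) = g j by rewrite ffunE liftK.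
have hI : injective h.
  by move=> g g' /ffunP e; apply/ffunP => j; have := e (lift ord0 j); rewrite !hS.
have lmax : ord_max = lift ord0 ord_max :> 'I_k.+2 by apply: val_inj.
have w0 : widen_ord (leqnSn k.+1) ord0 = ord0 by apply: val_inj.
have wS (i : 'I_k) : widen_ord (leqnSn k.+1) (lift ord0 i) = lift ord0 (widen_ord (leqnSn k) i).
  by apply: val_inj.
pose D := [set g : {ffun 'I_k.+1 -> {group gT}} | [&& V \subset g ord0, g ord_max == B &
    [forall i : 'I_k, g (widen_ord (leqnSn k) i) \subset g (lift ord0 i)]]].
transitivity #|D|.
  rewrite -(card_imset _ hI); apply: eq_card => G; rewrite inE; apply/and3P/imsetP.
    case=> /eqP G0 Gm /forallP Gs; exists [ffun j => G (lift ord0 j)].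
      rewrite inE !ffunE; apply/and3P; split.
      - by have := Gs ord0; rewrite w0 G0.
      - by rewrite -lmax.
      - by apply/forallP => i; rewrite !ffunE; have := Gs (lift ord0 i); rewrite wS.
    apply/ffunP => i; rewrite ffunE; case: unliftP => [j ->|->]; last by [].
    by rewrite ffunE.
  case=> g; rewrite inE => /and3P[sV gm /forallP gs] ->; rewrite h0 lmax hS; split=> //.
  apply/forallP => i; case: (unliftP ord0 i) => [j ->|->].
    by rewrite wS !hS; apply: gs.
  by rewrite w0 h0 hS.
rewrite -sum1_card (partition_big (fun g : {ffun 'I_k.+1 -> {group gT}} => g ord0)
  (fun W : {group gT} => V \subset W)) /=; last first.
  by move=> g; rewrite inE => /and3P[].
apply: eq_bigr => W sVW; rewrite -IH -sum1_card; apply: eq_bigl => g; rewrite !inE.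
by case: (g ord0 =P W) => [->|_]; rewrite ?andbF // sVW andbT.
Qed.

Section Embedding.
Variables p m : nat.
Hypothesis p_pr : prime p.
Local Notation q := (p ^ m.+1)%N.
Local Notation R := 'Z_q.
Let q_gt1 := ppow_gt1 m p_pr.

Lemma mulmx_morphM r n (f : 'M[R]_(r, n)) :
  {in [set: 'cV[R]_n] &, {morph (fun x : 'cV[R]_n => f *m x) : x y / (x * y)%g}}.
Proof. by move=> x y _ _; rewrite !zmodMgE mulmxDr. Qed.
Canonical mulmx_morphism r n (f : 'M[R]_(r, n)) := Morphism (mulmx_morphM f).

Lemma ker_mulmx r n (f : 'M[R]_(r, n)) : ('ker (mulmx_morphism f))%g = mxker f.
Proof. by apply/setP => x; rewrite !inE. Qed.

Lemma im_mulmx r n (f : 'M[R]_(r, n)) : (mulmx_morphism f @* setT)%g = mimg f.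
Proof.
rewrite /morphim setTI; apply/setP => y; apply/imsetP/mimgP => [[x _ ->]|[x ->]].
  by exists x.
by exists x; rewrite ?inE.
Qed.

(** By cardinality W equals its double annihilator, so the matrix whose nonzero rows are the nonzero
    elements of [perp W] has kernel W. *)
Lemma group_mxker n (W : {group 'cV[R]_n}) : exists l (f : 'M[R]_(l, n)), mxker f = W.
Proof.
pose T := {: 'rV[R]_n}; exists #|T|.
exists (\matrix_(i, j) if enum_val i \in perp W then (enum_val i : 'rV[R]_n) 0 j else 0).
set f := \matrix_(i, j) _.
have eker : mxker f = annih (perp W).
  have frow i : row i f = if enum_val i \in perp W then enum_val i else 0.
    by apply/rowP => j; rewrite !mxE; case: ifP; rewrite ?mxE.
  apply/setP => x; rewrite inE; apply/eqP/annihP => [fx v vW|h].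
    have := congr1 (row (enum_rank v)) fx; rewrite row_mul frow enum_rankK vW => ->.
    by rewrite row0.
  apply/row_matrixP => i; rewrite row_mul frow row0.
  by case: ifP => [/h|_]; rewrite ?mul0mx.
have sub : W \subset mxker f.
  by rewrite eker; apply/subsetP => x Wx; apply/annihP => v /perpP; apply.
apply/eqP; rewrite eq_sym eqEcard sub /= eker.
have perp0 : (0 < #|perp W|)%N := cardG_gt0 (perp_group W).
by rewrite -(leq_pmul2l perp0) [leqRHS]mulnC card_perp_mul // card_annih_le.
Qed.

(** The elements of B define a surjection from R^s onto B; its kernel is also the kernel of some
    matrix f, so B is isomorphic to the image of f. *)
Lemma abelian_embedding (gT : finGroupType) (B : {group gT}) :
  abelian B -> #|B| = (p ^ m)%N ->
  exists s (C : {group 'cV[R]_s}), C \isog B.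
Proof.
move=> abB oB; pose s := #|B|.
have bq (x : gT) : x \in B -> (x ^+ q = 1)%g.
  by move=> Bx; rewrite expnSr expgM -oB expg_cardG // expg1n.
pose b (i : 'I_s) : gT := enum_val i.
have Bb i : b i \in B := enum_valP i.
pose phi (x : 'cV[R]_s) : gT := (\prod_i b i ^+ (x i 0 : nat))%g.
have phiM : {in [set: 'cV[R]_s] &, {morph phi : x y / (x * y)%g}}.
  move=> x y _ _; rewrite /phi.
  elim: (index_enum _) => [|i r IH]; first by rewrite !big_nil mulg1.
  rewrite !big_cons {}IH zmodMgE mxE /=.
  have -> : (b i ^+ ((x i 0 + y i 0) %% (Zp_trunc q).+2) = b i ^+ x i 0 * b i ^+ y i 0)%g.
    have bq1 : (b i ^+ (Zp_trunc q).+2 = 1)%g by rewrite Zp_cast ?bq.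
    by rewrite expg_mod // expgD.
  set X := (\prod_(j <- r) b j ^+ x j 0)%g.
  have BX : X \in B by apply: group_prod => j _; rewrite groupX.
  rewrite -!mulgA; congr (_ * _)%g; rewrite !mulgA; congr (_ * _)%g.
  by apply: (centsP abB); rewrite // groupX.
pose phim := Morphism phiM.
have imphi : (phim @* setT = B)%g.
  rewrite /morphim setTI; apply/setP => y; apply/imsetP/idP => [[x _ ->]|By].
    by apply: group_prod => j _; rewrite groupX.
  exists (delta_mx (enum_rank_in By y) 0); rewrite ?inE //=.
  set i0 := enum_rank_in By y; have bi0 : b i0 = y by rewrite /b enum_rankK_in.
  have -> : y = (\prod_(i | i == i0) b i)%g by rewrite big_pred1_eq.
  rewrite /phi big_mkcond; apply: eq_bigr => i _.
  by rewrite mxE eqxx andbT; case: eqP.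
have [l [f ef]] := group_mxker ('ker phim)%G.
exists l, (mimg_group f).
have := first_isog (mulmx_morphism f); rewrite ker_mulmx ef im_mulmx /= => h1.
have := first_isog phim; rewrite imphi /= => h2.
exact: isog_trans (isog_symr h1) h2.
Qed.

(** Two surjections onto C with the same kernel differ by a unique automorphism of C; [h al] is the
    matrix of the composite of f0 with [al]. *)
Lemma card_surj_same_kernel (s n : nat) (C : {group 'cV[R]_s}) (f0 : 'M[R]_(s, n)) :
  mimg f0 = C ->
  #|[set f : 'M[R]_(s, n) | (mimg f == C) && (mxker f == mxker f0)]| = #|Aut C|.
Proof.
move=> f0C; pose h (al : {perm 'cV[R]_s}) : 'M[R]_(s, n) := \matrix_(i, j) al (col j f0) i 0.
have Cf0 x : f0 *m x \in C by rewrite -f0C mem_mimg.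
have CP y : y \in C -> exists x : 'cV[R]_n, y = f0 *m x.
  by rewrite -f0C => /mimgP.
have colh al j : col j (h al) = al (col j f0) by apply/colP => i; rewrite !mxE.
have hE al x : al \in Aut C -> h al *m x = al (f0 *m x).
  move=> Aal; have alD : {in C &, {morph al : y z / y + z}}.
    exact/morphicP/(Aut_morphic Aal).
  have al0 : al 0 = 0.
    by apply: (addrI (al 0)); rewrite -alD ?addr0 // -zmod1gE group1.
  have aln y k : y \in C -> al (y *+ k) = al y *+ k.
    move=> Cy; elim: k => [|k IH]; first by rewrite !mulr0n.
    by rewrite !mulrS alD ?IH // -zmodXgE groupX.
  rewrite !mulmx_sum_col.
  have Cc j : col j f0 \in C by rewrite colE Cf0.
  have : al (\sum_j x j 0 *: col j f0) = \sum_j x j 0 *: col j (h al) /\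
      \sum_j x j 0 *: col j f0 \in C; last by case.
  elim/big_rec2: _ => [|j y z _ [IH Cz]]; first by rewrite al0 -zmod1gE group1.
  rewrite colh -[x j 0]natr_Zp !scaler_nat -aln // -IH -alD //; last first.
    by rewrite -zmodXgE groupX.
  by split=> //; rewrite -zmodMgE groupM // -zmodXgE groupX.
rewrite -(card_in_imset (f := h)); last first.
  move=> al be Aal Abe e; apply: (eq_Aut Aal Abe) => _ /CP[x ->].
  by rewrite -!hE // e.
apply: eq_card => f; rewrite inE; apply/andP/imsetP => [[/eqP fC /eqP ker]|[al Aal ->]].
  pose g (y : 'cV[R]_s) := f *m odflt 0 [pick x : 'cV[R]_n | f0 *m x == y].
  have gE (x : 'cV[R]_n) : g (f0 *m x) = f *m x.
    rewrite /g; case: pickP => [x' /eqP ex|/(_ x)]; last by rewrite eqxx.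
    have : x' - x \in mxker f by rewrite ker inE mulmxBr ex subrr.
    by rewrite inE mulmxBr subr_eq0 => /eqP.
  have gM : {in C &, {morph g : y z / (y * z)%g}}.
    move=> _ _ /CP[x ->] /CP[y ->].
    by rewrite !zmodMgE -mulmxDr !gE mulmxDr.
  pose gm := Morphism gM.
  have injg : ('injm gm)%g.
    apply/injmP => _ _ /CP[x ->] /CP[y ->].
    rewrite /= !gE => /eqP; rewrite -subr_eq0 -mulmxBr => fxy.
    have : x - y \in mxker f0 by rewrite -ker inE.
    by rewrite inE mulmxBr subr_eq0 => /eqP.
  have gC : (gm @* C = C)%g.
    apply/eqP; rewrite eqEcard card_injm // leqnn andbT.
    apply/subsetP => _ /morphimP[_ _ /CP[x ->] ->].
    by rewrite /= gE -fC mem_mimg.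
  exists (aut injg gC); first exact: Aut_aut.
  apply/matrixP => i j; rewrite mxE colE autE ?Cf0 //= gE -colE mxE.
  by [].
have ker : mxker (h al) = mxker f0.
  apply/setP => x; rewrite !inE hE //; apply/eqP/eqP => [e|->].
    apply: (@perm_inj _ al); rewrite e; have := hE al 0 Aal.
    by rewrite !mulmx0.
  by have := hE al 0 Aal; rewrite !mulmx0.
split; last by rewrite ker.
rewrite eqEcard; apply/andP; split.
  by apply/subsetP => _ /mimgP[x ->]; rewrite hE // (Aut_closed Aal).
have k0 : (0 < #|mxker f0|)%N := cardG_gt0 (mxker_group f0).
by rewrite -(leq_pmul2l k0) -{2}ker -f0C !card_mxker_mimg.
Qed.

Lemma cochains_surj (gT : finGroupType) (B : {group gT}) (s n k : nat)
    (C : {group 'cV[R]_s}) (f : 'M[R]_(s, n)) : C \isog B -> mimg f = C ->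
  group_cochains [set: _]%G k (mxker_group f) = group_cochains B k 1%G.
Proof.
case/isogP => kap injk imk fC.
have fT : (mulmx_morphism f @* setT)%g = C by rewrite im_mulmx.
pose a (W : {group 'cV[R]_n}) := (kap @* (mulmx_morphism f @* W))%G.
pose b (G : {group gT}) := (mulmx_morphism f @*^-1 (kap @*^-1 G))%G.
apply: (@cochains_transfer _ _ _ _ _ _ a b); rewrite ?sub1G ?subsetT //.
- move=> W sVW _; split; first exact: sub1G.
    by rewrite /= -imk morphimS // -fT morphimS // subsetT.
  apply/val_inj; rewrite /= injmK ?morphimGK ?ker_mulmx ?subsetT //.
  by rewrite -fT morphimS // subsetT.
- move=> G _ sGB; split; last 1 first.
  + apply/val_inj; rewrite /= morphpreK ?morphpreK ?imk //.
    by rewrite fT subsetIl.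
  + by rewrite /= -ker_mulmx; apply: ker_sub_pre.
  by rewrite subsetT.
- by move=> W W' sW; rewrite /= !morphimS.
- by move=> G G' sG; rewrite /= !morphpreS.
Qed.

End Embedding.

From mathcomp Require Import all_classical all_reals all_analysis.
Import numFieldNormedType.Exports.
Local Open Scope classical_set_scope.
Local Open Scope ring_scope.

(** * Limits *)

Section Limits.
Variable K : realType.

Lemma bernoulli (h : K) n : 0 <= h -> 1 + n%:R * h <= (1 + h) ^+ n.
Proof.
move=> h0; elim: n => [|n IH]; first by rewrite mul0r addr0 expr0.
rewrite exprS; apply: le_trans (ler_wpM2l _ IH); last by rewrite addr_ge0.
rewrite -natr1; have : 0 <= n%:R * h * h by rewrite !mulr_ge0.
by rewrite mulrDr mulr1 !mulrDl !mul1r; lra.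
Qed.

Lemma expr1D_sub1_le (y : K) n : 0 <= y -> n%:R * y <= 2^-1 ->
  (1 + y) ^+ n - 1 <= 2 * (n%:R * y).
Proof.
move=> y0; elim: n => [|n IH] ny; first by rewrite expr0 subrr !mul0r mulr0.
have y1 : (n.+1)%:R * y = n%:R * y + y by rewrite -natr1 mulrDl mul1r.
have ny0 : 0 <= n%:R * y by rewrite mulr_ge0.
rewrite y1 in ny *; have {}IH := IH ltac:(lra).
rewrite exprS; set a := (1 + y) ^+ n in IH *; set b := n%:R * y in IH ny0 ny *.
nra.
Qed.

Lemma cvg_natmul_expr (rho : K) : 0 <= rho < 1 ->
  (fun t => (t.+1)%:R * rho ^+ t) @ \oo --> (0 : K).
Proof.
(* As rho <= sig^2, one factor sig^t absorbs the linear growth by Bernoulli's inequality and the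
   other one tends to 0. *)
move=> /andP[rho0 rho1]; pose sig := (1 + rho) / 2.
have sig0 : 0 < sig by rewrite /sig; lra.
have sig1 : sig < 1 by rewrite /sig; lra.
have sigsq : rho <= sig ^+ 2 by rewrite /sig expr2; nra.
pose h := sig^-1 - 1; have h0 : 0 < h by rewrite /h subr_gt0 invf_gt1.
have tP t : t%:R * sig ^+ t <= h^-1.
  have eh : 1 + h = sig^-1 by rewrite /h addrC subrK.
  have := bernoulli t (ltW h0); rewrite eh => e.
  rewrite -[leRHS]mul1r ler_pdivlMr // mulrAC -ler_pdivlMr ?exprn_gt0 // mul1r -exprVn.
  by move: e; lra.
apply: (@squeeze_cvgr _ _ _ _ (fun=> 0) (fun t => (h^-1 + 1) * sig ^+ t)).
- near=> t; apply/andP; split; first by rewrite mulr_ge0 ?exprn_ge0.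
  apply: (@le_trans _ _ ((t.+1)%:R * (sig ^+ t * sig ^+ t))).
    by rewrite ler_wpM2l // -exprMn -expr2 lerXn2r ?nnegrE ?exprn_ge0 ?(ltW sig0).
  rewrite mulrA ler_wpM2r ?exprn_ge0 ?(ltW sig0) // -natr1 mulrDl mul1r lerD //.
  by rewrite exprn_ile1 ?ltW.
- exact: cvg_cst.
- rewrite -(mulr0 (h^-1 + 1)); apply: cvgM; first exact: cvg_cst.
  by apply: cvg_expr; rewrite ger0_norm ?ltW.
Unshelve. all: by end_near. Qed.

Lemma cvg_divn M : (0 < M)%N -> (fun n => (n %/ M)%N) @ \oo --> \oo.
Proof.
move=> M0; apply/cvgnyPge => A; near=> n.
rewrite leq_divRL //; near: n; exact: nbhs_infty_ge.
Unshelve. all: by end_near. Qed.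

Section KeySum.
Variables (q r : nat) (rho : K).
Hypotheses (q_gt1 : (1 < q)%N) (rho01 : 0 <= rho < 1).
Local Notation R := 'Z_q.
Let Q : K := (q ^ r)%:R.
Let Q0 : 0 < Q. Proof. by rewrite ltr0n expn_gt0 ltnW. Qed.
Let Q1 : 1 <= Q. Proof. by rewrite ler1n expn_gt0 ltnW. Qed.

Lemma cvg_key_sum :
  (fun n => @key_sum q K n rho r) @ \oo --> (0 : K).
Proof.
have /andP[rho0 rho1] := rho01.
(* With Q x = (1 - rho) / 4 the limiting base c0 of the second term of [key_inequality] is still
   below 1, and [c] leaves room for the error Q rho^t. *)
pose x : K := (1 - rho) / (4 * Q).
have x0 : 0 < x by apply: divr_gt0; [rewrite subr_gt0|rewrite mulr_gt0].
have Qx : Q * x = (1 - rho) / 4 by rewrite /x invfM !mulrA mulrC !mulrA mulVf ?mul1r ?gt_eqF.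
have x1 : x <= 1.
  have : x <= Q * x by apply: ler_peMl => //; exact: ltW.
  by rewrite Qx; lra.
pose c0 := (1 + rho) / 2 * (1 + Q * x); pose c := (1 + c0) / 2.
have c01 : c0 < 1 by rewrite /c0 Qx; nra.
have c00 : 0 < c0 by rewrite /c0 Qx; nra.
have cc0 : c0 < c by rewrite /c; lra.
have c1 : c < 1 by rewrite /c; lra.
have cpos : 0 < c by rewrite /c; lra.
(* [key_inequality] is applied with t = n %/ M: the penalty x^-(q^r t) is then beaten by c^n up to
   2^-t, while t grows linearly in n, so that n rho^t still tends to 0. *)
have [M M0 cM] : exists2 M, (0 < M)%N & x ^- (q ^ r) * c ^+ M <= 2^-1.
  have : (fun n => c ^+ n) @ \oo --> (0 : K) by apply: cvg_expr; rewrite ger0_norm ?ltW.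
  have e0 : 0 < 2^-1 * x ^+ (q ^ r) by rewrite mulr_gt0 ?exprn_gt0 ?invr_gt0.
  move=> /cvgr0_norm_lt/(_ _ e0)[N _ NP]; exists N.+1 => //.
  rewrite mulrC ler_pdivrMr ?exprn_gt0 //; apply: ltW.
  by have := NP N.+1 (leqnSn N); rewrite /= ger0_norm // exprn_ge0 // ltW.
have rcvg : (fun t => rho ^+ t) @ \oo --> (0 : K) by apply: cvg_expr; rewrite ger0_norm.
have near1 : \forall t \near \oo, ((1 + rho) / 2 + Q * rho ^+ t) * (1 + Q * x) <= c.
  have e0 : 0 < (c - c0) / (Q * (1 + Q * x)).
    by rewrite divr_gt0 ?subr_gt0 // mulr_gt0 // Qx; lra.
  move/cvgr0_norm_lt/(_ _ e0): rcvg; apply: filterS => t.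
  rewrite ger0_norm ?exprn_ge0 // ltr_pdivlMr; last by rewrite mulr_gt0 // Qx; lra.
  by rewrite /c0; lra.
pose S : K := #|{: {group 'rV[R]_r}}|%:R + #|{: {group 'cV[R]_r}}|%:R.
have S0 : 0 <= S by rewrite addr_ge0.
pose a t : K := M%:R * Q * (t.+1%:R * rho ^+ t).
have acvg : a t @[t --> \oo] --> (0 : K).
  by rewrite -(mulr0 (M%:R * Q)); apply: cvgM; [exact: cvg_cst|exact: cvg_natmul_expr].
pose b t : K := S * (2 * a t + 2^-1 ^+ t).
have bcvg : b t @[t --> \oo] --> (0 : K).
  rewrite -(mulr0 S); apply: cvgM; first exact: cvg_cst.
  rewrite -[X in _ --> X]addr0 -{1}(mulr0 2); apply: cvgD.
    by apply: cvgM => //; exact: cvg_cst.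
  by apply: cvg_expr; rewrite ger0_norm ?invr_ge0 ?invf_lt1 //; lra.
have near2 : \forall t \near \oo, a t <= 2^-1.
  by move/cvgr0_norm_le/(_ 2^-1): acvg; rewrite invr_gt0 => /(_ ltac:(done)); apply: filterS => t /ler_normlW.
have nearn : \forall n \near \oo, @key_sum q K n rho r <= b (n %/ M)%N.
  have near12 : \forall t \near \oo, a t <= 2^-1 /\
      ((1 + rho) / 2 + Q * rho ^+ t) * (1 + Q * x) <= c by apply: filterI near2 near1.
  have near3 : \forall n \near \oo, a (n %/ M)%N <= 2^-1 /\
      ((1 + rho) / 2 + Q * rho ^+ (n %/ M)%N) * (1 + Q * x) <= c.
    exact: cvg_divn M0 _ near12.
  near=> n.
  have [] : a (n %/ M)%N <= 2^-1 /\
      ((1 + rho) / 2 + Q * rho ^+ (n %/ M)%N) * (1 + Q * x) <= c by near: n.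
  set t := (n %/ M)%N => at2 gt.
  have nMt : (n <= M * t.+1)%N by rewrite mulnC ltnW // ltn_ceil.
  have Mtn : (M * t <= n)%N by rewrite mulnC leq_trunc_div.
  have rt0 : 0 <= Q * rho ^+ t by rewrite mulr_ge0 ?exprn_ge0 // ltW.
  have nQ : n%:R * (Q * rho ^+ t) <= a t.
    have -> : a t = (M * t.+1)%:R * (Q * rho ^+ t) by rewrite /a natrM; ring.
    by rewrite ler_wpM2r // ler_nat.
  have x01 : 0 < x <= 1 by rewrite x0.
  apply: le_trans (@key_inequality q K r n t rho x q_gt1 rho01 x01) _.
  have a0 : 0 <= a t by apply: le_trans nQ; rewrite mulr_ge0.
  have h1 : (1 + Q * rho ^+ t) ^+ n - 1 <= 2 * a t.
    apply: le_trans (expr1D_sub1_le rt0 (le_trans nQ at2)) _.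
    by rewrite ler_wpM2l.
  have h2 : x ^- (q ^ r * t) * (((1 + rho) / 2 + Q * rho ^+ t) * (1 + Q * x)) ^+ n <= 2^-1 ^+ t.
    apply: (@le_trans _ _ (x ^- (q ^ r * t) * c ^+ (M * t))).
      rewrite ler_wpM2l ?invr_ge0 ?exprn_ge0 ?(ltW x0) //.
      apply: (@le_trans _ _ (c ^+ n)).
        rewrite lerXn2r ?nnegrE ?(ltW cpos) // mulr_ge0 ?addr_ge0 ?divr_ge0 ?addr_ge0 //.
        by rewrite mulr_ge0 ?(ltW Q0) ?(ltW x0).
      by rewrite ler_wiXn2l // ltW.
    rewrite !exprM -exprVn -exprMn lerXn2r ?nnegrE ?invr_ge0 //.
    by rewrite mulr_ge0 ?invr_ge0 ?exprn_ge0 ?(ltW x0) ?(ltW cpos).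
  have h3 := sum_rker_le K q_gt1 n r.
  have h0 : 0 <= (1 + Q * rho ^+ t) ^+ n - 1 by rewrite subr_ge0 exprn_ege1 // lerDl.
  rewrite /b /S [leRHS]mulrDl [leLHS]addrC; apply: lerD.
    rewrite ler_wpM2l //; apply: le_trans h2 _; rewrite lerDr mulr_ge0 //.
  apply: le_trans (ler_pM _ h0 h3 h1) _.
    by apply: sumr_ge0 => F _; rewrite exprn_ge0 // divr_ge0.
  by rewrite ler_wpM2l // lerDl exprn_ge0 // invr_ge0.
have ks0 n : 0 <= @key_sum q K n rho r.
  apply: sumr_ge0 => F _; rewrite divr_ge0 ?exprn_ge0 // subr_ge0.
  have s0 : 0 <= \sum_(v | v \notin rker F) rho ^+ hw (v *m F).
    by apply: sumr_ge0 => v _; rewrite exprn_ge0.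
  by rewrite sum_rho_split lerXn2r ?nnegrE ?addr_ge0 // lerDl.
apply: (@squeeze_cvgr _ _ _ _ (fun=> 0) (fun n => b (n %/ M)%N)).
- by move: nearn; apply: filterS => n ->; rewrite andbT.
- exact: cvg_cst.
- exact: cvg_comp (cvg_divn M0) bcvg.
Unshelve. all: by end_near. Qed.

End KeySum.
End Limits.

Lemma cvg_sum0 (K : realType) (I : Type) (r : seq I) (F : I -> nat -> K) :
    (forall i, F i @ \oo --> (0 : K)) ->
  (fun n => \sum_(i <- r) F i n) @ \oo --> (0 : K).
Proof.
move=> F0; elim: r => [|i r IH].
  rewrite (_ : (fun n => _) = fun=> 0); first exact: cvg_cst.
  by apply/funext => n; rewrite big_nil.
rewrite (_ : (fun n => _) = fun n => F i n + \sum_(j <- r) F j n); last first.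
  by apply/funext => n; rewrite big_cons.
by rewrite -[X in _ --> X]addr0; apply: cvgD.
Qed.

Lemma cvg_pow (K : realType) (u : nat -> K) (l : K) k :
  u @ \oo --> l -> (fun n => u n ^+ k) @ \oo --> l ^+ k.
Proof.
move=> ul; elim: k => [|k IH].
  by rewrite (_ : (fun n => _) = fun=> 1) ?expr0; [exact: cvg_cst|apply/funext => n].
rewrite exprS (_ : (fun n => _) = fun n => u n * u n ^+ k); first exact: cvgM.
by apply/funext => n; rewrite exprS.
Qed.

(** * Passage from the uniform law to the law [mu], and the limit modulo p^(m+1) *)

Section Universality.
Variables (K : realType) (p m : nat).
Hypothesis p_pr : prime p.
Local Notation q := (p ^ m.+1)%N.
Local Notation R := 'Z_q.
Let q_gt1 := ppow_gt1 m p_pr.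
Let p_gt1 := prime_gt1 p_pr.
Local Notation U := (unif K : R -> K).

Section Comparison.
Variables (mu : R -> K) (c1 c2 : R).
Hypotheses (mu_ge0 : forall c, 0 <= mu c) (mu_sum : \sum_c mu c = 1).
Hypotheses (mu1 : 0 < mu c1) (mu2 : 0 < mu c2) (c12 : (c1 - c2) \is a GRing.unit).

Lemma cvg_kdist r k : (fun n => kdist n mu r k) @ \oo --> (0 : K).
Proof.
have [rho rho01 rhoP] := phi_gap q_gt1 mu_ge0 mu_sum mu1 mu2 c12.
elim: k => [|k IH].
  rewrite (_ : (fun n => _) = fun=> 0); first exact: cvg_cst.
  apply/funext => n; rewrite /kdist big1 // => F _.
  by rewrite /kpr /= subrr normr0.
have kS n := kdistS n r mu_ge0 mu_sum rhoP k.
apply: (@squeeze_cvgr _ _ _ _ (fun=> 0) _ _ _ _ _).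
- by near=> n; rewrite kdist_ge0 /=; exact: kS.
- exact: cvg_cst.
rewrite -[X in _ --> X](_ : 0 * ((group_chains k [set: 'cV[R]_r]%G)%:R + 0) +
  #|{: {group 'cV[R]_r}}|%:R * 0 = 0 :> K); last by rewrite mul0r mulr0 addr0.
apply: cvgD; last by apply: cvgM => //; exact: cvg_cst.
apply: cvgM; first exact: cvg_key_sum.
by apply: cvgD => //; exact: cvg_cst.
Unshelve. all: by end_near. Qed.

Variables (s : nat) (C : {group 'cV[R]_s}).

Lemma cvg_moment_error k l :
  (fun n => @moment_error p m K s n k mu l) @ \oo --> (0 : K).
Proof.
apply: (@cvg_sum0 K 'I_(size (sieve_poly p K l)) _
  (fun i n => `|(sieve_poly p K l)`_i| * kdist n mu (s + i) k)) => i /=.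
rewrite -[X in _ --> X](mulr0 `|(sieve_poly p K l)`_i|).
by apply: (cvgM (cvg_cst _)); exact: cvg_kdist.
Qed.

(** The remainders at levels 2t and 2t+1 are small uniformly in n, so t is fixed first; then
    finitely many moments are compared as n tends to infinity. *)
Lemma cvg_surj_count_dist k :
  (fun n => surj_count C n k.+1 mu - surj_count C n k.+1 U) @ \oo --> (0 : K).
Proof.
have [l0 l0P] := sum_torsion_chains_le m p_pr k s.
have remP n l : (l0 <= l)%N ->
    surj_moment C n k.+1 U l / (p ^ 'C(l, 2))%:R <= (p ^ l)%:R^-1 :> K.
  move=> /l0P lP; rewrite ler_pdivrMr ?ltr0n ?expn_gt0 ?prime_gt0 //.
  apply: le_trans (surj_moment_unif_le K p_pr C n k l) _.
  by rewrite ler_pdivlMl ?ltr0n ?expn_gt0 ?prime_gt0 // -natrM ler_nat.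
apply/cvgr0Pnorm_le => e e0.
have [t lt te] : exists2 t, (l0 <= t)%N & 2 * (p ^ t)%:R^-1 <= e / 2.
  have pcvg : (fun t => p%:R^-1 ^+ t) @ \oo --> (0 : K).
    apply: cvg_expr; rewrite ger0_norm ?invr_ge0 // invf_lt1 ?ltr1n // ltr0n.
    exact: prime_gt0.
  have e4 : 0 < e / 4 by rewrite divr_gt0.
  move/cvgr0_norm_lt/(_ _ e4): pcvg => [N _ NP]; exists (maxn l0 N); first exact: leq_maxl.
  have := ltW (NP (maxn l0 N) (leq_maxr _ _)); rewrite /= ger0_norm ?exprn_ge0 ?invr_ge0 //.
  by rewrite natrX exprVn; lra.
have errP : \forall n \near \oo,
    @moment_error p m K s n k.+1 mu t.*2 + @moment_error p m K s n k.+1 mu t.*2.+1 <= e / 2.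
  have e2 : 0 < e / 2 by rewrite divr_gt0.
  have ecvg : (fun n => @moment_error p m K s n k.+1 mu t.*2 +
      @moment_error p m K s n k.+1 mu t.*2.+1) @ \oo --> (0 : K).
    by rewrite -[X in _ --> X]addr0; apply: cvgD; exact: cvg_moment_error.
  by move/cvgr0_norm_lt/(_ _ e2): ecvg; apply: filterS => n /ltW/ler_normlW.
move: errP; apply: filterS => n errn.
apply: le_trans (surj_count_dist p_pr C n k.+1 t mu_ge0) _.
rewrite [e in leRHS](_ : e = e / 2 + e / 2); last by lra.
apply: lerD => //; apply: le_trans te.
have pl l : (t <= l)%N -> surj_moment C n k.+1 U l / (p ^ 'C(l, 2))%:R <= (p ^ t)%:R^-1 :> K.
  move=> tl; apply: le_trans (remP n l (leq_trans lt tl)) _.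
  by rewrite lef_pV2 ?posrE ?ltr0n ?expn_gt0 ?prime_gt0 // ler_nat leq_exp2l.
by rewrite mulr_natl mulr2n; apply: lerD; apply: pl; lia.
Qed.

End Comparison.

Lemma cvg_unit_prob :
  (fun n => unit_prob p m K n) @ \oo --> (qpoch_inf p%:R^-1 p%:R^-1 : K).
Proof.
have -> : (fun n => unit_prob p m K n) =
    (fun n => \prod_(0 <= i < n) (1 - p%:R^-1 * p%:R^-1 ^+ i)).
  by apply/funext => n; rewrite unit_prob_eq.
have f01 i : 0 <= (1 - p%:R^-1 * p%:R^-1 ^+ i : K) <= 1.
  have h : p%:R^-1 * p%:R^-1 ^+ i <= 1 :> K.
    by rewrite -exprS exprn_ile1 // ?invr_ge0 // invf_le1 ?ler1n ?ltr0n prime_gt0.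
  by rewrite subr_ge0 h gerBl mulr_ge0 ?exprn_ge0 ?invr_ge0.
(* [qpoch_inf] is by definition the [limn] of these partial products, so only their convergence is
   left to prove. *)
apply: nonincreasing_is_cvgn.
  apply/nonincreasing_seqP => n; rewrite big_nat_recr //= ler_piMr //.
    by apply: prodr_ge0 => i _; case/andP: (f01 i).
by exists 0 => _ [n _ <-]; apply: prodr_ge0 => i _; case/andP: (f01 i).
Qed.

Section Good.
Variables (s : nat) (C : {group 'cV[R]_s}).

Definition cok_event n (A : 'M[R]_n) : bool :=
  [exists f : 'M[R]_(s, n), (mimg f == C) && (mxker f == mimg A)].

Lemma surj_count_cok (mu : R -> K) n k :
  surj_count C n k mu = #|Aut C|%:R * Ex mu k (fun A : 'M[R]_n => (cok_event A)%:R).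
Proof.
rewrite /surj_count -Ex_sum -ExZ; apply: eq_Ex => A.
rewrite /cok_event; case: existsP => [[f0 /andP[/eqP f0C /eqP f0A]]|nf].
  rewrite mulr1 -(card_surj_same_kernel p_pr f0C) -sum1_card natr_sum.
  rewrite big_mkcond [RHS]big_mkcond; apply: eq_bigr => f _.
  by rewrite inE f0A; case: (_ == _); case: (_ == _).
rewrite mulr0 big1 // => f /eqP fC; case: eqP => // fA.
by case: nf; exists f; rewrite fC fA !eqxx.
Qed.

Lemma cvg_cok_event (gT : finGroupType) (B : {group gT}) (mu : R -> K) (c1 c2 : R) k :
    (forall x : 'cV[R]_s, x \in C -> p%:R ^+ m *: x = 0) -> C \isog B ->
    (forall c, 0 <= mu c) -> \sum_c mu c = 1 ->
    0 < mu c1 -> 0 < mu c2 -> (c1 - c2) \is a GRing.unit ->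
  (fun n => Ex mu k.+1 (fun A : 'M[R]_n => (cok_event A)%:R)) @ \oo -->
  (qpoch_inf p%:R^-1 p%:R^-1 ^+ k.+1 *
    ((group_cochains B k.+1 1%G)%:R / #|Aut B|%:R) : K).
Proof.
move=> pC isoCB mu0 musum mu1 mu2 c12.
have Aut0 : #|Aut C|%:R != 0 :> K by rewrite pnatr_eq0 -lt0n cardG_gt0.
have AutCB : #|Aut B| = #|Aut C|.
  have /isogP[f injf <-] := isoCB.
  exact: card_isog (injm_Aut injf (subxx C)).
have ratio : (fun n => #|[set f : 'M[R]_(s, n) | mimg f == C]%SET|%:R / #|C|%:R ^+ n) @ \oo
    --> (1 : K).
  apply: (@squeeze_cvgr _ _ _ _ (fun n => 1 - #|{: {group 'cV[R]_s}}|%:R / 2 ^+ n) (fun=> 1)).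
  - by near=> n; exact: card_surj_bounds.
  - rewrite -[X in _ --> X]subr0; apply: cvgB; first exact: cvg_cst.
    rewrite -(mulr0 #|{: {group 'cV[R]_s}}|%:R); apply: cvgM; first exact: cvg_cst.
    rewrite (_ : (fun n => _) = fun n => 2^-1 ^+ n); last by apply/funext => n; rewrite exprVn.
    by apply: cvg_expr; rewrite ger0_norm ?invr_ge0 // invf_lt1 // ltr1n.
  - exact: cvg_cst.
have unifcvg : (fun n => surj_count C n k.+1 U) @ \oo -->
    (qpoch_inf p%:R^-1 p%:R^-1 ^+ k.+1 * (group_cochains B k.+1 1%G)%:R * 1 : K).
  have e n := @surj_count_unif p m K p_pr s C pC n k.+1 _
     (fun f => @cochains_surj p m gT B s n k.+1 C f isoCB).
  rewrite (_ : (fun n => _) = fun n => unit_prob p m K n ^+ k.+1 *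
      (group_cochains B k.+1 1%G)%:R *
      (#|[set f : 'M[R]_(s, n) | mimg f == C]%SET|%:R / #|C|%:R ^+ n)); last first.
    by apply/funext => n; exact: e.
  apply: cvgM => //; apply: cvgM; last exact: cvg_cst.
  exact: cvg_pow cvg_unit_prob.
rewrite AutCB mulrA; rewrite mulr1 in unifcvg.
rewrite (_ : (fun n => _) = fun n => surj_count C n k.+1 mu / #|Aut C|%:R); last first.
  by apply/funext => n; rewrite surj_count_cok mulrC mulKf.
apply: cvgM; last exact: cvg_cst.
rewrite (_ : (fun n => _) = fun n =>
  (surj_count C n k.+1 mu - surj_count C n k.+1 U) + surj_count C n k.+1 U); last first.
  by apply/funext => n; rewrite subrK.
rewrite -[X in _ --> X]add0r; apply: cvgD => //.
exact: (cvg_surj_count_dist mu0 musum mu1 mu2 c12).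
Unshelve. all: by end_near. Qed.

End Good.
End Universality.

(** * Reduction from the p-adic integers *)

Section CokernelProjection.
Variables (A : comNzRingType) (n : nat) (M : 'M[A]_n).
Local Open Scope quotient_scope.

(** The quotient is traded for a homomorphism from the free module onto B with kernel the image of
    M, which can be compared with its residue. *)
Lemma Cok_isogP (gT : finGroupType) (B : {group gT}) : Cok_isog M B <->
  exists g : 'cV[A]_n -> gT, [/\ {morph g : x y / x + y >-> (x * y)%g}, forall x, g x \in B,
    forall b, b \in B -> exists x, g x = b & forall x, g x = 1%g <-> exists z, x = M *m z].
Proof.
have piE (x y : 'cV[A]_n) : \pi_(Cok M) x = \pi_(Cok M) y <-> exists z, x - y = M *m z.
  rewrite /Cok; split=> [/eqP|[z e]].
    by rewrite -Quotient.idealrBE => /asboolP.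
  by apply/eqP; rewrite -Quotient.idealrBE; apply/asboolP; exists z.
have piD (x y : 'cV[A]_n) : \pi_(Cok M) (x + y) = \pi_(Cok M) x + \pi_(Cok M) y.
  by rewrite /Cok raddfD.
split=> [[f [fD [fB fI fS]]]|[g [gD gB gS gK]]].
  have f0 : f 0 = 1%g by apply: (mulgI (f 0)); rewrite -fD addr0 mulg1.
  exists (fun x => f (\pi_(Cok M) x)); split.
  - by move=> x y; rewrite piD fD.
  - by move=> x; apply: fB.
  - move=> b Bb; have [c _ fc] := fS b Bb; exists (repr c); by rewrite reprK.
  - move=> x; have pi0 : \pi_(Cok M) (0 : 'cV[A]_n) = 0 by apply: (addrI (\pi_(Cok M) 0)); rewrite -piD !addr0.
    rewrite -f0 -pi0; split=> [/fI e|[z ->]].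
      have [|z] := (piE x 0).1; last by rewrite subr0 => ->; exists z.
      by apply: e; rewrite inE.
    by congr f; apply/piE; exists z; rewrite subr0.
have g0 : g 0 = 1%g by apply: (mulgI (g 0)); rewrite -gD addr0 mulg1.
have gV x : g (- x) = (g x)^-1%g by apply: (mulgI (g x)); rewrite -gD subrr mulgV.
have gE x y : g x = g y <-> \pi_(Cok M) x = \pi_(Cok M) y.
  rewrite piE -gK gD gV; split=> [->|]; first by rewrite mulgV.
  by move/(congr1 (fun t => t * g y)%g); rewrite mulgKV mul1g.
have gr x : g (repr (\pi_(Cok M) x)) = g x by apply/gE; rewrite reprK.
exists (fun c => g (repr c)); split=> [c d|].
  by rewrite -[c]reprK -[d]reprK -piD !gr gD.
split=> [c _|c d _ _|b Bb]; first exact: gB.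
  by move/gE; rewrite !reprK.
by have [x gx] := gS b Bb; exists (\pi_(Cok M) x) => //; rewrite gr.
Qed.

End CokernelProjection.

(** A named copy of the projection [padic_seq], to carry the ring morphism structure. *)
Definition padic_red (p n : nat) (x : padic p) : 'Z_(p ^ n.+1) := padic_seq x n.

Section PadicRed.
Variables p n : nat.

Lemma padic_red_zmod_morphism : zmod_morphism (@padic_red p n).
Proof. by []. Qed.
HB.instance Definition _ :=
  GRing.isZmodMorphism.Build (padic p) ('Z_(p ^ n.+1)) (@padic_red p n) padic_red_zmod_morphism.

Lemma padic_red_monoid_morphism : monoid_morphism (@padic_red p n).
Proof. by []. Qed.
HB.instance Definition _ :=
  GRing.isMonoidMorphism.Build (padic p) ('Z_(p ^ n.+1)) (@padic_red p n) padic_red_monoid_morphism.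

End PadicRed.

Section Padic.
Variable p : nat.
Hypothesis p_pr : prime p.
Let p_gt0 := prime_gt0 p_pr.

Lemma Zppow_modulus n : (Zp_trunc (p ^ n.+1)).+2 = (p ^ n.+1)%N.
Proof. exact: Zp_cast (ppow_gt1 n p_pr). Qed.

Lemma Zq_mul_val n (a b : 'Z_(p ^ n.+1)) : (a * b : 'Z_(p ^ n.+1)) = (a * b %% p ^ n.+1)%N :> nat.
Proof. by congr (_ %% _)%N; exact: Zppow_modulus. Qed.

Lemma padic_red_succ (x : padic p) n :
  (padic_red n x : nat) = (padic_red n.+1 x %% p ^ n.+1)%N.
Proof.
have e := congr1 (@nat_of_ord _) (padicE x n); apply: etrans (esym e) _.
by congr (_ %% _)%N; exact: Zppow_modulus.
Qed.

Lemma padic_red_add (x : padic p) n l :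
  (padic_red n x : nat) = (padic_red (n + l) x %% p ^ n.+1)%N.
Proof.
elim: l => [|l IH].
  by rewrite addn0 modn_small // -[X in (_ < X)%N](Zppow_modulus n) ltn_ord.
rewrite IH addnS padic_red_succ modn_dvdm // dvdn_exp2l //.
by rewrite ltnS leq_addr.
Qed.

Lemma padic_coherentP (a : forall n, nat) :
  (forall n, a n = a n.+1 %[mod p ^ n.+1]) ->
  exists y : padic p, forall n, padic_red n y = (a n)%:R.
Proof.
move=> ha; have coh : @padic_coherent p (fun n => (a n)%:R).
  apply/asboolP => n; apply: val_inj => /=.
  rewrite !val_Zp_nat ?ppow_gt1 // Zppow_modulus modn_dvdm ?ha //.
  by rewrite dvdn_exp2l.
by exists (Padic coh).
Qed.

(** The quotient is a shift: its residue at level n is the representative of x at level n + m + 1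
    divided by p^(m+1). *)
Lemma padic_red_eq0 m (x : padic p) :
  padic_red m x = 0 -> exists y, x = (p ^ m.+1)%:R * y.
Proof.
move=> xm0; pose b n := (padic_red (n + m.+1) x : nat).
have qb n : (p ^ m.+1 %| b n)%N.
  by have := padic_red_add x m n.+1; rewrite addnS -addSn addnC -/(b n) xm0 => /esym/eqP.
have [|y yP] := @padic_coherentP (fun n => b n %/ p ^ m.+1)%N.
  move=> n; rewrite /b [in LHS]padic_red_succ -addSn.
  set c := nat_of_ord _; have -> : (p ^ (n + m.+1).+1 = p ^ n.+1 * p ^ m.+1)%N by rewrite -expnD addSn.
  by rewrite divn_modl ?dvdn_mull // mulnK ?expn_gt0 ?p_gt0 // modn_mod.
exists y; apply: padic_eqP => n.
rewrite -[RHS]/(padic_red n _) rmorphM rmorph_nat /= yP -natrM mulnC divnK //.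
apply: val_inj; rewrite /= val_Zp_nat ?ppow_gt1 //.
exact: padic_red_add.
Qed.

Lemma padic_red_lift m (a : 'Z_(p ^ m.+1)) : padic_red m (a : nat)%:R = a.
Proof. by rewrite rmorph_nat natr_Zp. Qed.

(** Every residue of x is a unit, being prime to p, and the inverses at successive levels are
    coherent by uniqueness of inverses. *)
Lemma padic_inv (x : padic p) : padic_red 0 x = 1 -> exists y, x * y = 1.
Proof.
move=> x1; have xu n : padic_red n x \is a GRing.unit.
  rewrite -[padic_red n x]natr_Zp unitZpE ?ppow_gt1 // coprime_pexpl // prime_coprime //.
  apply/negP => pd; have := padic_red_add x 0 n; rewrite add0n x1 expn1.
  by move/eqP: pd; rewrite /dvdn => ->.
have [|y yP] := @padic_coherentP (fun n => ((padic_red n x)^-1 : nat)).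
  move=> n; have h : ((((padic_red n.+1 x)^-1 : nat)%:R : 'Z_(p ^ n.+1)) = (padic_red n x)^-1).
    have redE : padic_red n x = (padic_red n.+1 x : nat)%:R.
      apply: val_inj; rewrite /= val_Zp_nat ?ppow_gt1 //; exact: padic_red_succ.
    apply: (mulIr (xu n)); rewrite (mulVr (xu n)) redE.
    rewrite -(natrM ('Z_(p ^ n.+1))).
    have e : ((padic_red n.+1 x)^-1 * padic_red n.+1 x = 1 %[mod p ^ n.+2])%N.
      by rewrite -Zq_mul_val (mulVr (xu n.+1)) modn_small // ppow_gt1.
    apply: val_inj; rewrite /= val_Zp_nat ?ppow_gt1 //.
    rewrite -(@modn_dvdm (p ^ n.+2)) ?dvdn_exp2l // e.
    by rewrite modn_dvdm ?dvdn_exp2l // modn_small // ppow_gt1.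
  have := congr1 (@nat_of_ord _) h; rewrite val_Zp_nat ?ppow_gt1 // => <-.
  by rewrite modn_mod.
exists y; apply: padic_eqP => n; rewrite -[LHS]/(padic_red n _) rmorphM /= yP natr_Zp.
exact: divrr (xu n).
Qed.

End Padic.

Section CokernelEvent.
Variables (p m s n : nat) (C : {group 'cV['Z_(p ^ m.+1)]_s}).
Hypothesis p_pr : prime p.
Local Notation q := (p ^ m.+1)%N.
Local Notation R := ('Z_q).
Variables (gT : finGroupType) (B : {group gT}).
Hypotheses (pC : forall x : 'cV[R]_s, x \in C -> p%:R ^+ m *: x = 0) (isoCB : C \isog B).
Implicit Type A : 'M[padic p]_n.

Let red a b (X : 'M[padic p]_(a, b)) : 'M[R]_(a, b) := map_mx (@padic_red p m) X.

Let red_lift a b (X : 'M[R]_(a, b)) : exists Y, red Y = X.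
Proof.
exists (\matrix_(i, j) (X i j : nat)%:R).
by apply/matrixP => i j; rewrite !mxE padic_red_lift.
Qed.

Let red_eq0 a b (X : 'M[padic p]_(a, b)) : red X = 0 -> exists Y, X = q%:R *: Y.
Proof.
move=> X0; have h (ij : 'I_a * 'I_b) : exists y, X ij.1 ij.2 = q%:R * y.
  by apply: (padic_red_eq0 p_pr); have /matrixP/(_ ij.1 ij.2) := X0; rewrite !mxE.
have [y yP] := fin_all_exists h; exists (\matrix_(i, j) y (i, j)).
by apply/matrixP => i j; rewrite !mxE -(yP (i, j)).
Qed.

Let unit_1subp (Y : 'M[padic p]_n) : exists E, (1%:M - p%:R *: Y) *m E = 1%:M.
Proof.
set D := 1%:M - _; have detD : padic_red 0 (\det D) = 1.
  rewrite -det_map_mx map_mxB map_mx1 map_mxZ rmorph_nat.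
  rewrite (_ : p%:R = 0) ?scale0r ?subr0 ?det1 //.
  by apply/eqP; rewrite natr_Zq_eq0 // expn1.
have [u du] := padic_inv p_pr detD; exists (u *: \adj D).
by rewrite -scalemxAr mul_mx_adj scale_scalar_mx mulrC du.
Qed.

(* For the converse: ker F contains p^m R^n, so p^m = A Z + p^(m+1) Y with 1 - p Y invertible;
   hence p^(m+1) Z_p^n lies in the image of A, and im A is the preimage of its residue. *)
Lemma Cok_isog_event A : Cok_isog A B <-> cok_event C (red A).
Proof.
have /isogP[kap injk imk] := isoCB.
rewrite Cok_isogP; split=> [[g [gD gB gS gK]]|/existsP[F /andP[/eqP FC /eqP FA]]].
  have g0 : g 0 = 1%g by apply: (mulgI (g 0)); rewrite -gD addr0 mulg1.
  pose G x : 'cV[R]_s := invm injk (g x).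
  have gI x : g x \in (kap @* C)%g by rewrite imk.
  have GC x : G x \in C.
    by have := mem_morphim (invm_morphism injk) (gI x) (gI x); rewrite im_invm.
  have GD x y : G (x + y) = G x + G y by rewrite /G gD morphM.
  have G0 : G 0 = 0 by apply: (addrI (G 0)); rewrite -GD !addr0.
  have GMn x k : G (x *+ k) = G x *+ k.
    by elim: k => [|k IH]; rewrite ?mulr0n // !mulrS GD IH.
  have Gq x : G (q%:R *: x) = 0.
    by rewrite scaler_nat GMn -scaler_nat ppow_eq0 ?scale0r.
  (* [G] kills q times every vector, so it factors through the residues, and [F] is the matrix of
     the induced map. *)
  pose F : 'M[R]_(s, n) := \matrix_(i, j) G (delta_mx j 0) i 0.
  have colF j : col j F = G (delta_mx j 0) by apply/colP => i; rewrite !mxE.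
  have GF x : F *m red x = G x.
    rewrite mulmx_sum_col; have -> : G x = \sum_j G (x j 0 *: delta_mx j 0).
      rewrite -(big_morph G GD G0); congr G; apply/colP => i.
      rewrite summxE (bigD1 i) //= big1 => [|j ji]; rewrite !mxE ?eqxx ?mulr1 ?addr0 //.
      by rewrite eq_sym (negbTE ji) mulr0.
    apply: eq_bigr => j _; rewrite colF mxE.
    have [|b xb] := @padic_red_eq0 p p_pr m (x j 0 - (padic_red m (x j 0) : nat)%:R).
      by rewrite rmorphB /= padic_red_lift subrr.
    rewrite -[x j 0 in RHS](subrK (padic_red m (x j 0) : nat)%:R) xb scalerDl GD.
    by rewrite -scalerA Gq add0r scaler_nat GMn -scaler_nat natr_Zp.
  apply/existsP; exists F; apply/andP; split; apply/eqP/setP => y.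
    apply/mimgP/idP => [[x ->]|Cy].
      by have [x' <-] := red_lift x; rewrite GF.
    have [|x gx] := gS (kap y); first by rewrite -imk mem_morphim.
    by exists (red x); rewrite GF /G gx invmE.
  rewrite inE; apply/eqP/mimgP => [Fy|[z ->]].
    have [x xy] := red_lift y; rewrite -xy GF in Fy.
    have /gK[z xz] : g x = 1%g.
      by apply: (injmP (injm_invm injk)) => //; rewrite ?morph1 // group1.
    by exists (red z); rewrite -xy xz /red map_mxM.
  have [z' <-] := red_lift z; rewrite -map_mxM GF /G.
  have -> : g (A *m z') = 1%g by apply/gK; exists z'.
  by rewrite morph1.
have Fq (x : 'cV[R]_n) : p%:R ^+ m *: (F *m x) = 0 by apply: pC; rewrite -FC mem_mimg.
have [Z [Y ZY]] : exists Z Y : 'M[padic p]_n, p%:R ^+ m *: 1%:M = A *m Z + q%:R *: Y.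
  have h j : exists zy : 'cV[padic p]_n * 'cV[padic p]_n,
      p%:R ^+ m *: delta_mx j 0 = A *m zy.1 + q%:R *: zy.2.
    have : p%:R ^+ m *: delta_mx j 0 \in mxker F by rewrite inE -scalemxAr Fq.
    rewrite FA => /mimgP[z ez]; have [z' z'z] := red_lift z.
    have [|y yP] := @red_eq0 _ _ (p%:R ^+ m *: delta_mx j 0 - A *m z').
      rewrite /red map_mxB map_mxZ map_mxM -/(red A) -/(red z') z'z -ez.
      by rewrite rmorphXn rmorph_nat map_delta_mx subrr.
    by exists (z', y); rewrite /= -yP addrC subrK.
  have [zy zyP] := fin_all_exists h.
  exists (\matrix_(i, j) (zy j).1 i 0), (\matrix_(i, j) (zy j).2 i 0).
  apply/matrixP => i j; have /colP/(_ i) := zyP j; rewrite !mxE eqxx andbT => ->.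
  by congr (_ + _); apply: eq_bigr => l _; rewrite mxE.
have [E DE] := unit_1subp Y.
have qA (y : 'cV[padic p]_n) : exists z, q%:R *: y = A *m z.
  exists (Z *m (E *m (p%:R *: y))).
  have ZE : A *m Z = p%:R ^+ m *: (1%:M - p%:R *: Y).
    by rewrite scalerBr ZY scalerA -exprSr natrX addrK.
  by rewrite mulmxA ZE -scalemxAl mulmxA DE mul1mx scalerA -exprSr natrX.
have imF (x : 'cV[R]_n) : F *m x \in C by rewrite -FC mem_mimg.
exists (fun x => kap (F *m red x)); split.
- by move=> x y; rewrite /red map_mxD mulmxDr -morphM.
- by move=> x; rewrite -imk mem_morphim.
- move=> b; rewrite -imk => /morphimP[c _ Cc ->].
  have /mimgP[x ->] : c \in mimg F by rewrite FC.
  by have [x' <-] := red_lift x; exists x'.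
move=> x; split=> [k1|[z ->]].
  have : red x \in mxker F.
    by rewrite inE; apply/eqP/(injmP injk); rewrite ?imF ?group1 // k1 morph1.
  rewrite FA => /mimgP[z xz]; have [z' z'z] := red_lift z.
  have [|y yP] := @red_eq0 _ _ (x - A *m z').
    by rewrite /red map_mxB map_mxM -/(red A) -/(red z') -/(red x) z'z -xz subrr.
  have [w wP] := qA y; exists (z' + w).
  by rewrite mulmxDr -wP -yP addrC subrK.
have : red (A *m z) \in mxker F by rewrite FA /red map_mxM mem_mimg.
by rewrite inE => /eqP ->; rewrite morph1.
Qed.

End CokernelEvent.

Lemma Ex_ffun (q : nat) (K : rcfType) n (mu : 'Z_q -> K) k (g : 'M['Z_q]_n -> K) :
  Ex mu k g = \sum_(a : {ffun 'I_k -> 'M['Z_q]_n})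
    (\prod_l mweight mu (a l)) * g (\prod_(l < k) a l).
Proof.
elim: k g => [|k IH] g /=.
  rewrite (big_pred1 [ffun=> 0]) => [|a]; last first.
    by apply/esym/eqP/ffunP => l; have := ltn_ord l.
  by rewrite !big_ord0 mul1r.
pose h (Aa : 'M['Z_q]_n * {ffun 'I_k -> 'M['Z_q]_n}) : {ffun 'I_k.+1 -> 'M['Z_q]_n} :=
  [ffun i => if unlift ord0 i is Some j then Aa.2 j else Aa.1].
rewrite (reindex h) /=; last first.
  exists (fun a : {ffun 'I_k.+1 -> _} => (a ord0, [ffun j => a (lift ord0 j)])) => [[A a] _|a _].
    rewrite /h !ffunE unlift_none; congr pair; apply/ffunP => j.
    by rewrite !ffunE liftK.
  by apply/ffunP => i; rewrite ffunE; case: unliftP => [j ->|->]; rewrite ?ffunE.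
rewrite -(pair_big xpredT xpredT (fun A a =>
  (\prod_l mweight mu (h (A, a) l)) * g (\prod_(l < k.+1) h (A, a) l))) /=.
apply: eq_bigr => A _; rewrite IH mulr_sumr; apply: eq_bigr => a _.
rewrite !big_ord_recl mulrA /h ffunE unlift_none /=.
by congr (_ * _ * g (_ * _)); apply: eq_bigr => j _; rewrite ffunE liftK.
Qed.

Lemma measurable_padic_red p m (c : 'Z_(p ^ m.+1)) :
  measurable [set x : padic p | padic_red m x = c].
Proof. by apply: sub_sigma_algebra; exists m, c. Qed.

(** * From p-adic random matrices to weighted sums over residues *)

Section MeasureReduction.
Variables (R : realType) (p m : nat).
Hypothesis p_pr : prime p.
Local Notation q := (p ^ m.+1)%N.

Lemma probability_finite_cover d (T : measurableType d) (P : probability T R)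
    (I : finType) (D : pred I) (F : I -> set T) :
    (forall i, measurable (F i)) -> (forall i j w, F i w -> F j w -> i = j) ->
  P (\bigcup_(i in [set i | D i]) F i) = (\sum_(i | D i) P (F i))%E.
Proof.
move=> mF tF; have finD : finite_set [set i | D i] by exact: finite_finset.
rewrite measure_fin_bigcup //; last first.
  apply/trivIsetP => i j _ _ ij; rewrite -subset0 => w [Fi Fj].
  by move/eqP: ij; apply; apply: tF Fi Fj.
rewrite fsbig_finite // -[RHS]big_filter; apply: perm_big; apply: uniq_perm.
- exact: finmap.fset_uniq.
- by rewrite filter_uniq // index_enum_uniq.
move=> i; rewrite in_fset_set // mem_filter mem_index_enum andbT.
by apply/idP/idP; rewrite inE.
Qed.

Variables (d0 : measure_display) (T0 : measurableType d0) (P0 : probability T0 R).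
Variable xi : {RV P0 >-> padic p}.

Definition residue_law (c : 'Z_q) : R := fine (P0 (xi @^-1` [set x | padic_red m x = c])).

Lemma measurable_residue c : measurable (xi @^-1` [set x | padic_red m x = c]).
Proof.
rewrite -[X in measurable X]setTI; apply: measurable_funP => //.
exact: measurable_padic_red.
Qed.

Lemma residue_lawE c :
  (residue_law c)%:E = P0 (xi @^-1` [set x | padic_red m x = c]).
Proof. by rewrite fineK // fin_num_measure //; exact: measurable_residue. Qed.

Lemma residue_law_ge0 c : 0 <= residue_law c.
Proof. by apply: fine_ge0; exact: measure_ge0. Qed.

Lemma residue_law_sum (D : pred 'Z_q) :
  (\sum_(c | D c) residue_law c)%:E = P0 [set w | D (padic_red m (xi w))].
Proof.
rewrite -sumEFin; under eq_bigr => c _ do rewrite residue_lawE.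
rewrite -(@probability_finite_cover _ _ P0 _ D
  (fun c => xi @^-1` [set x | padic_red m x = c])).
- congr (P0 _); apply/seteqP; split=> [w [c /= Dc e]|w /= Dw]; first by rewrite /= e.
  by exists (padic_red m (xi w)).
- exact: measurable_residue.
- by move=> c c' w /= <- <-.
Qed.

Lemma residue_law_total : \sum_c residue_law c = 1.
Proof.
apply: EFin_inj; rewrite (residue_law_sum xpredT) (_ : [set w | _] = setT) ?probability_setT //.
by apply/seteqP; split.
Qed.

Let residue_unit (a b : 'Z_q) :
  (a - b \is a GRing.unit) = ((b : nat)%:R != (a : nat)%:R :> 'Z_(p ^ 1)).
Proof.
set c := a - b; have -> : a = b + c by rewrite addrC subrK.
have -> : (nat_of_ord (b + c)%R)%:R = (b : nat)%:R + (c : nat)%:R :> 'Z_(p ^ 1).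
  rewrite -natrD [in RHS](divn_eq ((b : nat) + (c : nat))%N q) natrD natrM.
  have -> : q%:R = 0 :> 'Z_(p ^ 1).
    by apply/eqP; rewrite (natr_Zq_eq0 0 p_pr) expn1 expnS dvdn_mulr.
  rewrite mulr0 add0r; congr (_%:R); congr (_ %% _)%N; exact: Zppow_modulus.
rewrite -[c in LHS]natr_Zp unitZpE ?ppow_gt1 // coprime_pexpl // prime_coprime //.
rewrite -subr_eq0 opprD addrA subrr add0r oppr_eq0 (natr_Zq_eq0 0 p_pr).
by rewrite expn1.
Qed.

Let padic_red_modp (x : padic p) : padic_modp x = (padic_red m x : nat)%:R :> 'Z_(p ^ 1).
Proof.
apply: val_inj; rewrite /= val_Zp_nat ?(ppow_gt1 0) //.
exact: (padic_red_add p_pr x 0 m).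
Qed.

(** Some residue [c1] has positive mass; if every residue of positive mass were congruent to it mod
    p, then [xi] would be constant mod p with probability 1. *)
Lemma residue_law_support : ~ constant_modp P0 xi ->
  exists c1 c2, [/\ 0 < residue_law c1, 0 < residue_law c2 & (c1 - c2) \is a GRing.unit].
Proof.
move=> nconst.
have [c1 p1] : exists c, 0 < residue_law c.
  apply: contrapT => nall; have := residue_law_total; rewrite big1 => [/esym/eqP|c _].
    by rewrite oner_eq0.
  apply/eqP; rewrite eq_le residue_law_ge0 andbT leNgt; apply/negP => pc.
  by apply: nall; exists c.
have [c2 [p2 c12]] : exists c, 0 < residue_law c /\ (c1 - c) \is a GRing.unit.
  apply: contrapT => nall; apply: nconst; exists (c1 : nat)%:R.
  have <- : (\sum_(c : 'Z_q | (c1 - c) \isn't a GRing.unit) residue_law c)%:E = 1%E.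
    congr EFin; rewrite -residue_law_total [RHS](bigID (fun c => (c1 - c) \is a GRing.unit)) /=.
    rewrite [X in _ = X + _]big1 ?add0r // => c uc.
    apply/eqP; rewrite eq_le residue_law_ge0 andbT leNgt; apply/negP => pc.
    by apply: nall; exists c.
  rewrite residue_law_sum; congr (P0 _); apply/seteqP; split=> w /=;
    rewrite residue_unit -padic_red_modp negbK; first by move/eqP.
  by move=> e; apply/eqP.
by exists c1, c2.
Qed.

Variables (d : measure_display) (T : measurableType d) (P : probability T R).
Variables (n k : nat) (M : 'I_k -> T -> 'M[padic p]_n).
Hypothesis M_meas : forall l (i j : 'I_n), measurable_fun [set: T] (fun w => M l w i j).
Hypothesis M_law : forall l (i j : 'I_n) (A : set (padic p)), measurable A ->
  P ((fun w => M l w i j) @^-1` A) = distribution P0 xi A.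
Hypothesis M_indep : independent_RVs P
  (fun (e : 'I_k * 'I_n * 'I_n) w => M e.1.1 w e.1.2 e.2).

(** The event is a disjoint union of cylinders [F a] that fix all residues, and independence gives
    each of them the product weight that it has in [Ex_ffun]. *)
Lemma prob_residues (E : pred 'M['Z_q]_n) :
  P [set w | E (map_mx (@padic_red p m) (\prod_(l < k) M l w))] =
  (Ex residue_law k (fun A : 'M['Z_q]_n => (E A)%:R))%:E.
Proof.
pose F (a : {ffun 'I_k -> 'M['Z_q]_n}) : set T :=
  \bigcap_(e in [set` [set: 'I_k * 'I_n * 'I_n]%SET])
    ((fun w => M e.1.1 w e.1.2 e.2) @^-1` [set x | padic_red m x = a e.1.1 e.1.2 e.2]).
have FP a w : F a w <-> forall l, map_mx (@padic_red p m) (M l w) = a l.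
  split=> [Fw l|h e _ /=]; last by rewrite -h mxE.
  by apply/matrixP => i j; rewrite mxE; apply: (Fw (l, i, j)); rewrite /= inE.
have PF a : P (F a) = (\prod_l mweight residue_law (a l))%:E.
  rewrite /F M_indep => [|e _]; last exact: measurable_padic_red.
  rewrite (eq_bigr (fun e : 'I_k * 'I_n * 'I_n =>
    (residue_law (a e.1.1 e.1.2 e.2))%:E)) => [|e _]; last first.
    by rewrite M_law; [rewrite residue_lawE|exact: measurable_padic_red].
  rewrite -(big_morph EFin EFinM erefl); congr EFin.
  rewrite (eq_bigl xpredT) => [|e]; last by rewrite inE.
  rewrite -(pair_big xpredT xpredT (fun li j => residue_law (a li.1 li.2 j))) /=.
  rewrite -(pair_big xpredT xpredT (fun l i => \prod_j residue_law (a l i j))) /=.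
  by apply: eq_bigr => l _; rewrite exchange_big.
have mF a : measurable (F a).
  apply: fin_bigcap_measurable; first exact: finite_finset.
  move=> e _; rewrite -[X in measurable X]setTI; apply: M_meas => //.
  exact: measurable_padic_red.
have red_prod w : map_mx (@padic_red p m) (\prod_(l < k) M l w) =
    \prod_(l < k) map_mx (@padic_red p m) (M l w).
  by apply: (big_morph _ (fun A B => map_mxM _ A B)); exact: map_mx1.
rewrite (_ : [set w | _] = \bigcup_(a in [set a : {ffun 'I_k -> 'M['Z_q]_n} | E (\prod_(l < k) a l)]) F a); last first.
  apply/seteqP; split=> w /=.
    rewrite red_prod => Ew; exists [ffun l => map_mx (@padic_red p m) (M l w)].
      by rewrite /= (eq_bigr (fun l => map_mx (@padic_red p m) (M l w))) // => l _; rewrite ffunE.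
    by apply/FP => l; rewrite ffunE.
  move=> [a /= Ea /FP Fa]; rewrite red_prod (eq_bigr (fun l => a l)) // => l _; exact: Fa.
rewrite probability_finite_cover //; last first.
  by move=> a b w /FP Fa /FP Fb; apply/ffunP => l; rewrite -Fa -Fb.
under eq_bigr => a _ do rewrite PF.
rewrite sumEFin Ex_ffun; congr EFin; rewrite big_mkcond; apply: eq_bigr => a _.
by case: (E _); rewrite ?mulr1 ?mulr0.
Qed.

End MeasureReduction.

Theorem theorem8p2 (R : realType) (p k : nat) (p_prime : prime p) (k_ge1 : (1 <= k)%N)
    (d0 : measure_display) (T0 : measurableType d0) (P0 : probability T0 R)
    (xi : {RV P0 >-> padic p}) (xi_nonconst : ~ constant_modp P0 xi)
    (d : nat -> measure_display) (T : forall n, measurableType (d n))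
    (P : forall n, probability (T n) R)
    (M : forall n, 'I_k -> T n -> 'M[padic p]_n)
    (M_meas : forall n (l : 'I_k) (i j : 'I_n),
      measurable_fun [set: T n] (fun w => M n l w i j))
    (M_law : forall n (l : 'I_k) (i j : 'I_n) (A : set (padic p)), measurable A ->
      P n ((fun w => M n l w i j) @^-1` A) = distribution P0 xi A)
    (M_indep : forall n, independent_RVs (P n)
      (fun (e : 'I_k * 'I_n * 'I_n) w => M n e.1.1 w e.1.2 e.2))
    (gT : finGroupType) (B : {group gT}) (B_abelian : abelian B) (B_pgroup : (p.-group B)%g) :
  P n [set w | Cok_isog (\prod_(l < k) M n l w) B] @[n --> \oo] -->
  (qpoch_inf (p%:R^-1) (p%:R^-1) ^+ k
    * (#|subgroup_chains B k|%:R / #|Aut B|%:R) : R)%:E.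
Proof.
have oB := card_pgroup B_pgroup; set m := logn p #|B| in oB.
have [s [C isoCB]] := abelian_embedding p_prime B_abelian oB.
have pC (x : 'cV['Z_(p ^ m.+1)]_s) : x \in C -> p%:R ^+ m *: x = 0.
  by move=> Cx; rewrite -natrX scaler_nat -FinRing.zmodXgE -oB -(card_isog isoCB) expg_cardG.
have [c1 [c2 [mu1 mu2 c12]]] := residue_law_support m p_prime xi_nonconst.
have -> : #|subgroup_chains B k| = group_cochains B k 1%G by exact: card_group_chains.
have probE n : P n [set w | Cok_isog (\prod_(l < k) M n l w) B] =
    (Ex (residue_law (m := m) xi) k (fun A : 'M['Z_(p ^ m.+1)]_n => (cok_event C A)%:R))%:E.
  rewrite -(prob_residues (M_meas n) (M_law n) (M_indep n)).
  congr (P n _); apply/seteqP; split=> w /=; first by move/(Cok_isog_event p_prime pC isoCB).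
  by move=> h; apply/(Cok_isog_event p_prime pC isoCB).
rewrite (_ : (fun n => _) = fun n => (Ex (residue_law (m := m) xi) k
  (fun A : 'M['Z_(p ^ m.+1)]_n => (cok_event C A)%:R))%:E); last exact/funext.
case: k k_ge1 {M M_meas M_law M_indep probE} => // k _.
apply: cvg_EFin; first by near=> n.
exact: (cvg_cok_event p_prime pC isoCB (residue_law_ge0 (m := m) xi) (residue_law_total m xi) mu1 mu2 c12).
Unshelve. all: by end_near. Qed.
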